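(* Let $K$ be the Vicsek set equipped with its geodesic distance $d$ and normalized Hausdorff measure $\mu$. Then the property $\mathcal P(p,\alpha_p)$ holds on $(K,d,\mu)$ for every $p\ge1$. Therefore, if $p>1$, there exist constants $C_1,C_2>0$ such that for every $f\in KS^{\alpha_p,p}(K)$, $$C_1\,\mathrm{Var}_p(f)^p\le\mathcal E_p(f)\le C_2\,\mathrm{Var}_p(f)^p.$$
   Context: Vicsek set: let $q_1=(-\tfrac{\sqrt2}2,\tfrac{\sqrt2}2)$, $q_2=(\tfrac{\sqrt2}2,\tfrac{\sqrt2}2)$, $q_3=(\tfrac{\sqrt2}2,-\tfrac{\sqrt2}2)$, $q_4=(-\tfrac{\sqrt2}2,-\tfrac{\sqrt2}2)$, $q_5=(0,0)$, and $\psi_i(z)=\frac13(z-q_i)+q_i$, $1\le i\le5$. $K$ is the unique non-empty compact set with $K=\bigcup_{i=1}^5\psi_i(K)$. Let $V_0=\{q_1,\dots,q_5\}$, $V_{n+1}=\bigcup_{i=1}^5\psi_i(V_n)$. Let $\bar V_0\subset K$ be the cable system with vertices $V_0$ (the union of the four segments of length $1$ joining $q_5$ to $q_1,\dots,q_4$) and $\bar V_{n+1}=\bigcup_{i=1}^5\psi_i(\bar V_n)$; $\bar V_n\subset K$ has vertex set $V_n$ and edges of length $3^{-n}$, and $\bigcup_n\bar V_n$ is dense in $K$. For $x,y\in V_n$, $x\sim y$ means that $x,y$ are neighbors, i.e. joined by an edge of $\bar V_n$. The geodesic distance $d$: for $x,y\in\bar V_n$, $d(x,y)$ is the length of the geodesic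 path in $\bar V_n$ between $x$ and $y$, and $d$ is extended by continuity to $K\times K$. $\mu$ is the unique Borel measure on $K$ with $\mu(\psi_{i_1}\circ\cdots\circ\psi_{i_n}(K))=5^{-n}$ for all $i_1,\dots,i_n\in\{1,\dots,5\}$. Let $B(x,r)=\{y\in K:d(x,y)<r\}$. For $p\ge1$, $\alpha\ge0$, $r>0$, $f\in L^p(K,\mu)$ put $$E_{p,\alpha}(f,r)=\int_K\frac{1}{\mu(B(x,r))}\int_{B(x,r)}\frac{|f(y)-f(x)|^p}{r^{p\alpha}}\,d\mu(y)\,d\mu(x).$$ $\mathcal B^{\alpha,p}(K)=\{f\in L^p(K,\mu):\sup_{r>0}E_{p,\alpha}(f,r)<+\infty\}$, $KS^{\alpha,p}(K)=\{f\in L^p(K,\mu):\limsup_{r\to0}E_{p,\alpha}(f,r)<+\infty\}$. ''Constant'' means constant $\mu$-a.e. $\alpha_p=\sup\{\alpha\ge0:\mathcal B^{\alpha,p}(K)\text{ contains non-constant functions}\}$; on the Vicsek set it is known that $\alpha_p=1+\frac{d_h-1}p$ with $d_h=\frac{\log5}{\log3}$. Property $\mathcal P(p,\alpha)$: $KS^{\alpha,p}(K)$ contains non-constant functions and there is a constant $C\ge1$ such that for every $f\in KS^{\alpha,p}(K)$, $\sup_{r>0}E_{p,\alpha}(f,r)\le C\liminf_{r\to0}E_{p,\alpha}(f,r)$. $\mathrm{Var}_p(f)=\liminf_{r\to0}E_{p,\alpha_p}(f,r)^{1/p}$. For $p>1$ every $f\in KS^{\alpha_p,p}(K)$ has a continuous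 version, and $KS^{\alpha_p,p}(K)$ is regarded as a subset of $C(K)$. For $p>1$ and $f\in C(K)$: $\mathcal E_p^m(f)=\frac12 3^{(p-1)m}\sum_{x,y\in V_m,\,x\sim y}|f(x)-f(y)|^p$, which is non-decreasing in $m$, and $\mathcal E_p(f)=\lim_{m\to\infty}\mathcal E_p^m(f)\in[0,+\infty]$. *)

(* Defs.v *)
From HB Require Import structures.
From mathcomp Require Import all_boot all_order all_algebra.
From mathcomp Require Import all_classical all_reals all_analysis.

Set Implicit Arguments.
Unset Strict Implicit.
Unset Printing Implicit Defensive.

Import Order.TTheory GRing.Theory Num.Theory.
Import numFieldNormedType.Exports.

Local Open Scope classical_set_scope.
Local Open Scope ring_scope.

Definition borel_plane (R : realType) :=
  g_sigma_algebraType (@open (R * R)%type).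

(* The product type R * R carries the usual topology of the plane, but its
   library norm is the sup norm; lengths are measured with [eucl_dist]. *)
Definition eucl_dist (R : realType) (x y : R * R) : R :=
  Num.sqrt ((x.1 - y.1) ^+ 2 + (x.2 - y.2) ^+ 2).

Definition segment (R : realType) (a b : R * R) : set (R * R) :=
  [set (1 - t) *: a + t *: b | t in `[0, 1]%classic].

(* [q] is indexed from 0: the corners q_1, ..., q_4 have indices 0, ..., 3 and
   the centre q_5 has index [ord_max]. *)
Definition q (R : realType) (i : 'I_5) : R * R :=
  let s := Num.sqrt 2 / 2 in
  nth (0, 0) [:: (- s, s); (s, s); (s, - s); (- s, - s); (0, 0)] i.

Definition psi (R : realType) (i : 'I_5) (z : R * R) : R * R :=
  3^-1 *: (z - q R i) + q R i.

Definition is_vicsek_set (R : realType) (K : set (R * R)) : Prop :=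
  [/\ K !=set0, compact K & K = \bigcup_(i in [set: 'I_5]) (psi i @` K)].

Fixpoint V (R : realType) (n : nat) : set (R * R) :=
  if n is m.+1 then \bigcup_(i in [set: 'I_5]) (psi i @` V m)
  else range (q R).

Fixpoint Vbar (R : realType) (n : nat) : set (R * R) :=
  if n is m.+1 then \bigcup_(i in [set: 'I_5]) (psi i @` Vbar m)
  else \bigcup_(i in [set~ ord_max]) segment (q R ord_max) (q R i).

(* The edges of [Vbar n], as pairs of endpoints; each edge is listed with one
   orientation only, from the centre of its n-cell to a corner. *)
Fixpoint edges (R : realType) (n : nat) : set ((R * R) * (R * R)) :=
  if n is m.+1 then
    \bigcup_(i in [set: 'I_5]) [set (psi i e.1, psi i e.2) | e in edges m]
  else [set (q R ord_max, q R i) | i in [set~ ord_max]].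

Definition neighbors (R : realType) (n : nat) (x y : R * R) : Prop :=
  edges n (x, y) \/ edges n (y, x).

(* z_0, ..., z_k are the successive break points of a piecewise linear path
   from x to y in the cable system [Vbar n]: each piece runs inside one edge. *)
Definition cable_path (R : realType) (n : nat) (x y : R * R)
    (k : nat) (z : nat -> R * R) : Prop :=
  [/\ Vbar n x, Vbar n y, z 0 = x, z k = y &
    forall i, (i < k)%N -> exists e, [/\ edges n e,
      segment e.1 e.2 (z i) & segment e.1 e.2 (z i.+1)]].

Definition cable_dist (R : realType) (n : nat) (x y : R * R) : R :=
  inf [set l | exists k z, cable_path n x y k z /\
                 l = \sum_(i < k) eucl_dist (z i) (z i.+1)].

(* These conditions determine d on K x K, by density of the union of the
   [Vbar n]; the values of d elsewhere are never used. *)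
Definition is_geodesic_distance (R : realType) (K : set (R * R))
    (d : R * R -> R * R -> R) : Prop :=
  (forall n x y, Vbar n x -> Vbar n y -> d x y = cable_dist n x y) /\
  {within K `*` K, continuous (fun z : (R * R) * (R * R) => d z.1 z.2)}.

(* psi_{i_1} o ... o psi_{i_n} (K) for w = [:: i_1; ...; i_n] *)
Definition cell (R : realType) (K : set (R * R)) (w : seq 'I_5) :
    set (R * R) :=
  foldr (fun i A => psi i @` A) K w.

(* A Borel measure on K is represented by a Borel measure on the plane for
   which the complement of K is null. *)
Definition is_vicsek_measure (R : realType) (K : set (R * R))
    (mu : {measure set (borel_plane R) -> \bar R}) : Prop :=
  mu (~` K) = 0%E /\
  forall w : seq 'I_5, mu (cell K w) = ((5^-1) ^+ size w)%:E.

Definition dball (R : realType) (K : set (R * R)) (d : R * R -> R * R -> R)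
    (x : R * R) (r : R) : set (R * R) :=
  [set y | K y /\ d x y < r].

Definition Lp (R : realType) (K : set (R * R))
    (mu : {measure set (borel_plane R) -> \bar R}) (p : R) :
    set (borel_plane R -> R) :=
  [set f : borel_plane R -> R | measurable_fun (K : set (borel_plane R)) f /\
           (\int[mu]_(x in K) (`|f x| `^ p)%:E < +oo)%E].

Definition is_constant (R : realType) (K : set (R * R))
    (mu : {measure set (borel_plane R) -> \bar R})
    (f : borel_plane R -> R) : Prop :=
  exists c : R, {ae mu, forall x, K x -> f x = c}.

Definition Epa (R : realType) (K : set (R * R)) (d : R * R -> R * R -> R)
    (mu : {measure set (borel_plane R) -> \bar R}) (p alpha : R)
    (f : borel_plane R -> R) (r : R) : \bar R :=
  (\int[mu]_(x in K) ((mu (dball K d x r))^-1 *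
     \int[mu]_(y in dball K d x r)
       (`|f y - f x| `^ p / r `^ (p * alpha))%:E))%E.

Definition supE (R : realType) (K : set (R * R)) (d : R * R -> R * R -> R)
    (mu : {measure set (borel_plane R) -> \bar R}) (p alpha : R)
    (f : borel_plane R -> R) : \bar R :=
  ereal_sup [set Epa K d mu p alpha f r | r in [set r : R | 0 < r]].

Definition besov (R : realType) (K : set (R * R)) (d : R * R -> R * R -> R)
    (mu : {measure set (borel_plane R) -> \bar R}) (alpha p : R) :
    set (borel_plane R -> R) :=
  [set f : borel_plane R -> R | Lp K mu p f /\ (supE K d mu p alpha f < +oo)%E].

Definition KS (R : realType) (K : set (R * R)) (d : R * R -> R * R -> R)
    (mu : {measure set (borel_plane R) -> \bar R}) (alpha p : R) :
    set (borel_plane R -> R) :=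
  [set f : borel_plane R -> R | Lp K mu p f /\
           (limf_esup (Epa K d mu p alpha f) (0 : R)^'+ < +oo)%E].

Definition alpha_crit (R : realType) (K : set (R * R))
    (d : R * R -> R * R -> R)
    (mu : {measure set (borel_plane R) -> \bar R}) (p : R) : R :=
  sup [set alpha : R | 0 <= alpha /\
         exists2 f, besov K d mu alpha p f & ~ is_constant K mu f].

Definition propertyP (R : realType) (K : set (R * R))
    (d : R * R -> R * R -> R)
    (mu : {measure set (borel_plane R) -> \bar R}) (p alpha : R) : Prop :=
  (exists2 f, KS K d mu alpha p f & ~ is_constant K mu f) /\
  (exists2 C : R, 1 <= C & forall f, KS K d mu alpha p f ->
     (supE K d mu p alpha f
        <= C%:E * limf_einf (Epa K d mu p alpha f) (0 : R)^'+)%E).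

Definition Varp (R : realType) (K : set (R * R)) (d : R * R -> R * R -> R)
    (mu : {measure set (borel_plane R) -> \bar R}) (p : R)
    (f : borel_plane R -> R) : \bar R :=
  limf_einf
    (fun r => (Epa K d mu p (alpha_crit K d mu p) f r `^ p^-1)%E) (0 : R)^'+.

Definition continuous_version (R : realType) (K : set (R * R))
    (mu : {measure set (borel_plane R) -> \bar R})
    (f : borel_plane R -> R) (g : R * R -> R) : Prop :=
  {within K, continuous g} /\ {ae mu, forall x, K x -> f x = g x}.

(* The sum runs over ordered pairs, so each edge is counted twice. *)
Definition discrete_energy (R : realType) (p : R) (m : nat)
    (f : R * R -> R) : R :=
  2^-1 * 3 `^ ((p - 1) * m%:R) *
  \sum_(z \in [set z | [/\ V m z.1, V m z.2 & neighbors m z.1 z.2]])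
    `|f z.1 - f z.2| `^ p.

Definition energy (R : realType) (p : R) (f : R * R -> R) : \bar R :=
  limn (fun m => (discrete_energy p m f)%:E).

(* Main.v *)
Require Import Defs.
From HB Require Import structures.
From mathcomp Require Import all_boot all_order all_algebra.
From mathcomp Require Import all_classical all_reals all_analysis.
From mathcomp Require Import measurable_realfun.
From mathcomp Require Import zify ring lra.

(** The balls of the geodesic distance are replaced by stars. A cell of level [n] has
    a word [w] of length [n]; its star is the union of the cells that touch it. Cells
    that do not touch are at least [3 ^ -n] apart ([d_lt_adj]) and points of cells
    that touch are at most [4 * 3 ^ -n] apart ([d_le_adj]), so that a ball of radius
    of order [3 ^ -n] is comparable with a star, in extent and in measure
    ([mu_dball_ge], [mu_dball_le]). Let [osc w] be the infimum over [c] of [5 ^ n]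
    times the integral of [|f - c| ^ p] over the star of [w], and [osc_energy n] the
    sum of the [osc w] over the words of length [n] times [3 ^ ((p - 1) n)]. For radii
    of order [3 ^ -n] the energy [Epa] at the exponent [1 + (d_h - 1) / p] is, up to
    constants, bounded below by [osc_energy n] ([osc_energy_le]) and above by
    [osc_energy (n - 3)] ([Epa_le]).

    The set is a tree: in the star of a cell of level [n], the cells of level [n + m]
    are joined to those of the middle cell by chains of at most [2 * 3 ^ m] touching
    cells that stay in the star ([conn_star]). Jensen's inequality along this chain
    gives a Poincare inequality ([osc_poincare]) with exactly the factor
    [3 ^ ((p - 1) m)] of the energies. Applied to almost best constants it shows that
    [osc_energy n] is at most a constant times [osc_energy (n + m)] ([osc_energy_mono]). Hence all
    the energies, and with them the supremum of [Epa], are controlled by the lower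
    limit of [Epa] at small radii.

    A nonconstant function of finite energy is the nearest-point projection to one
    diagonal ([exists_nonconstant]): it varies on [3 ^ n] cells of level [n] only, by
    [3 ^ -n]. At a larger exponent finiteness of [Epa] makes [osc_energy n] tend to 0,
    so that [osc_energy 0] vanishes by weak monotonicity and the function is constant
    ([besov_supercritical]). This identifies the critical exponent ([alpha_critE]) and
    proves the property of the supremum and the lower limit ([propertyP_vicsek]).

    For [p > 1] the bound on [osc_energy n] forces [osc w] to decay geometrically, and
    the best constants of the cells containing a point converge to the value of a
    continuous version ([exists_continuous_version]). The discrete energy is the sum
    over cells of the differences between centre and corners; it does not decrease
    with the level ([cell_energy_mono]), so that its limit is its supremum
    ([energyE]). Chains of small cells between the ends of an edge bound it by the
    supremum of the [osc_energy n] ([cell_energy_bound]), and conversely the Poincare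
    inequality with the values at the centres bounds [osc_energy n] by it
    ([osc_energy_le_cell_energy]). *)

Set Implicit Arguments.
Unset Strict Implicit.
Unset Printing Implicit Defensive.

Import Order.TTheory GRing.Theory Num.Theory.
Import numFieldNormedType.Exports.

Local Open Scope classical_set_scope.
Local Open Scope ring_scope.

(** * Words and the adjacency of cells *)

Notation ctr := (@ord_max 4).

Definition opposite (i : 'I_5) : 'I_5 :=
  nth ctr [:: inord 2; inord 3; inord 0; inord 1; ctr] i.

(** Adjacency of two cells of the same level, read off their words, so that it can
    be computed without the set. Cells with the same first letter are compared inside
    that first-level cell; otherwise they touch only if one is in the central
    first-level cell and the other in a corner one, and both reach the junction
    [psi ctr (q j) = psi j (q (opposite j))], which only the constant words do. *)
Fixpoint adj (u v : seq 'I_5) : bool :=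
  match u, v with
  | [::], [::] => true
  | i :: u', j :: v' =>
      if i == j then adj u' v' else
        [&& i == ctr, u' == nseq (size v') j & v' == nseq (size u') (opposite j)]
        || [&& j == ctr, v' == nseq (size u') i & u' == nseq (size v') (opposite i)]
  | _, _ => false
  end.

Definition words (n : nat) : seq (seq 'I_5) :=
  iter n (fun ws => [seq i :: w | i <- enum 'I_5, w <- ws]) [:: [::]].

Section Words.
Local Open Scope nat_scope.
Implicit Types (u v w : seq 'I_5) (i j : 'I_5).

Lemma ord5P i : [\/ i = inord 0, i = inord 1, i = inord 2 | i = inord 3] \/ i = ctr.
Proof.
case: i => [[|[|[|[|[|//]]]]] Hi]; [left; constructor 1|left; constructor 2
 |left; constructor 3|left; constructor 4|right]; by apply/val_inj; rewrite /= ?inordK.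
Qed.

Lemma oppositeK : involutive opposite.
Proof.
by move=> i; case: (ord5P i) => [[]|] ->; rewrite /opposite /= ?inordK //= ?inordK.
Qed.

Lemma opposite_ctr : opposite ctr = ctr. Proof. by []. Qed.

Lemma opposite_eq_ctr i : (opposite i == ctr) = (i == ctr).
Proof. by rewrite -{1}opposite_ctr (inj_eq (can_inj oppositeK)). Qed.

Lemma opposite_neq i : i != ctr -> opposite i != i.
Proof.
case: (ord5P i) => [[]|] -> //; rewrite /opposite ?inordK //= => _;
  by rewrite -val_eqE /= ?inordK.
Qed.

Lemma words0 : words 0 = [:: [::]]. Proof. by []. Qed.

Lemma wordsS n : words n.+1 = [seq i :: w | i <- enum 'I_5, w <- words n].
Proof. by []. Qed.

Lemma mem_words n w : (w \in words n) = (size w == n).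
Proof.
elim: n w => [|n IH] w; first by rewrite words0 inE; case: w.
rewrite wordsS; apply/allpairsP/eqP => [[[j v] /= [_ + ->]]|].
  by rewrite IH /= => /eqP ->.
case: w => // i w [sw]; exists (i, w) => /=.
by rewrite IH sw eqxx mem_enum.
Qed.

Lemma uniq_words n : uniq (words n).
Proof.
elim: n => // n IH; rewrite wordsS allpairs_uniq ?enum_uniq //.
by move=> [i u] [j v] _ _ /= [-> ->].
Qed.

Lemma size_words n : size (words n) = 5 ^ n.
Proof. by elim: n => // n IH; rewrite wordsS size_allpairs IH size_enum_ord expnS. Qed.

Lemma adj_size u v : adj u v -> size u = size v.
Proof.
elim: u v => [|i u IH] [|j v] //=; case: ifP => _; first by move=> /IH ->.
by case/orP => /and3P [_ /eqP Hu /eqP Hv];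
  [rewrite Hu size_nseq|rewrite Hv size_nseq].
Qed.

Lemma adj_refl u : adj u u.
Proof. by elim: u => //= i u ->; rewrite eqxx. Qed.

Lemma adj_sym u v : adj u v = adj v u.
Proof.
elim: u v => [|i u IH] [|j v] //=; rewrite [j == i]eq_sym IH.
by case: ifP => // _; rewrite orbC.
Qed.

Lemma adj_catl w u v : adj (w ++ u) (w ++ v) = adj u v.
Proof. by elim: w => //= i w ->; rewrite eqxx. Qed.

(** The subcells at the corner shared by two adjacent cells are adjacent at every
    depth; this is where chains cross from one cell to the next. *)
Lemma adj_corner u v : adj u v ->
  exists i j, forall m, adj (u ++ nseq m i) (v ++ nseq m j).
Proof.
elim: u v => [|i u IH] [|j v] //=.
  by move=> _; exists ctr, ctr => m; apply: adj_refl.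
case: ifP => ij; first by move=> /IH [a [b H]]; exists a, b.
case/orP => /and3P [/eqP ic /eqP uE /eqP vE]; [exists j, (opposite j)|exists (opposite i), i];
  move=> m; apply/orP; [left|right]; rewrite ic eqxx !size_cat !size_nseq.
  by rewrite !nseqD -uE -vE !eqxx.
by rewrite !nseqD -uE -vE !eqxx.
Qed.

Lemma adj_other_letter i j u v : i != j -> adj (i :: u) (j :: v) ->
  [/\ exists2 k, k != i & u = nseq (size v) k &
      v = nseq (size u) (if i == ctr then opposite j else i)].
Proof.
move=> /[dup] ij; rewrite /= => /negbTE ->.
case/orP => /and3P [/eqP ic /eqP uE /eqP vE]; split.
- by exists j => //; rewrite eq_sym.
- by rewrite ic eqxx.
- exists (opposite i) => //; apply/opposite_neq; by rewrite -ic.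
- by move: ij; rewrite -ic => /negbTE ->.
Qed.

(** The word [i :: w] has at most one neighbour for each of the four other first
    letters, and has one only if [w] is constant of a letter other than [i]. The
    induction therefore carries the better bound 5 for constant words, which gives
    5 + 4 neighbours at the next level instead of a number growing with [n]. *)
Lemma count_adj n w : size w = n -> (count (adj w) (words n) <= 9)%N.
Proof.
suff H : size w = n -> (count (adj w) (words n) <= 9)%N /\
    forall k, w = nseq n k -> (count (adj w) (words n) <= 5)%N.
  by move=> /H [].
elim: n w => [|n IH] [|i w] // [sw].
have le5 : (count (adj (i :: w)) (words n.+1) <= 5 ^ n.+1)%N.
  by rewrite -size_words count_size.
have [IH9 IH5] := IH w sw.
pose X j := count (fun v => adj (i :: w) (j :: v)) (words n).
have NE : count (adj (i :: w)) (words n.+1) =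
    (count (adj w) (words n) + \sum_(j : 'I_5 | j != i) X j)%N.
  rewrite wordsS count_flatten -map_comp sumnE big_map big_enum /=.
  rewrite (bigD1 i) //=; congr (_ + _)%N.
    by rewrite count_map; apply: eq_count => v /=; rewrite eqxx.
  by apply: eq_bigr => j _; rewrite count_map.
have X1 j : j != i -> (X j <= 1)%N.
  rewrite eq_sym => ij; rewrite /X.
  rewrite (leq_trans (_ : _ <= count_mem
    (nseq n (if i == ctr then opposite j else i)) (words n))%N) //; last first.
    by rewrite count_uniq_mem ?uniq_words ?leq_b1.
  by apply: sub_count => v /(adj_other_letter ij) [_ ->]; rewrite sw /=.
have X0 : {j | j != i & (0 < X j)%N} + {forall j, j != i -> X j = 0%N}.
  case: (pickP [pred j | (j != i) && (0 < X j)%N]) => [j /andP [ji Xj]|H].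
    by left; exists j.
  right=> j ji; have := H j; rewrite /= ji /= => /negbT.
  by rewrite lt0n negbK => /eqP.
rewrite NE; case: X0 => [[j ji Xj]|X0]; last first.
  rewrite big1 // addn0; split=> // k [_ wE]; exact: (IH5 k).
have [k ki wE] : exists2 k, k != i & w = nseq n k.
  move: Xj; rewrite -has_count => /hasP [v vn].
  rewrite eq_sym in ji; move=> /(adj_other_letter ji) [[k ki wE] _].
  by exists k => //; rewrite wE; move: vn; rewrite mem_words => /eqP ->.
split.
  rewrite (leq_add (IH5 k wE) (_ : _ <= 4)%N) //.
  rewrite (leq_trans (leq_sum _ X1)) // sum1_card cardC1 card_ord //.
move=> k' [ik' wE']; rewrite -NE (leq_trans le5) //.
case: n {IH X IH9 IH5 NE X1 Xj le5} sw wE wE' => [|n] sw -> // [kk' _].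
by rewrite kk' -ik' eqxx in ki.
Qed.

(** * Chains of adjacent cells *)

Definition conn (S : pred (seq 'I_5)) (k : nat) (u v : seq 'I_5) : Prop :=
  exists p, [/\ path adj u p, last u p = v, size p <= k & all S (u :: p)].

Lemma conn_refl (S : pred (seq 'I_5)) u : S u -> conn S 0 u u.
Proof. by move=> Su; exists [::]; rewrite /= Su. Qed.

Lemma conn_adj (S : pred (seq 'I_5)) u v : S u -> S v -> adj u v -> conn S 1 u v.
Proof. by move=> Su Sv uv; exists [:: v]; rewrite /= uv Su Sv. Qed.

Lemma conn_trans S k l u v w : conn S k u v -> conn S l v w -> conn S (k + l) u w.
Proof.
move=> [p [up lp sp Sp]] [r [vr lr sr Sr]]; exists (p ++ r).
rewrite cat_path last_cat lp size_cat up vr lr leq_add //; split=> //.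
by move: Sp Sr => /= /andP [-> Sp] /andP [_ Sr]; rewrite all_cat Sp Sr.
Qed.

Lemma conn_sym S k u v : conn S k u v -> conn S k v u.
Proof.
move=> [p [up lp sp Sp]]; exists (rev (belast u p)); split.
- rewrite -lp rev_path; apply: sub_path up => x y; by rewrite adj_sym.
- case: p {up sp Sp} lp => [/= -> //|x p /= _].
  by rewrite rev_cons last_rcons.
- by rewrite size_rev size_belast.
- have : all S (rev (v :: rev (belast u p))).
    by rewrite rev_cons revK -lp -lastI.
  by rewrite all_rev.
Qed.

Lemma conn_le S k l u v : k <= l -> conn S k u v -> conn S l u v.
Proof. by move=> kl [p [H1 H2 H3 H4]]; exists p; split=> //; apply: leq_trans kl. Qed.

Lemma conn_sub (S T : pred (seq 'I_5)) k u v :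
  (forall w, S w -> T w) -> conn S k u v -> conn T k u v.
Proof. by move=> ST [p [H1 H2 H3 H4]]; exists p; split=> //; apply: sub_all H4. Qed.

Definition inside w u := prefix w u.

Lemma conn_cat w k u v : conn predT k u v -> conn (inside w) k (w ++ u) (w ++ v).
Proof.
move=> [p [H1 H2 H3 _]]; exists [seq w ++ x | x <- p]; split.
- elim: p u H1 {H2 H3} => //= x p IH u /andP [ux xp].
  by rewrite adj_catl ux IH.
- by rewrite last_map H2.
- by rewrite size_map.
- by rewrite -map_cons all_map; apply/allP => x _ /=; apply: prefix_prefix.
Qed.

(** The number of steps from the central word of length [m] to a corner word: it
    takes half of the [3 ^ m] subcells on a diagonal, without the central one. *)
Fixpoint chain_len m := if m is m'.+1 then 3 * chain_len m' + 1 else 0.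

Lemma chain_lenE m : 2 * chain_len m + 1 = 3 ^ m.
Proof. by elim: m => //= m IH; rewrite expnS -IH; lia. Qed.

Lemma conn_cons i k u v : conn predT k u v -> conn predT k (i :: u) (i :: v).
Proof. by move=> /(conn_cat [:: i]); apply: conn_sub. Qed.

Lemma adj_junction m i : adj (ctr :: nseq m i) (i :: nseq m (opposite i)).
Proof.
case: (eqVneq ctr i) => [<-|ci]; first by rewrite opposite_ctr adj_refl.
by rewrite /= (negbTE ci) !size_nseq !eqxx.
Qed.

(** The diagonal from the centre to the corner [i] leaves the central subcell at its
    corner [i], then crosses the subcell [i] from the opposite corner to its centre
    and on to its corner [i]: three legs of the previous level and one crossing. *)
Lemma conn_corner m i : conn predT (chain_len m) (nseq m ctr) (nseq m i).
Proof.
elim: m i => [|m IH] i; first exact: conn_refl.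
apply: (@conn_le _ (chain_len m + (1 + (chain_len m + chain_len m)))) => /=; first lia.
apply: (conn_trans (conn_cons ctr (IH i))).
apply: (@conn_trans _ _ _ _ (i :: nseq m (opposite i))).
  exact/conn_adj/adj_junction.
apply: (conn_trans (conn_cons i (conn_sym (IH (opposite i))))).
exact/conn_cons/IH.
Qed.

Lemma conn_center m u : size u = m -> conn predT (chain_len m) u (nseq m ctr).
Proof.
elim: m u => [|m IH] [|i u] // su; first exact: conn_refl.
case: su => su.
apply: (@conn_le _ (chain_len m + (chain_len m + (1 + chain_len m)))) => /=; first lia.
apply: (conn_trans (conn_cons i (IH u su))).
apply: (conn_trans (conn_cons i (conn_corner m (opposite i)))).
apply: (@conn_trans _ _ _ _ (ctr :: nseq m i)).
  by apply: conn_adj => //; rewrite adj_sym adj_junction.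
exact/conn_cons/conn_sym/conn_corner.
Qed.

(** Only the first [size w] letters of [v] matter, so that the star of [w] contains
    words of all greater lengths. *)
Definition star w : pred (seq 'I_5) := fun v => adj w (take (size w) v).

Lemma star_cat w w' u : adj w w' -> star w (w' ++ u).
Proof. by move=> ww'; rewrite /star (adj_size ww') take_size_cat. Qed.

(** The chain goes from [u0] to the centre of the cell [w], to the corner shared with
    [w'], to the centre of [w'] and to [u]: four legs of [chain_len m] steps. *)
Lemma conn_star w w' m u u0 : adj w w' -> size u = m -> size u0 = m ->
  conn (star w) (2 * 3 ^ m) (w ++ u0) (w' ++ u).
Proof.
move=> ww' su su0; have [i [j H]] := adj_corner ww'.
apply: (@conn_le _ (chain_len m + (chain_len m + (1 + (chain_len m + chain_len m))))).
  by rewrite -chain_lenE; lia.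
have sub v : adj w v -> forall x, inside v x -> star w x.
  by move=> wv x /prefixP [y ->]; apply: star_cat.
have ins v k a b : adj w v -> conn predT k a b -> conn (star w) k (v ++ a) (v ++ b).
  by move=> wv /(conn_cat v); apply/conn_sub/sub.
apply: (conn_trans (ins _ _ _ _ (adj_refl w) (conn_center su0))).
apply: (conn_trans (ins _ _ _ _ (adj_refl w) (conn_corner m i))).
apply: (@conn_trans _ _ _ _ (w' ++ nseq m j)).
  apply: conn_adj; [exact: star_cat (adj_refl w)|exact: star_cat|exact: H].
apply: (conn_trans (ins _ _ _ _ ww' (conn_sym (conn_corner m j)))).
exact: (ins _ _ _ _ ww' (conn_sym (conn_center su))).
Qed.

Lemma conn_uniq S k u v : conn S k u v ->
  exists p, [/\ path adj u p, last u p = v, size p <= k, all S (u :: p) & uniq (u :: p)].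
Proof.
move=> [p [up lp sp Sp]]; case: (shortenP up) lp => p' up' uniqp' sub lp.
exists p'; split => //.
  by apply: leq_trans sp; apply: uniq_leq_size sub; case/andP: uniqp'.
move: Sp => /= /andP [-> /allP Sp] /=; apply/allP => x /sub; exact: Sp.
Qed.

End Words.

(** * Sums over words and the power mean inequality along chains *)

Section WordSums.
Variable R : realType.
Implicit Types (F H : seq 'I_5 -> R) (u v w : seq 'I_5).

Lemma sum_words0 F : \sum_(w <- words 0) F w = F [::].
Proof. by rewrite words0 big_seq1. Qed.

Lemma sum_wordsS n F :
  \sum_(w <- words n.+1) F w = \sum_(i : 'I_5) \sum_(w <- words n) F (i :: w).
Proof.
by rewrite wordsS big_allpairs_dep /= big_enum.
Qed.

Lemma sum_words_cat n m F : \sum_(w <- words (n + m)) F w =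
  \sum_(w <- words n) \sum_(u <- words m) F (w ++ u).
Proof.
elim: n F => [|n IH] F; first by rewrite sum_words0.
by rewrite addSn !sum_wordsS; apply: eq_bigr => i _; rewrite IH.
Qed.

Lemma sum_words_const n (x : R) : \sum_(w <- words n) x = 5 ^+ n * x.
Proof.
by rewrite big_const_seq count_predT size_words iter_addr_0 -[LHS]mulr_natl natrX.
Qed.

Lemma eq_sum_words n F H : (forall w, size w = n -> F w = H w) ->
  \sum_(w <- words n) F w = \sum_(w <- words n) H w.
Proof.
by move=> FH; apply: eq_big_seq => w; rewrite mem_words => /eqP; apply: FH.
Qed.

Lemma ler_sum_words n F H : (forall w, size w = n -> F w <= H w) ->
  \sum_(w <- words n) F w <= \sum_(w <- words n) H w.
Proof.
move=> FH; rewrite big_seq [leRHS]big_seq; apply: ler_sum => w.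
by rewrite mem_words => /eqP; apply: FH.
Qed.

Lemma sum_adj n F : (forall w, 0 <= F w) ->
  \sum_(w <- words n) \sum_(v <- words n | adj w v) F v <=
  9 * \sum_(v <- words n) F v.
Proof.
move=> F0; rewrite (exchange_big_dep predT) //= mulr_sumr; apply: ler_sum_words => v sv.
rewrite big_const_seq iter_addr_0 -[leLHS]mulr_natl ler_wpM2r // ler_nat.
rewrite (eq_count (a2 := adj v)) ?count_adj // => w; exact: adj_sym.
Qed.

Lemma sum_star n m w F : size w = n -> \sum_(v <- words (n + m) | star w v) F v =
  \sum_(v <- words n | adj w v) \sum_(u <- words m) F (v ++ u).
Proof.
move=> sw; rewrite big_mkcond sum_words_cat [RHS]big_mkcond.
apply: eq_sum_words => v sv.
by case: ifP => wv; [apply: eq_bigr => u _|rewrite big1 // => u _];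
  rewrite /star sw -sv take_size_cat // wv.
Qed.

Lemma ler_sum_uniq (T : eqType) (s t : seq T) (G : T -> R) : (forall x, 0 <= G x) ->
  uniq s -> {subset s <= t} -> \sum_(x <- s) G x <= \sum_(x <- t) G x.
Proof.
move=> G0; elim: s t => [|x s IH] t /=; first by rewrite big_nil sumr_ge0.
case/andP => xs us st; rewrite big_cons.
rewrite [leRHS](perm_big _ (perm_to_rem (st x (mem_head _ _)))) big_cons.
rewrite lerD2l; apply: IH => // y ys.
by apply: rem_mem; [apply: contraNneq xs => <-|rewrite st // inE ys orbT].
Qed.

End WordSums.

Section PowerMean.
Variables (R : realType) (p : R).
Hypothesis p1 : 1 <= p.
Implicit Types (x y : R).

Let p0 : 0 <= p. Proof. exact: le_trans p1. Qed.

Lemma ler_powR_base x y : 0 <= x -> x <= y -> x `^ p <= y `^ p.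
Proof.
move=> x0 xy; apply: ge0_ler_powR => //; rewrite nnegrE //; exact: le_trans xy.
Qed.

Lemma powR_convex x y (t : R) : 0 <= x -> 0 <= y -> 0 <= t <= 1 ->
  (t * x + (1 - t) * y) `^ p <= t * x `^ p + (1 - t) * y `^ p.
Proof.
move=> x0 y0 t01.
have := convex_powR p1 (Itv01 (andP t01).1 (andP t01).2) (x := x) (y := y).
by rewrite !inE /= !in_itv /= !andbT => /(_ x0 y0); rewrite !convRE.
Qed.

(** Jensen's inequality for the uniform mean of the entries. *)
Lemma powR_sum (s : seq R) : all (>= 0) s ->
  (\sum_(x <- s) x) `^ p <= (size s)%:R `^ (p - 1) * \sum_(x <- s) x `^ p.
Proof.
elim: s => [|x s IH] /=.
  by move=> _; rewrite !big_nil mulr0 powR0 // gt_eqF // (lt_le_trans _ p1).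
case/andP => x0 s0; rewrite !big_cons.
have S0 : 0 <= \sum_(y <- s) y by rewrite big_seq; apply: sumr_ge0 => y /(allP s0).
case: s => [|y s'] in IH s0 S0 *.
  by rewrite !big_nil !addr0 powR1 mul1r.
set s := y :: s' in IH s0 S0 *; set n := size s; set S := \sum_(z <- s) z in S0 *.
have n0 : 0 < n%:R :> R by rewrite ltr0n.
have n10 : 0 < n.+1%:R :> R by rewrite ltr0n.
have key : (n.+1%:R^-1 * (x + S)) `^ p <=
    n.+1%:R^-1 * x `^ p + (1 - n.+1%:R^-1) * (n%:R^-1 * S) `^ p.
  have -> : n.+1%:R^-1 * (x + S) = n.+1%:R^-1 * x + (1 - n.+1%:R^-1) * (n%:R^-1 * S).
    rewrite -natr1; field; by rewrite natr1 !gt_eqF.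
  apply: powR_convex => //; first by rewrite mulr_ge0 // invr_ge0 ltW.
  by rewrite invr_ge0 ltW //= invf_le1 // ler1n.
have pown (k : R) : 0 < k -> (k^-1) `^ p = k^-1 * (k `^ (p - 1))^-1.
  move=> k0; rewrite -[X in X `^ p]powR_inv1 ?ltW // -powRrM mulN1r powRN.
  by rewrite -mulr_powRB1 ?ltW // ?invfM // (lt_le_trans _ p1).
have i0 : 0 <= n%:R^-1 :> R by rewrite invr_ge0.
have i10 : 0 <= n.+1%:R^-1 :> R by rewrite invr_ge0.
have xS0 : 0 <= x + S by rewrite addr_ge0.
move: key; rewrite !powRM // !pown //.
set T := \sum_(z <- s) z `^ p.
have IH' := IH s0; rewrite -/n -/S -/T in IH'.
have a0 : 0 < n%:R `^ (p - 1) :> R by rewrite powR_gt0.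
have b0 : 0 < n.+1%:R `^ (p - 1) :> R by rewrite powR_gt0.
move: IH' a0 b0; set a := n%:R `^ (p - 1); set b := n.+1%:R `^ (p - 1).
set U := (x + S) `^ p; set W := S `^ p; set X := x `^ p => IH' a0 b0 key.
have k2 : n%:R^-1 * a^-1 * W <= n%:R^-1 * T.
  by rewrite -mulrA ler_wpM2l ?invr_ge0 ?(ltW n0) // mulrC ler_pdivrMr // mulrC.
have : n.+1%:R^-1 * b^-1 * U <= n.+1%:R^-1 * X + (1 - n.+1%:R^-1) * (n%:R^-1 * T).
  apply: le_trans key _; rewrite lerD2l ler_wpM2l //.
  by rewrite subr_ge0 invf_le1 // ler1n.
have -> : n.+1%:R^-1 * X + (1 - n.+1%:R^-1) * (n%:R^-1 * T) = n.+1%:R^-1 * (X + T).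
  rewrite -natr1; field; by rewrite natr1 !gt_eqF.
by rewrite -mulrA ler_pM2l ?invr_gt0 // mulrC ler_pdivrMr // mulrC.
Qed.

Lemma powR_addr x y : 0 <= x -> 0 <= y ->
  (x + y) `^ p <= 2 `^ (p - 1) * (x `^ p + y `^ p).
Proof.
move=> x0 y0; have := @powR_sum [:: x; y].
by rewrite /= x0 y0 !big_cons !big_nil !addr0; apply.
Qed.

Lemma powR_dist (x y z : R) :
  `|x - z| `^ p <= 2 `^ (p - 1) * (`|x - y| `^ p + `|y - z| `^ p).
Proof.
apply: le_trans (powR_addr (normr_ge0 _) (normr_ge0 _)).
apply: ler_powR_base => //.
by rewrite (le_trans _ (ler_normD _ _)) // addrA subrK.
Qed.

(** The factor 2 arises because every word of the chain takes part in at most two of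
    its steps. *)
Lemma chain_sum (c H : seq 'I_5 -> R) (u : seq 'I_5) (s : seq (seq 'I_5)) :
  (forall v w, v \in u :: s -> w \in u :: s -> adj v w ->
     `|c v - c w| `^ p <= H v + H w) ->
  (forall v, 0 <= H v) -> path adj u s ->
  `|c u - c (last u s)| `^ p <= (size s)%:R `^ (p - 1) * (2 * \sum_(v <- u :: s) H v).
Proof.
move=> cH H0 us.
pose D := pairmap (fun v w => `|c v - c w|) u s.
have D1 : `|c u - c (last u s)| <= \sum_(x <- D) x.
  rewrite /D; elim: s u {cH us D} => [|v s IH] u /=.
    by rewrite big_nil subrr normr0.
  rewrite big_cons (le_trans _ (lerD (lexx _) (IH v))) //.
  by rewrite (le_trans _ (ler_normD _ _)) // addrA subrK.
have D0 : all (>= 0) D.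
  by rewrite /D; elim: s u {cH us D D1} => //= v s IH u; rewrite normr_ge0 IH.
have DH : \sum_(x <- D) x `^ p <= H u + 2 * \sum_(v <- s) H v.
  rewrite /D; elim: s u us cH {D D1 D0} => [|v s IH] u /=.
    by rewrite !big_nil mulr0 addr0.
  case/andP => uv vs cH; rewrite !big_cons.
  have := IH v vs (fun a b ha hb => cH a b (mem_behead (s := u :: _) ha) (mem_behead (s := u :: _) hb)).
  have := cH u v; rewrite !inE !eqxx !orbT => /(_ isT isT uv).
  lra.
have sD : size D = size s by rewrite size_pairmap.
apply: le_trans (ler_powR_base (normr_ge0 _) D1) _.
apply: le_trans (powR_sum D0) _; rewrite sD ler_wpM2l ?powR_ge0 //.
apply: le_trans DH _; rewrite big_cons; have := H0 u; lra.
Qed.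

(** Two words below adjacent words of level [n] are joined by at most [2 * 3 ^ m]
    steps that stay below the star, whence the factor of order [3 ^ (m (p - 1))]. *)
Lemma chain_bound n m (c H : seq 'I_5 -> R) (w w' u u0 : seq 'I_5) :
  (forall v v', size v = (n + m)%N -> size v' = (n + m)%N -> adj v v' ->
     `|c v - c v'| `^ p <= H v + H v') ->
  (forall v, 0 <= H v) ->
  size w = n -> adj w w' -> size u = m -> size u0 = m ->
  `|c (w' ++ u) - c (w ++ u0)| `^ p <=
    2 `^ p * 3 `^ ((p - 1) * m%:R) * \sum_(v <- words (n + m) | star w v) H v.
Proof.
move=> cH H0 sw ww' su su0; rewrite distrC.
have [s [us ls ss stars uniqs]] := conn_uniq (conn_star ww' su su0).
have szs : {in (w ++ u0) :: s, forall v, size v = (n + m)%N}.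
  have : size (w ++ u0) = (n + m)%N by rewrite size_cat sw su0.
  elim: s (w ++ u0) us {ls ss stars uniqs} => [|y s IH] x /=.
    by move=> _ sx v; rewrite inE => /eqP ->.
  case/andP => xy ys sx v; rewrite inE => /orP [/eqP -> //|].
  by apply: IH => //; rewrite -(adj_size xy).
rewrite -ls; apply: le_trans (chain_sum _ H0 us) _.
  by move=> v v' /szs sv /szs sv'; apply: cH.
rewrite mulrA; apply: ler_pM.
- by rewrite mulr_ge0 ?powR_ge0.
- exact: sumr_ge0.
- have -> : 2 `^ p * 3 `^ ((p - 1) * m%:R) = (2 * 3 ^ m)%:R `^ (p - 1) * 2 :> R.
    rewrite natrM natrX powRM ?exprn_ge0 // -[2 `^ p]mulr_powRB1 ?(lt_le_trans _ p1) //.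
    by rewrite [(p - 1) * _]mulrC powRrM powR_mulrn //; ring.
  rewrite ler_wpM2r // ge0_ler_powR ?nnegrE ?ler0n ?subr_ge0 // ler_nat //.
- rewrite -[leRHS]big_filter; apply: ler_sum_uniq => // v vs.
  by rewrite mem_filter (allP stars) // mem_words szs /=.
Qed.

End PowerMean.

(** * Geometry of the cells *)

Definition Pw (R : realType) (w : seq 'I_5) (z : R * R) : R * R :=
  foldr (fun i => @psi R i) z w.

(** The scalar product with [q j]: for a corner [q j] it exposes that corner,
    being 1 there and at most 1 on the Vicsek set. *)
Definition lin (R : realType) (j : 'I_5) (z : R * R) : R :=
  (q R j).1 * z.1 + (q R j).2 * z.2.

Section Similarities.
Variable R : realType.
Implicit Types (x y z : R * R) (i j : 'I_5) (u v w : seq 'I_5).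

Lemma q_coord i : [/\ `|(q R i).1| <= 1, `|(q R i).2| <= 1,
  (q R i).1 ^+ 2 + (q R i).2 ^+ 2 <= 1 & q R (opposite i) = - q R i].
Proof.
have s2 : (Num.sqrt 2 / 2) ^+ 2 = 2^-1 :> R by rewrite exprMn sqr_sqrtr //; lra.
have s0 : 0 <= Num.sqrt 2 / 2 :> R by rewrite divr_ge0 // sqrtr_ge0.
have s1 : Num.sqrt 2 / 2 <= 1 :> R by nra.
have qo (k : nat) : (k < 5)%N -> (nat_of_ord (inord k : 'I_5)) = k by move=> ?; rewrite inordK.
rewrite /q /opposite; move: s2 s0 s1; set s := Num.sqrt 2 / 2 => s2 s0 s1.
case: i => [[|[|[|[|[|//]]]]] Hi] /=; rewrite ?qo //=;
  (split; [by rewrite ?normrN ?(ger0_norm s0) ?normr0|by rewrite ?normrN ?(ger0_norm s0) ?normr0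
    |by rewrite ?sqrrN ?expr0n /= ?s2; lra
    |by apply/eqP; rewrite xpair_eqE /= ?opprK ?oppr0 !eqxx]).
Qed.

Lemma q_ctr : q R ctr = 0. Proof. by []. Qed.

Lemma lin_opposite j z : lin (opposite j) z = - lin j z.
Proof. by rewrite /lin; have [_ _ _ ->] := q_coord j; rewrite /= !mulNr opprD. Qed.

Lemma lin_ctr z : lin ctr z = 0.
Proof. by rewrite /lin q_ctr /= !mul0r addr0. Qed.

Lemma linB j x y : lin j (x - y) = lin j x - lin j y.
Proof. by rewrite /lin /=; ring. Qed.

Lemma psi1 i z : (psi i z).1 = 3^-1 * (z.1 - (q R i).1) + (q R i).1.
Proof. by []. Qed.

Lemma psi2 i z : (psi i z).2 = 3^-1 * (z.2 - (q R i).2) + (q R i).2.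
Proof. by []. Qed.

Lemma lin_psi j i z : lin j (psi i z) = lin j z / 3 + 2 / 3 * lin j (q R i).
Proof. by rewrite /lin psi1 psi2; field. Qed.

Lemma lin_qq j : j != ctr -> lin j (q R j) = 1.
Proof.
have s2 : (Num.sqrt 2 / 2) * (Num.sqrt 2 / 2) = 2^-1 :> R.
  by rewrite -expr2 exprMn sqr_sqrtr //; lra.
rewrite /lin /q; case: j => [[|[|[|[|[|//]]]]] Hi] //= _;
  rewrite ?mulNr ?mulrN ?opprK s2; lra.
Qed.

Lemma lin_q_le0 j i : i != j -> lin j (q R i) <= 0.
Proof.
have s2 : (Num.sqrt 2 / 2) * (Num.sqrt 2 / 2) = 2^-1 :> R.
  by rewrite -expr2 exprMn sqr_sqrtr //; lra.
rewrite /lin /q; case: j => [[|[|[|[|[|//]]]]] Hj] //=;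
 case: i => [[|[|[|[|[|//]]]]] Hi] //= _;
  rewrite ?mulNr ?mulrN ?opprK ?mulr0 ?mul0r ?s2; lra.
Qed.

Lemma lin_q_le1 j i : lin j (q R i) <= 1.
Proof.
have [->|ij] := eqVneq i j; last by rewrite (le_trans (lin_q_le0 ij)).
have [->|jc] := eqVneq j ctr; first by rewrite lin_ctr.
by rewrite lin_qq.
Qed.

Lemma linC i j : lin i (q R j) = lin j (q R i).
Proof. by rewrite /lin; ring. Qed.

(** Over the five fixed points, [lin i - lin j] is largest at [q i]; by convexity
    the same bound will hold on the whole set. *)
Lemma lin_corners_le i j k : i != ctr -> j != ctr -> i != j ->
  lin i (q R k) - lin j (q R k) <= 1 - lin i (q R j).
Proof.
have s2 : (Num.sqrt 2 / 2) * (Num.sqrt 2 / 2) = 2^-1 :> R.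
  by rewrite -expr2 exprMn sqr_sqrtr //; lra.
rewrite /lin /q; case: j => [[|[|[|[|[|//]]]]] Hj] //=;
 case: i => [[|[|[|[|[|//]]]]] Hi] //= _ _ _;
 case: k => [[|[|[|[|[|//]]]]] Hk] //=;
  rewrite ?mulNr ?mulrN ?opprK ?mulr0 ?mul0r ?s2; lra.
Qed.

Lemma lin_eucl j x y : lin j x - lin j y <= eucl_dist x y.
Proof.
have [_ _ q1 _] := q_coord j; rewrite /eucl_dist /lin.
set a := x.1 - y.1; set b := x.2 - y.2.
have -> : (q R j).1 * x.1 + (q R j).2 * x.2 - ((q R j).1 * y.1 + (q R j).2 * y.2) =
  (q R j).1 * a + (q R j).2 * b by rewrite /a /b; ring.
apply: le_trans (ler_norm _) _; rewrite -sqrtr_sqr ler_wsqrtr //.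
move: q1; set c := (q R j).1; set e := (q R j).2 => q1.
(* Cauchy-Schwarz, by the identity of Lagrange *)
have : (c * a + e * b) ^+ 2 <= (c ^+ 2 + e ^+ 2) * (a ^+ 2 + b ^+ 2).
  rewrite -subr_ge0; have -> : (c ^+ 2 + e ^+ 2) * (a ^+ 2 + b ^+ 2) - (c * a + e * b) ^+ 2 =
    (c * b - e * a) ^+ 2 by ring.
  exact: sqr_ge0.
move=> /le_trans; apply; by rewrite ler_piMl // addr_ge0 // sqr_ge0.
Qed.

Lemma lin_sup j x y : `|lin j x - lin j y| <= 2 * `|x - y|.
Proof.
have [q1 q2 _ _] := q_coord j; rewrite -linB /lin.
apply: le_trans (ler_normD _ _) _; rewrite !normrM.
have n1 : `|(x - y).1| <= `|x - y| by rewrite prod_normE le_max lexx.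
have n2 : `|(x - y).2| <= `|x - y| by rewrite prod_normE le_max lexx orbT.
have -> : 2 * `|x - y| = `|x - y| + `|x - y| by ring.
apply: lerD; rewrite -[leRHS]mul1r; exact: ler_pM.
Qed.

Lemma psiB i x y : psi i x - psi i y = 3^-1 *: (x - y).
Proof. by rewrite /psi opprD addrACA subrr addr0 -scalerBr opprB addrA subrK. Qed.

Lemma psi_inj i : injective (@psi R i).
Proof.
move=> x y /eqP; rewrite -subr_eq0 psiB scaler_eq0 invr_eq0 pnatr_eq0 /= subr_eq0.
by move/eqP.
Qed.

Lemma PwB w x y : Pw w x - Pw w y = (3^-1) ^+ size w *: (x - y).
Proof.
elim: w => [|i w IH] /=; first by rewrite expr0 scale1r.
by rewrite psiB IH scalerA exprS.
Qed.

Lemma Pw_cat w u z : Pw (w ++ u) z = Pw w (Pw u z).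
Proof. by rewrite /Pw foldr_cat. Qed.

Lemma psi_q i : psi i (q R i) = q R i.
Proof. by rewrite /psi subrr scaler0 add0r. Qed.

Lemma psi_junction i : psi ctr (q R i) = psi i (q R (opposite i)).
Proof.
have [_ _ _ ->] := q_coord i; rewrite /psi q_ctr subr0 addr0.
by apply/eqP; rewrite xpair_eqE /=; apply/andP; split; apply/eqP; rewrite /GRing.scale /=; field.
Qed.

Lemma Pw_nseq m i : Pw (nseq m i) (q R i) = q R i.
Proof. by elim: m => //= m ->; rewrite psi_q. Qed.

Lemma adj_common_corner u v : adj u v -> exists i j, Pw u (q R i) = Pw v (q R j).
Proof.
elim: u v => [|i u IH] [|j v] //=; first by move=> _; exists ctr, ctr.
case: ifP => [/eqP <- /IH [a [b ab]]|_].
  by exists a, b; rewrite ab.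
case/orP => /and3P [/eqP -> /eqP uE /eqP vE]; [exists j, (opposite j)|exists (opposite i), i].
  by rewrite uE {2}vE !Pw_nseq psi_junction.
by rewrite {1}uE vE !Pw_nseq psi_junction.
Qed.

Lemma psi_continuous i : continuous (@psi R i).
Proof.
move=> x; rewrite /psi; apply: cvgD; last exact: cvg_cst.
by apply: cvgZr; apply: cvgB => //; exact: cvg_cst.
Qed.

Lemma Pw_continuous w : continuous (@Pw R w).
Proof.
elim: w => [|i w IH] x; first exact: cvg_id.
exact: (continuous_comp (IH x) (@psi_continuous i _)).
Qed.

Lemma cellE K w : cell K w = @Pw R w @` K.
Proof.
elim: w => [|i w IH] /=; first by rewrite image_id.
by rewrite IH image_comp.
Qed.

Lemma cell_cat K w u : cell K (w ++ u) = @Pw R w @` cell K u.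
Proof.
rewrite !cellE image_comp; congr image.
by apply/funext => z /=; rewrite Pw_cat.
Qed.

End Similarities.

Lemma geometric_small (R : realType) (t M e : R) : 0 <= t < 1 -> 0 < e ->
  exists n, forall m, (n <= m)%N -> M * t ^+ m < e.
Proof.
move=> /andP [t0 t1] e0; have : (M * t ^+ n : R) @[n --> \oo] --> M * 0.
  by apply: cvgMr; apply: cvg_expr; rewrite ger0_norm.
rewrite mulr0 => /cvgrPdist_lt /(_ _ e0) [n _ H]; exists n => m nm.
by have := H m nm; rewrite /= sub0r normrN; apply: le_lt_trans (ler_norm _).
Qed.

Section Cells.
Variables (R : realType) (K : set (R * R)).
Hypothesis hK : is_vicsek_set K.
Implicit Types (x y z : R * R) (i j : 'I_5) (u v w : seq 'I_5).

Lemma K_compact : compact K. Proof. by case: hK. Qed.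

Lemma K_neq0 : K !=set0. Proof. by case: hK. Qed.

Lemma K_psi i x : K x -> K (psi i x).
Proof. by case: hK => _ _ KE Kx; rewrite KE; exists i => //; exists x. Qed.

Lemma K_split x : K x -> exists i y, K y /\ x = psi i y.
Proof. by case: hK => _ _ KE; rewrite {1}KE => -[i _ [y Ky <-]]; exists i, y. Qed.

Lemma K_Pw w x : K x -> K (Pw w x).
Proof. by move=> Kx; elim: w => //= i w; exact: K_psi. Qed.

Lemma cell_sub w : cell K w `<=` K.
Proof. by rewrite cellE => _ [x Kx <-]; exact: K_Pw. Qed.

Lemma cell_cat_sub w u : cell K (w ++ u) `<=` cell K w.
Proof.
by rewrite cell_cat [X in _ `<=` X]cellE; apply: image_subset; exact: cell_sub.
Qed.

Lemma cell_rcons w x : cell K w x -> exists i, cell K (rcons w i) x.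
Proof.
rewrite cellE => -[y Ky <-]; have [i [z [Kz ->]]] := K_split Ky.
by exists i; rewrite -cats1 cell_cat; exists (psi i z) => //=; exists z.
Qed.

Lemma cell_extend m w x : cell K w x ->
  exists2 u, size u = m & cell K (w ++ u) x.
Proof.
elim: m w => [|m IH] w wx; first by exists [::] => //; rewrite cats0.
have [i wix] := cell_rcons wx; have [u su H] := IH _ wix.
by exists (i :: u); rewrite /= ?su // -cat_rcons.
Qed.

Lemma K_cell n x : K x -> exists2 w, size w = n & cell K w x.
Proof. by move=> Kx; apply: (@cell_extend n [::]). Qed.

Lemma K_bounded : exists2 M : R, 0 < M & forall x, K x -> `|x| <= M.
Proof.
have /compact_bounded [M [Mr HM]] := K_compact.
exists (`|M| + 1); first by rewrite ltr_wpDl.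
by move=> x Kx; apply: (HM (`|M| + 1)) => //; rewrite ltr_pwDr // ler_norm.
Qed.

Lemma cell_diam : exists2 M : R, 0 < M &
  forall w x y, cell K w x -> cell K w y -> `|x - y| <= M * (3^-1) ^+ size w.
Proof.
have [M M0 KM] := K_bounded; exists (M + M); first exact: addr_gt0.
move=> w x y; rewrite cellE => -[x' Kx' <-] [y' Ky' <-].
rewrite PwB normrZ ger0_norm ?exprn_ge0 ?invr_ge0 // mulrC; apply: ler_wpM2r.
  by rewrite exprn_ge0 // invr_ge0.
by rewrite (le_trans (ler_normB _ _)) // lerD ?KM.
Qed.

Lemma pow3_small (M e : R) : 0 < e ->
  exists n, forall m, (n <= m)%N -> M * (3^-1) ^+ m < e.
Proof. by apply: geometric_small; apply/andP; split; lra. Qed.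

(** A bounded set covered by its own images under the similarities is contained
    in the attractor: each of its points has an address. *)
Lemma bounded_subinvariant (S : set (R * R)) (M : R) :
  (forall x, S x -> `|x| <= M) ->
  (forall x, S x -> exists i y, S y /\ x = psi i y) -> S `<=` K.
Proof.
move=> SM SS x Sx.
have addr n : exists w y, [/\ size w = n, S y & x = Pw w y].
  elim: n => [|n [w [y [sw Sy xE]]]]; first by exists [::], x.
  have [i [y' [Sy' yE]]] := SS y Sy; exists (rcons w i), y'.
  by rewrite size_rcons sw -cats1 Pw_cat /= -yE.
have [k0 Kk0] := K_neq0.
have /closure_id -> := compact_closed (@norm_hausdorff _ _) K_compact.
move=> B /nbhs_ballP [e /= e0 eB].
have [n Hn] := pow3_small (M + `|k0|) e0.
have [w [y [sw Sy xE]]] := addr n.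
exists (Pw w k0); split; first exact: K_Pw.
apply: eB; rewrite -ball_normE /ball_ /= xE PwB sw normrZ.
rewrite ger0_norm ?exprn_ge0 ?invr_ge0 // mulrC.
apply: le_lt_trans (Hn n (leqnn _)); rewrite ler_wpM2r ?exprn_ge0 ?invr_ge0 //.
by rewrite (le_trans (ler_normB _ _)) // lerD2r SM.
Qed.

Lemma K_q i : K (q R i).
Proof.
apply: (@bounded_subinvariant [set q R i] `|q R i|) => // x -> //.
by exists i, (q R i); rewrite psi_q.
Qed.

Lemma K_0 : K 0. Proof. exact: (K_q ctr). Qed.

Lemma cell_Pw w x : K x -> cell K w (Pw w x).
Proof. by move=> Kx; rewrite cellE; exists x. Qed.

(** A linear functional is bounded on the set by its values at the fixed points of
    the similarities: each subdivision divides the excess over [c] by 3. *)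
Lemma linear_le (a : R * R) (c : R) x :
  (forall i, a.1 * (q R i).1 + a.2 * (q R i).2 <= c) -> K x ->
  a.1 * x.1 + a.2 * x.2 <= c.
Proof.
have [M M0 KM] := K_bounded => ac Kx.
set N := `|a.1| * M + `|a.2| * M + `|c|.
have H n : forall x, K x -> a.1 * x.1 + a.2 * x.2 - c <= N * (3^-1) ^+ n.
  elim: n => [|n IH] y Ky.
    rewrite expr0 mulr1.
    have n1 : `|y.1| <= M by apply: le_trans (KM y Ky); rewrite prod_normE le_max lexx.
    have n2 : `|y.2| <= M by apply: le_trans (KM y Ky); rewrite prod_normE le_max lexx orbT.
    have b1 : a.1 * y.1 <= `|a.1| * M.
      by apply: le_trans (ler_norm _) _; rewrite normrM ler_wpM2l.
    have b2 : a.2 * y.2 <= `|a.2| * M.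
      by apply: le_trans (ler_norm _) _; rewrite normrM ler_wpM2l.
    have := ler_norm (- c); rewrite normrN /N; lra.
  have [i [z [Kz ->]]] := K_split Ky.
  rewrite exprS psi1 psi2; have := IH z Kz; have := ac i; lra.
rewrite -subr_le0; apply/ler_addgt0Pr => e e0; rewrite add0r.
have [n Hn] := pow3_small N e0.
exact: le_trans (H n x Kx) (ltW (Hn n (leqnn _))).
Qed.

Lemma lin_le1 j x : K x -> lin j x <= 1.
Proof. by apply: linear_le => i; exact: lin_q_le1. Qed.

Lemma lin_geN1 j x : K x -> -1 <= lin j x.
Proof. by move=> Kx; rewrite lerNl -lin_opposite lin_le1. Qed.

(** Only the corner cell [nseq n j] comes close to the corner [q j]. *)
Lemma lin_not_corner j w x : j != ctr -> w != nseq (size w) j -> cell K w x ->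
  lin j x <= 1 - 2 * (3^-1) ^+ size w.
Proof.
move=> jc; rewrite cellE => wj [z Kz <-] {x}.
elim: w wj => [|i w IH] //=; rewrite lin_psi exprS.
have K1 := lin_le1 j (K_Pw w Kz).
have e1 : (3^-1) ^+ size w <= 1 :> R by apply: exprn_ile1; lra.
have [->|ij] := eqVneq i j; last first.
  by move=> _; have := lin_q_le0 R ij; lra.
rewrite eqseq_cons eqxx lin_qq //= => /IH; lra.
Qed.

(** Distances are bounded below only through the functionals [lin j]. After removal
    of the common prefix, a cell of the central first-level cell and one of a corner
    first-level cell that are not both at the junction leave a gap along the
    functional of that corner, and for two different corners the functionals of the
    two corners together exceed the required gap. *)
Lemma cell_separation u v x y : size u = size v -> ~~ adj u v ->
  cell K u x -> cell K v y ->
  exists j, (3^-1) ^+ size u <= `|lin j x - lin j y|.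
Proof.
elim: u v x y => [|i u IH] [|j v] // x y [suv].
rewrite /=; case: ifP => [/eqP <- nadj|ij nadj] [x' ux' <-] [y' vy' <-].
  have [k Hk] := IH v x' y' suv nadj ux' vy'; exists k.
  rewrite !lin_psi exprS.
  have -> : lin k x' / 3 + 2 / 3 * lin k (q R i) - (lin k y' / 3 + 2 / 3 * lin k (q R i))
    = 3^-1 * (lin k x' - lin k y') by field.
  by rewrite normrM ger0_norm ?invr_ge0 // ler_wpM2l // invr_ge0.
have Kx' := cell_sub ux'; have Ky' := cell_sub vy'.
have e1 : (3^-1) ^+ size u <= 1 :> R by apply: exprn_ile1; lra.
have e0 : 0 <= (3^-1) ^+ size u :> R by rewrite exprn_ge0 // invr_ge0.
(* the centre cell against a corner cell *)
have central (k : 'I_5) a b s t : k != ctr -> cell K s a -> cell K t b ->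
    size s = size t -> ~~ ((s == nseq (size t) k) && (t == nseq (size s) (opposite k))) ->
    3^-1 * (3^-1) ^+ size s <= lin k (psi k b) - lin k (psi ctr a).
  move=> kc sa tb st; rewrite !lin_psi lin_qq // q_ctr.
  have -> : lin k 0 = 0 :> R by rewrite /lin /= !mulr0 addr0.
  have a1 := lin_le1 k (cell_sub sa); have b1 := lin_geN1 k (cell_sub tb).
  have f0 : 0 <= (3^-1) ^+ size s :> R by rewrite exprn_ge0 // invr_ge0.
  rewrite negb_and => /orP [sk|tk].
    have : lin k a <= 1 - 2 * 3^-1 ^+ size s by apply: lin_not_corner => //; rewrite {1}st.
    lra.
  have : lin (opposite k) b <= 1 - 2 * 3^-1 ^+ size t.
    by apply: lin_not_corner => //; rewrite ?opposite_eq_ctr // -{1}st.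
  by rewrite lin_opposite st; rewrite st in f0; lra.
rewrite exprS; move: nadj; rewrite negb_or.
have [ic|ic] := eqVneq i ctr; last have [jc|jc] := eqVneq j ctr.
- subst i; rewrite /= => /andP [nadj _]; exists j; rewrite distrC.
  apply: le_trans (ler_norm _); apply: (central j x' y' u v) => //.
  by rewrite eq_sym ij.
- subst j; rewrite /= => nadj; exists i.
  apply: le_trans (ler_norm _); rewrite suv; apply: (central i y' x' v u) => //.
(* two different corner cells *)
- move=> _.
  have x1 := lin_geN1 i Kx'; have x2 := lin_le1 j Kx'.
  have y1 := lin_geN1 j Ky'; have y2 := lin_le1 i Ky'.
  have ij' : i != j by rewrite ij.
  have ji' : j != i by rewrite eq_sym.
  have m1 := lin_q_le0 R ji'; set m := 1 - lin i (q R j).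
  have Dm z : K z -> `|lin i z - lin j z| <= m.
    move=> Kz; rewrite ler_norml; apply/andP; split.
      have : ((q R j - q R i).1 * z.1 + (q R j - q R i).2 * z.2 <= m).
        apply: linear_le => // k; have := lin_corners_le R k jc ic ji'.
        by rewrite /m /lin /=; lra.
      by rewrite /lin /=; lra.
    have : ((q R i - q R j).1 * z.1 + (q R i - q R j).2 * z.2 <= m).
      apply: linear_le => // k; have := lin_corners_le R k ic jc ij'.
      by rewrite /m /lin /=; lra.
    by rewrite /lin /=; lra.
  have := Dm _ Kx'; have := Dm _ Ky'; rewrite !ler_norml => /andP [y3 y4] /andP [x3 x4].
  have sumE : (lin i (psi i x') - lin i (psi j y')) + (lin j (psi j y') - lin j (psi i x'))
     >= 2 / 3.
    rewrite !lin_psi !lin_qq // [lin j (q R i)]linC; rewrite /m in x3 x4 y3 y4 m1 *; lra.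
  have [H|H] := leP 3^-1 (lin i (psi i x') - lin i (psi j y')).
    exists i; apply: le_trans (ler_norm _); lra.
  exists j; rewrite distrC; apply: le_trans (ler_norm _); lra.
Qed.

Lemma cell_adj u v x : size u = size v -> cell K u x -> cell K v x -> adj u v.
Proof.
move=> suv ux vx; apply: contraT => nadj.
have [j] := cell_separation suv nadj ux vx.
by rewrite subrr normr0 leNgt exprn_gt0 // invr_gt0.
Qed.

End Cells.

(** * The geodesic distance at the scale of the cells *)

Lemma within_continuousP (R : realType) (V W : normedModType R) (A : set V)
    (f : V -> W) (x : V) (e : R) :
  {within A, continuous f} -> A x -> 0 < e ->
  exists2 del : R, 0 < del & forall y, A y -> `|x - y| < del -> `|f x - f y| < e.
Proof.
move=> /subspace_continuousP /(_ x) fc Ax e0.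
have /cvgrPdist_lt /(_ _ e0) := fc Ax.
rewrite near_withinE => /nbhs_ballP [del /= del0 H].
by exists del => // y Ay xy; apply: H => //; rewrite -ball_normE.
Qed.

Section Distance.
Variable R : realType.
Implicit Types (x y z : R * R) (i j : 'I_5) (u v w : seq 'I_5) (l : R).

Lemma eucl_dist_ge0 x y : 0 <= eucl_dist x y.
Proof. exact: sqrtr_ge0. Qed.

Lemma eucl_distC x y : eucl_dist x y = eucl_dist y x.
Proof. by rewrite /eucl_dist; congr Num.sqrt; ring. Qed.

Lemma eucl_dist_psi i x y : eucl_dist (psi i x) (psi i y) = 3^-1 * eucl_dist x y.
Proof.
rewrite /eucl_dist !psi1 !psi2.
have -> : (3^-1 * (x.1 - (q R i).1) + (q R i).1 - (3^-1 * (y.1 - (q R i).1) + (q R i).1)) ^+ 2 +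
  (3^-1 * (x.2 - (q R i).2) + (q R i).2 - (3^-1 * (y.2 - (q R i).2) + (q R i).2)) ^+ 2 =
  3^-1 ^+ 2 * ((x.1 - y.1) ^+ 2 + (x.2 - y.2) ^+ 2) by field.
by rewrite sqrtrM ?sqr_ge0 // sqrtr_sqr ger0_norm // invr_ge0.
Qed.

Lemma eucl_dist_q i : eucl_dist 0 (q R i) <= 1.
Proof.
have [_ _ q1 _] := q_coord R i.
by rewrite /eucl_dist /= !sub0r !sqrrN -[leRHS]sqrtr1 ler_wsqrtr.
Qed.

(** The existence of a path has to be part of the upper bounds on lengths: the
    infimum [cable_dist] is 0 when there is no path at all. *)
Definition linked n x y l := exists k (z : nat -> R * R),
  cable_path n x y k z /\ \sum_(i < k) eucl_dist (z i) (z i.+1) <= l.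

Lemma linked_le n x y l l' : l <= l' -> linked n x y l -> linked n x y l'.
Proof. by move=> ll' [k [z [H1 H2]]]; exists k, z; split=> //; apply: le_trans ll'. Qed.

Lemma linked_refl n x : Vbar n x -> linked n x x 0.
Proof. by move=> Vx; exists 0%N, (fun=> x); split; rewrite ?big_ord0. Qed.

Lemma linked_sym n x y l : linked n x y l -> linked n y x l.
Proof.
move=> [k [z [[Vx Vy z0 zk H] sl]]]; exists k, (fun i : nat => z (k - i)%N); split.
  split=> //; [by rewrite subn0|by rewrite subnn|].
  move=> i ik; have [|e [e1 e2 e3]] := H (k - i.+1)%N.
    by rewrite -subSn // leq_subLR addSn ltnS leq_addl.
  by exists e; split=> //; move: e3; rewrite -subSn // subSS.
apply: le_trans sl; rewrite (reindex_inj rev_ord_inj) /=.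
rewrite le_eqVlt; apply/orP; left; apply/eqP; apply: eq_bigr => i _.
have ik := ltn_ord i.
by rewrite eucl_distC; congr (eucl_dist (z _) (z _)); lia.
Qed.

Lemma linked_trans n x y z l l' :
  linked n x y l -> linked n y z l' -> linked n x z (l + l').
Proof.
move=> [k [a [[Vx Vy a0 ak H] sl]]] [k' [b [[_ Vz b0 bk H'] sl']]].
pose c (i : nat) := if (i <= k)%N then a i else b (i - k)%N.
have cl (i : nat) : (i <= k)%N -> c i = a i by rewrite /c => ->.
have cr (i : nat) : c (k + i)%N = b i.
  rewrite /c; case: i => [|i]; first by rewrite addn0 leqnn ak b0.
  have -> : (k + i.+1 <= k)%N = false by lia.
  by rewrite addKn.
have cr' (i : nat) : c (k + i).+1 = b i.+1 by rewrite -addnS cr.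
exists (k + k')%N, c; split; first split=> //.
- by rewrite cr bk.
- move=> i ik; have [ltik|leki] := ltnP i k.
    by have [e] := H i ltik; exists e; rewrite !cl // ltnW.
  have ik' : (i - k < k')%N by lia.
  have [e] := H' _ ik'.
  by exists e; rewrite -{1}[i](subnKC leki) -{2}[i](subnKC leki) cr cr'.
- rewrite big_split_ord /=; apply: lerD.
    apply: le_trans sl; rewrite le_eqVlt; apply/orP; left; apply/eqP.
    by apply: eq_bigr => i _; rewrite !cl // ltnW.
  apply: le_trans sl'; rewrite le_eqVlt; apply/orP; left; apply/eqP.
  by apply: eq_bigr => i _; rewrite cr cr'.
Qed.

Lemma segment_psi i a b z : segment a b z -> segment (psi i a) (psi i b) (psi i z).
Proof.
move=> [t t01 <-]; exists t => //.
apply/eqP; rewrite xpair_eqE /psi /= /GRing.scale /=.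
by apply/andP; split; apply/eqP; ring.
Qed.

Lemma linked_psi n i x y l :
  linked n x y l -> linked n.+1 (psi i x) (psi i y) (3^-1 * l).
Proof.
move=> [k [z [[Vx Vy z0 zk H] sl]]]; exists k, (fun a => psi i (z a)); split.
  split; [by exists i => //; exists x|by exists i => //; exists y|by rewrite z0|by rewrite zk|].
  move=> a ak; have [e [e1 e2 e3]] := H a ak.
  exists (psi i e.1, psi i e.2); split; [|exact: segment_psi|exact: segment_psi].
  by exists i => //; exists e.
rewrite (eq_bigr (fun a : 'I_k => 3^-1 * eucl_dist (z a) (z a.+1))); last first.
  by move=> a _; rewrite eucl_dist_psi.
by rewrite -mulr_sumr ler_wpM2l // invr_ge0.
Qed.

Lemma linked_Pw n w x y l :
  linked n x y l -> linked (size w + n) (Pw w x) (Pw w y) (3^-1 ^+ size w * l).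
Proof.
move=> H; elim: w => [|i w IH]; first by rewrite expr0 mul1r.
by rewrite /= exprS -mulrA addSn; exact: linked_psi.
Qed.

Lemma segment_left (a b : R * R) : segment a b a.
Proof.
exists 0; first by rewrite /= in_itv /= lexx ler01.
by rewrite subr0 scale1r scale0r addr0.
Qed.

Lemma segment_right (a b : R * R) : segment a b b.
Proof.
exists 1; first by rewrite /= in_itv /= lexx ler01.
by rewrite subrr scale1r scale0r add0r.
Qed.

Lemma Vbar0_0 : Vbar 0 (0 : R * R).
Proof.
exists (inord 0) => /=; last exact: segment_left.
by move=> /(congr1 val); rewrite /= inordK.
Qed.

Lemma psi_ctr0 : psi ctr 0 = 0 :> R * R.
Proof. exact: (psi_q R ctr). Qed.

(** The path goes through the junction of the central subcell with the corner one:
    the three legs have a third of the length each. *)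
Lemma linked_center_corner m i : linked m 0 (q R i) 1.
Proof.
elim: m i => [|m IH] i.
  have [->|ic] := eqVneq i ctr.
    apply: (linked_le _ (linked_refl Vbar0_0)) => //.
  exists 1%N, (fun a => if a is 0 then 0 else q R i); split; last first.
    by rewrite big_ord1 eucl_dist_q.
  split=> //; first exact: Vbar0_0.
    by exists i; [exact/eqP|exact: segment_right].
  case=> // _; exists (0, q R i); split; [|exact: segment_left|exact: segment_right].
  by exists i => //; exact/eqP.
apply: (@linked_le _ _ _ (3^-1 * 1 + (3^-1 * 1 + 3^-1 * 1))); first lra.
rewrite -[X in linked _ X]psi_ctr0.
apply: (linked_trans (linked_psi ctr (IH i))).
rewrite psi_junction.
apply: (linked_trans (linked_psi i (linked_sym (IH (opposite i))))).
by rewrite -[X in linked _ _ X](psi_q R i); exact: linked_psi.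
Qed.

Lemma linked_to_center u : linked (size u) (Pw u 0) (0 : R * R) 1.
Proof.
elim: u => [|i u IH] /=.
  by apply: (linked_le _ (linked_refl Vbar0_0)).
apply: (@linked_le _ _ _ (3^-1 * 1 + (3^-1 * 1 + 3^-1 * 1))); first lra.
apply: (linked_trans (linked_psi i IH)).
apply: (linked_trans (linked_psi i (linked_center_corner _ (opposite i)))).
rewrite -psi_junction -[X in linked _ _ X]psi_ctr0.
exact/linked_psi/linked_sym/linked_center_corner.
Qed.

Lemma linked_adj u v s t : adj u v -> size s = size t ->
  linked (size u + size s) (Pw (u ++ s) 0) (Pw (v ++ t) (0 : R * R))
    (4 * 3^-1 ^+ size u).
Proof.
move=> uv st; have suv := adj_size uv; have [i [j ij]] := adj_common_corner R uv.
rewrite !Pw_cat; set e := 3^-1 ^+ size u.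
apply: (@linked_le _ _ _ (e * 1 + (e * 1 + (e * 1 + e * 1)))); first lra.
apply: (linked_trans (linked_Pw u (linked_to_center s))).
apply: (linked_trans (linked_Pw u (linked_center_corner _ i))).
rewrite ij /e suv st.
apply: (linked_trans (linked_Pw v (linked_sym (linked_center_corner _ j)))).
exact/linked_Pw/linked_sym/linked_to_center.
Qed.

Lemma cable_dist_le n x y l : linked n x y l -> cable_dist n x y <= l.
Proof.
move=> [k [z [H sl]]]; apply: le_trans sl; apply: ge_inf; last by exists k, z.
by exists 0 => _ [k' [z' [_ ->]]]; apply: sumr_ge0 => i _; exact: eucl_dist_ge0.
Qed.

Lemma cable_dist_ge_lin n x y l j :
  linked n x y l -> lin j x - lin j y <= cable_dist n x y.
Proof.
move=> [k [z [H _]]]; apply: lb_le_inf; first by eexists; exists k, z.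
move=> _ [k' [z' [[_ _ <- <- _] ->]]] {k z H}.
elim: k' => [|k IH]; first by rewrite subrr big_ord0.
rewrite big_ord_recr /=; have := lin_eucl j (z' k) (z' k.+1); lra.
Qed.

Lemma Vbar_Pw u : Vbar (size u) (Pw u (0 : R * R)).
Proof. by have [k [z [[]]]] := linked_to_center u. Qed.

Variables (K : set (R * R)) (d : R * R -> R * R -> R).
Hypotheses (hK : is_vicsek_set K) (hd : is_geodesic_distance K d).

(** The distance is given by path lengths at vertices only; by continuity, bounds
    between the centres of arbitrarily small subcells pass to all points. *)
Lemma d_approx u v x y (e : R) : size u = size v -> cell K u x -> cell K v y ->
  0 < e -> exists s t, [/\ size s = size t,
    `|d x y - cable_dist (size u + size s) (Pw (u ++ s) 0) (Pw (v ++ t) 0)| < e,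
    `|x - Pw (u ++ s) 0| < e & `|y - Pw (v ++ t) 0| < e].
Proof.
move=> suv ux vy e0; have [M M0 HM] := cell_diam hK.
have [dV dc] := hd.
have Kxy : (K `*` K) (x, y) by split; [exact: cell_sub ux|exact: cell_sub vy].
have [del del0 Hdel] := within_continuousP dc Kxy e0.
have ed0 : 0 < Num.min e del by rewrite lt_min e0 del0.
have [m Hm] := pow3_small M ed0.
have [s ss us] := cell_extend hK m ux; have [t st vt] := cell_extend hK m vy.
have near w z : (m <= size w)%N -> cell K w z -> `|z - Pw w 0| < Num.min e del.
  move=> mw wz; apply: le_lt_trans (Hm _ mw); apply: HM => //.
  by apply: cell_Pw; exact: K_0 hK.
have xs := near _ _ (_ : (m <= size (u ++ s))%N) us.
have yt := near _ _ (_ : (m <= size (v ++ t))%N) vt.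
move: xs yt; rewrite !size_cat ss st !leq_addl => /(_ isT) + /(_ isT).
rewrite !lt_min => /andP [xs1 xs2] /andP [yt1 yt2].
exists s, t; split; rewrite ?ss ?st //.
rewrite -dV; last 2 first.
- by rewrite -ss -size_cat; exact: Vbar_Pw.
- by rewrite suv -st -size_cat; exact: Vbar_Pw.
apply: (Hdel (_, _)); last by rewrite prod_normE /= gt_max xs2.
by split; apply: (K_Pw hK); exact: K_0 hK.
Qed.

(** Four legs, each of at most the length of an edge: from a point to the centre of
    its cell, to the common corner, and the same in the other cell. *)
Lemma d_le_adj u v x y : adj u v -> cell K u x -> cell K v y ->
  d x y <= 4 * 3^-1 ^+ size u.
Proof.
move=> uv ux vy; apply/ler_addgt0Pr => e e0.
have [s [t [st /ltr_normlW H _ _]]] := d_approx (adj_size uv) ux vy e0.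
have := cable_dist_le (linked_adj uv st); lra.
Qed.

(** [lin j] is 1-Lipschitz for the Euclidean distance, hence along every path. *)
Lemma d_ge_lin j x y : K x -> K y -> lin j x - lin j y <= d x y.
Proof.
move=> Kx Ky; apply/ler_addgt0Pr => e e0.
have e50 : 0 < e / 5 by rewrite divr_gt0.
have [s [t [st H xs yt]]] := @d_approx [::] [::] x y _ (erefl _) Kx Ky e50.
have := cable_dist_ge_lin j (@linked_adj [::] [::] s t isT st).
have := lin_sup j x (Pw s 0); have := lin_sup j y (Pw t 0).
move: H xs yt; rewrite /= => /ltr_normlP [H1 H2] xs yt.
move=> /ler_normlP [h1 h2] /ler_normlP [h3 h4]; lra.
Qed.

(** Together with [d_le_adj], this makes the balls comparable with the stars. *)
Lemma d_lt_adj u v x y : size u = size v -> cell K u x -> cell K v y ->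
  d x y < 3^-1 ^+ size u -> adj u v.
Proof.
move=> suv ux vy; apply: contraLR => nadj; rewrite -leNgt.
have [j] := cell_separation hK suv nadj ux vy.
have Kx := cell_sub hK ux; have Ky := cell_sub hK vy.
have := d_ge_lin j Kx Ky; have := d_ge_lin (opposite j) Kx Ky.
rewrite !lin_opposite => h1 h2 /le_trans; apply; rewrite ler_norml; lra.
Qed.

End Distance.

(** * Integrals over the cells *)

Section IntegralBounds.
Local Open Scope ereal_scope.
Context d (T : measurableType d) (R : realType).
Variable mu : {measure set T -> \bar R}.
Implicit Types (D : set T) (f : T -> \bar R).

(** The integral of a nonnegative function is a supremum over simple functions
    below it, so that it is monotone without any measurability; the Korevaar-Schoen
    energies are only ever compared with integrals of explicit functions. *)
Lemma le_integral_nonneg D D' f f' :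
  (forall x, D x -> 0 <= f x) -> (forall x, D' x -> 0 <= f' x) ->
  (forall x, D x -> D' x /\ f x <= f' x) ->
  \int[mu]_(x in D) f x <= \int[mu]_(x in D') f' x.
Proof.
move=> f0 f'0 ff'; rewrite !ge0_integralE //=.
apply: le_ereal_sup => _ [h /= hf <-]; exists h => // x.
apply: le_trans (hf x) _; rewrite /patch; case: ifPn => [|_].
  by rewrite inE => /ff' [D'x ffx]; rewrite mem_set.
by case: ifPn => // /[!inE]; exact: f'0.
Qed.

(** Only the majorants have to be measurable; [f] will be the mean over a ball as a
    function of its centre. *)
Lemma integral_cover (I : eqType) (s : seq I) (F : I -> set T) (G : I -> T -> \bar R) D f :
  (forall i, measurable (F i)) -> (forall i, measurable_fun (F i) (G i)) ->
  (forall i x, F i x -> 0 <= G i x) -> (forall x, D x -> 0 <= f x) ->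
  (forall x, D x -> exists2 i, i \in s & F i x /\ f x <= G i x) ->
  \int[mu]_(x in D) f x <= \sum_(i <- s) \int[mu]_(x in F i) G i x.
Proof.
move=> mF mG G0 f0 H.
have P0 i x : 0 <= (G i \_ (F i)) x by apply: erestrict_ge0 => y; exact: G0.
have mP i : measurable_fun setT (G i \_ (F i)) by apply/(measurable_restrictT _ _).1.
rewrite (eq_bigr (fun i => \int[mu]_x (G i \_ (F i)) x)); last first.
  by move=> i _; rewrite integral_mkcond.
rewrite -ge0_integral_sum //; apply: le_integral_nonneg => //.
  by move=> x _; apply: sume_ge0.
move=> x Dx; split=> //; have [i si [Fi fG]] := H x Dx.
apply: le_trans fG _; rewrite (big_rem i si) /=.
rewrite [X in _ <= X + _]/patch mem_set // leeDl //.
by apply: sume_ge0.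
Qed.

(** The sets may overlap, as the closed cells do at their corners. *)
Lemma integral_pack (I : eqType) (s : seq I) (F : I -> set T) (a : I -> R) D f :
  (forall i, measurable (F i)) -> (forall i, (0 <= a i)%R) ->
  (forall x, D x -> 0 <= f x) -> (forall i, F i `<=` D) ->
  (forall x, D x -> (\sum_(i <- s) a i * \1_(F i) x)%:E <= f x) ->
  \sum_(i <- s) (a i)%:E * mu (F i) <= \int[mu]_(x in D) f x.
Proof.
move=> mF a0 f0 FD H.
have mP i : measurable_fun setT (fun x => (a i * \1_(F i) x)%:E).
  by apply/measurable_EFinP; apply: measurable_funM => //; exact: measurable_indic.
have P0 i x : 0 <= (a i * \1_(F i) x)%:E by rewrite lee_fin mulr_ge0.
have -> : \sum_(i <- s) (a i)%:E * mu (F i) =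
    \int[mu]_x \sum_(i <- s) (a i * \1_(F i) x)%:E.
  rewrite ge0_integral_sum //; apply: eq_bigr => i _.
  under eq_integral do rewrite EFinM.
  rewrite ge0_integralZl_EFin //; first by rewrite integral_indic // setIT.
  by apply/measurable_EFinP; exact: measurable_indic.
rewrite integral_mkcond [leRHS]integral_mkcond.
apply: le_integral_nonneg => [x _|x _|x _].
- by apply: erestrict_ge0 => y _; apply: sume_ge0.
- by apply: erestrict_ge0.
split=> //; rewrite patch_setT; have [Dx|Dx] := pselect (D x).
  by rewrite /patch mem_set // sumEFin H.
rewrite /patch memNset // big1 // => i _.
by rewrite indicE memNset ?mulr0 // => /FD.
Qed.

End IntegralBounds.

Lemma closed_measurable (R : realType) (A : set (R * R)) :
  closed A -> measurable (A : set (borel_plane R)).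
Proof.
move=> cA; rewrite -[A]setCK; apply: measurableC.
by apply: sub_sigma_algebra; exact: closed_openC.
Qed.

Lemma within_continuous_measurable (R : realType) (K : set (R * R)) (g : R * R -> R) :
  closed K -> {within K, continuous g} ->
  measurable_fun (K : set (borel_plane R)) (g : borel_plane R -> R).
Proof.
move=> cK /continuousP cg; have mK := closed_measurable cK.
apply: (measurability _ (RGenOpens.measurableE R)) => _ [_ [a [b ->] <-]].
have /cg /open_subspaceP [U oU UE] : open (`]a, b[%classic : set R) by exact: interval_open.
rewrite setIC -UE; apply: measurableI; last exact: closed_measurable.
exact: sub_sigma_algebra.
Qed.


Section CellMeasure.
Variables (R : realType) (K : set (R * R)) (d : R * R -> R * R -> R).
Variable mu : {measure set (borel_plane R) -> \bar R}.
Hypotheses (hK : is_vicsek_set K) (hd : is_geodesic_distance K d).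
Hypothesis hmu : is_vicsek_measure K mu.
Implicit Types (x y : R * R) (u v w : seq 'I_5) (r : R).

Lemma K_closed : closed K.
Proof. exact: compact_closed (@norm_hausdorff _ _) (K_compact hK). Qed.

Lemma cell_measurable w : measurable (cell K w : set (borel_plane R)).
Proof.
apply: closed_measurable; rewrite cellE.
apply: compact_closed (@norm_hausdorff _ _) _.
apply: continuous_compact (K_compact hK).
by apply: continuous_subspaceT => x; exact: Pw_continuous.
Qed.

Lemma K_measurable : measurable (K : set (borel_plane R)).
Proof. exact: (cell_measurable [::]). Qed.

Lemma mu_cell w : mu (cell K w) = ((5^-1) ^+ size w)%:E.
Proof. by case: hmu. Qed.

Definition Star w : set (borel_plane R) := \big[setU/set0]_(v <- words (size w) | adj w v) cell K v.

Lemma StarP w x : Star w x <-> exists2 v, adj w v & cell K v x.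
Proof.
rewrite /Star -bigcup_seq_cond; split => [[v /= /andP [_ wv] vx]|[v wv vx]].
  by exists v.
by exists v => //=; rewrite mem_words (adj_size wv) eqxx.
Qed.

Lemma Star_measurable w : measurable (Star w).
Proof. by apply: bigsetU_measurable => v _; exact: cell_measurable. Qed.

Lemma Star_sub w : Star w `<=` K.
Proof. by move=> x /StarP [v _ /(cell_sub hK)]. Qed.

Lemma cell_Star w v : adj w v -> cell K v `<=` Star w.
Proof. by move=> wv x vx; apply/StarP; exists v. Qed.

Lemma mu_Star w : (mu (Star w) <= (9 * (5^-1) ^+ size w)%:E)%E.
Proof.
have mc (v : seq 'I_5) := cell_measurable v.
have -> : mu (Star w) = (\int[mu]_(x in Star w) cst 1 x)%E.
  by rewrite integral_cst ?mul1e //; exact: Star_measurable.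
apply: (@le_trans _ _ (\sum_(v <- [seq v <- words (size w) | adj w v])
    \int[mu]_(x in cell K v) cst 1 x)%E).
  apply: integral_cover => //.
  move=> x /StarP [v wv vx]; exists v; last by split.
  by rewrite mem_filter wv mem_words (adj_size wv) eqxx.
rewrite (eq_big_seq (fun=> ((5^-1) ^+ size w)%:E)); last first.
  move=> v; rewrite mem_filter mem_words => /andP [_ /eqP sv].
  by rewrite integral_cst // mul1e mu_cell sv.
rewrite sumEFin lee_fin big_const_seq iter_addr_0 count_predT size_filter.
rewrite -[leLHS]mulr_natl ler_wpM2r ?exprn_ge0 ?invr_ge0 // ler_nat.
exact: count_adj.
Qed.

Lemma d_within x : K x -> {within K, continuous (d x)}.
Proof.
move=> Kx; apply/subspace_continuousP => y Ky; apply/cvgrPdist_lt => e e0.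
have [_ dc] := hd; have [del del0 H] := within_continuousP dc (conj Kx Ky : (K `*` K) (x, y)) e0.
rewrite near_withinE; apply/nbhs_ballP; exists del => // z.
rewrite -ball_normE /= => yz Kz; apply: (H (x, z)) => //.
by rewrite prod_normE /= subrr normr0 gt_max del0.
Qed.

Lemma dball_measurable x r : K x -> measurable (dball K d x r : set (borel_plane R)).
Proof.
move=> Kx; have -> : dball K d x r = K `&` d x @^-1` `]-oo, r[.
  by apply/seteqP; split => y; rewrite /dball /= in_itv.
apply: (within_continuous_measurable K_closed (d_within Kx)) => //.
exact: K_measurable.
Qed.

Lemma dball_sub_Star w x r : r <= 3^-1 ^+ size w -> cell K w x ->
  dball K d x r `<=` Star w.
Proof.
move=> rw wx y [Ky xy]; have [v sv vy] := K_cell hK (size w) Ky.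
apply/StarP; exists v => //.
by apply: (d_lt_adj hK hd _ wx vy) => //; apply: lt_le_trans rw.
Qed.

Lemma Star_sub_dball w x r : 4 * 3^-1 ^+ size w < r -> cell K w x ->
  Star w `<=` dball K d x r.
Proof.
move=> rw wx y /StarP [v wv vy]; split; first exact: cell_sub vy.
exact: le_lt_trans (d_le_adj hK hd wv wx vy) rw.
Qed.

Lemma mu_dball_ge n x r : 4 * 3^-1 ^+ n < r -> K x ->
  ((5^-1 ^+ n)%:E <= mu (dball K d x r))%E.
Proof.
move=> rn Kx; have [w sw wx] := K_cell hK n Kx.
rewrite -sw -mu_cell; apply: le_measure; rewrite ?inE.
- exact: cell_measurable.
- exact: dball_measurable.
- apply: subset_trans (Star_sub_dball _ wx); last by rewrite sw.
  exact/cell_Star/adj_refl.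
Qed.

(** As [12 <= 3 ^ 3], the ball lies in the star of a cell of level [n - 3], which
    accounts for the factor [5 ^+ 3]; the total mass is enough for smaller [n]. *)
Lemma mu_dball_le n x r : r <= 12 * 3^-1 ^+ n -> K x ->
  (mu (dball K d x r) <= (9 * 5 ^+ 3 * 5^-1 ^+ n)%:E)%E.
Proof.
move=> rn Kx; have [n3|n3] := ltnP n 3.
  apply: (@le_trans _ _ (mu K)).
    apply: le_measure; rewrite ?inE; [exact: dball_measurable|exact: K_measurable|].
    by move=> y [].
  rewrite (mu_cell [::]) lee_fin expr0.
  by move: n3 {rn}; case: n => [|[|[|//]]] _; rewrite ?exprS ?expr0; lra.
have [w sw wx] := K_cell hK (n - 3)%N Kx.
have nE : n = (size w + 3)%N by rewrite sw subnK.
have e0 : 0 <= 3^-1 ^+ size w :> R by rewrite exprn_ge0 // invr_ge0.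
apply: (@le_trans _ _ (mu (Star w))).
  apply: le_measure; rewrite ?inE; [exact: dball_measurable|exact: Star_measurable|].
  apply: dball_sub_Star => //; apply: le_trans rn _.
  rewrite nE exprD [in leLHS]mulrC -mulrA ler_piMr // !exprS expr0; lra.
apply: le_trans (mu_Star w) _; rewrite lee_fin nE exprD.
have f0 : 0 <= 5^-1 ^+ size w :> R by rewrite exprn_ge0 // invr_ge0.
by rewrite !exprS expr0; lra.
Qed.

End CellMeasure.

(** * The p-th moments of f about a constant *)

(** For [f] in L^p and [A] in the set the integral is finite, so that [fine] does not
    replace it by a default value: see [momentE]. *)
Definition moment d (T : measurableType d) (R : realType)
    (mu : {measure set T -> \bar R}) (p : R) (f : T -> R) (A : set T) (c : R) : R :=
  fine (\int[mu]_(x in A) (`|f x - c| `^ p)%:E).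

Lemma ae_imply d (T : measurableType d) (R : realType)
    (mu : {measure set T -> \bar R}) (P Q : T -> Prop) :
  (forall x, P x -> Q x) -> {ae mu, forall x, P x} -> {ae mu, forall x, Q x}.
Proof. by move=> PQ; apply: filterS. Qed.

Section Moments.
Context d (T : measurableType d) (R : realType).
Variables (mu : {measure set T -> \bar R}) (p : R) (f : T -> R) (K : set T).
Hypotheses (p1 : 1 <= p) (mK : measurable K) (muK : (mu K < +oo)%E).
Hypotheses (mf : measurable_fun K f)
  (fp : (\int[mu]_(x in K) (`|f x| `^ p)%:E < +oo)%E).
Implicit Types (A B : set T) (c : R).
Local Notation moment := (moment mu p f).

Let p0 : 0 <= p. Proof. exact: le_trans p1. Qed.

Lemma measurable_dist_powR A (g : T -> R) c : measurable_fun A g ->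
  measurable_fun A (fun x => (`|g x - c| `^ p)%:E).
Proof.
move=> mg; apply/measurable_EFinP.
apply: (@measurableT_comp _ _ _ _ _ _ (@powR R ^~ p)) => //.
apply: measurableT_comp => //.
by apply: measurable_funB => //; exact: measurable_cst.
Qed.

Lemma measurable_moment A c : measurable A -> A `<=` K ->
  measurable_fun A (fun x => (`|f x - c| `^ p)%:E).
Proof. by move=> mA AK; apply: measurable_dist_powR; apply: measurable_funS mf. Qed.

Lemma moment_ge0 A c : 0 <= moment A c.
Proof. by rewrite fine_ge0 // integral_ge0 // => x _; rewrite lee_fin powR_ge0. Qed.

Lemma mu_lty A : measurable A -> A `<=` K -> (mu A < +oo)%E.
Proof. by move=> mA AK; apply: le_lt_trans muK; apply: le_measure; rewrite ?inE. Qed.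

Lemma mu_fineK A : measurable A -> A `<=` K -> mu A = (fine (mu A))%:E.
Proof. by move=> mA AK; rewrite fineK // ge0_fin_numE // mu_lty. Qed.

Lemma moment_lty A c : measurable A -> A `<=` K ->
  (\int[mu]_(x in A) (`|f x - c| `^ p)%:E < +oo)%E.
Proof.
move=> mA AK.
have mc : measurable_fun K (cst ((2 `^ (p - 1) * `|c| `^ p)%:E)) by exact: measurable_cst.
have m1 : measurable_fun K (fun x => (`|f x| `^ p)%:E).
  have := measurable_moment 0 mK (@subset_refl _ K).
  by under eq_fun do rewrite subr0.
apply: (@le_lt_trans _ _ (\int[mu]_(x in K) ((2 `^ (p - 1))%:E * (`|f x| `^ p)%:E +
    cst ((2 `^ (p - 1) * `|c| `^ p)%:E) x))%E).
  apply: le_integral_nonneg => [x _|x _|x Ax].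
  - by rewrite lee_fin powR_ge0.
  - by rewrite adde_ge0 ?mule_ge0 ?lee_fin ?mulr_ge0 ?powR_ge0.
  split; first exact: AK.
  rewrite -!EFinM -EFinD lee_fin.
  have := @powR_dist _ _ p1 (f x) 0 c.
  by rewrite subr0 sub0r normrN mulrDr.
rewrite ge0_integralD //; last 2 first.
- by apply: measurable_funeM.
- by move=> x _; rewrite lee_fin mulr_ge0 ?powR_ge0.
rewrite ge0_integralZl_EFin ?powR_ge0 //.
rewrite integral_cst // lte_add_pinfty //.
- by rewrite lte_mul_pinfty ?lee_fin ?powR_ge0.
- by rewrite lte_mul_pinfty ?lee_fin ?mulr_ge0 ?powR_ge0.
Qed.

Lemma momentE A c : measurable A -> A `<=` K ->
  (\int[mu]_(x in A) (`|f x - c| `^ p)%:E)%E = (moment A c)%:E.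
Proof.
move=> mA AK; rewrite fineK // ge0_fin_numE ?moment_lty //.
by apply: integral_ge0 => x _; rewrite lee_fin powR_ge0.
Qed.

Lemma moment_cover (I : eqType) (s : seq I) (F : I -> set T) A c :
  measurable A -> A `<=` K ->
  (forall i, measurable (F i)) -> (forall i, F i `<=` K) ->
  (forall x, A x -> exists2 i, i \in s & F i x) ->
  moment A c <= \sum_(i <- s) moment (F i) c.
Proof.
move=> mA AK mF FK H; rewrite -lee_fin -sumEFin -momentE //.
under eq_bigr do rewrite -momentE //.
apply: integral_cover => [i|i|i x _|x _|x Ax].
- exact: mF.
- exact: measurable_moment.
- by rewrite lee_fin powR_ge0.
- by rewrite lee_fin powR_ge0.
- by have [i si Fi] := H x Ax; exists i.
Qed.

Lemma moment_mono A B c : measurable A -> measurable B -> A `<=` B -> B `<=` K ->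
  moment A c <= moment B c.
Proof.
move=> mA mB AB BK; have AK := subset_trans AB BK.
rewrite -lee_fin -!momentE //; apply: le_integral_nonneg => [x _|x _|x Ax].
- by rewrite lee_fin powR_ge0.
- by rewrite lee_fin powR_ge0.
- by split=> //; exact: AB.
Qed.

Lemma moment_shift A c c' : measurable A -> A `<=` K ->
  moment A c <= 2 `^ (p - 1) * (moment A c' + `|c' - c| `^ p * fine (mu A)).
Proof.
move=> mA AK; rewrite -lee_fin EFinM EFinD EFinM -!momentE // -mu_fineK //.
have mc : measurable_fun A (cst ((`|c' - c| `^ p)%:E)) by exact: measurable_cst.
have mm := measurable_moment c' mA AK.
rewrite -integral_cst // -ge0_integralD //; last first.
  by move=> x _; rewrite lee_fin powR_ge0.
rewrite -ge0_integralZl_EFin ?powR_ge0 //; last 2 first.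
- by move=> x _; rewrite adde_ge0 ?lee_fin ?powR_ge0.
- exact: emeasurable_funD.
apply: le_integral_nonneg => [x _|x _|x Ax].
- by rewrite lee_fin powR_ge0.
- by rewrite mule_ge0 ?adde_ge0 ?lee_fin ?powR_ge0.
- by split=> //; rewrite -EFinD -EFinM lee_fin; exact: powR_dist.
Qed.

Lemma moment_dist A c c' : measurable A -> A `<=` K ->
  `|c - c'| `^ p * fine (mu A) <= 2 `^ (p - 1) * (moment A c + moment A c').
Proof.
move=> mA AK; rewrite -lee_fin !EFinM EFinD -!momentE // -mu_fineK //.
have mm := measurable_moment c mA AK; have mm' := measurable_moment c' mA AK.
rewrite -integral_cst // -ge0_integralD //.
rewrite -ge0_integralZl_EFin ?powR_ge0 //; last 2 first.
- by move=> x _; rewrite adde_ge0 ?lee_fin ?powR_ge0.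
- exact: emeasurable_funD.
apply: le_integral_nonneg => [x _|x _|x Ax].
- by rewrite lee_fin powR_ge0.
- by rewrite mule_ge0 ?adde_ge0 ?lee_fin ?powR_ge0.
split=> //; rewrite -EFinD -EFinM lee_fin [`|f x - c|]distrC; exact: powR_dist.
Qed.

Lemma moment_eq0 c : moment K c = 0 -> {ae mu, forall x, K x -> f x = c}.
Proof.
move=> m0; have mm := measurable_moment c mK (@subset_refl _ K).
have : (\int[mu]_(x in K) `|(`|f x - c| `^ p)%:E| = 0)%E.
  by rewrite -[RHS]/(0%R%:E) -m0 -momentE //; apply: eq_integral => x _; rewrite gee0_abs // lee_fin powR_ge0.
move/(ae_eq_integral_abs mu mK mm); apply: filterS => x H Kx.
have [H0] : (`|f x - c| `^ p)%:E = 0%R%:E := H Kx.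
have /eqP := powR_eq0_eq0 H0.
by rewrite normr_eq0 subr_eq0 => /eqP.
Qed.

End Moments.

(** * The discrete energy of oscillations *)

Section Oscillation.
Variables (R : realType) (K : set (R * R)).
Variable mu : {measure set (borel_plane R) -> \bar R}.
Hypotheses (hK : is_vicsek_set K) (hmu : is_vicsek_measure K mu).
Variables (p : R) (f : borel_plane R -> R).
Hypotheses (p1 : 1 <= p) (hf : Lp K mu p f).
Implicit Types (u v w : seq 'I_5) (c : R).
Local Notation moment := (moment mu p f).
Local Notation Star := (Star K).

Let mK : measurable (K : set (borel_plane R)) := K_measurable hK.
Let mf : measurable_fun (K : set (borel_plane R)) f := hf.1.
Let fp := hf.2.
Let mcell v := cell_measurable hK v.
Let mStar v := Star_measurable hK v.
Let cellK v := @cell_sub _ _ hK v.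
Let StarK v := @Star_sub _ _ hK v.

Let muK : (mu K < +oo)%E.
Proof. by rewrite (mu_cell hmu [::]) ltry. Qed.

Lemma mu_cell_fine w : fine (mu (cell K w)) = 5^-1 ^+ size w.
Proof. by rewrite mu_cell. Qed.

Lemma mu_Star_fine w : fine (mu (Star w)) <= 9 * 5^-1 ^+ size w.
Proof. by rewrite -lee_fin -(mu_fineK mK muK) //; exact: mu_Star. Qed.

Lemma moment_Star_cover n m w c : size w = n ->
  moment (Star w) c <=
    \sum_(v <- words n | adj w v) \sum_(u <- words m) moment (cell K (v ++ u)) c.
Proof.
move=> sw; rewrite -(sum_star m (fun v => moment (cell K v) c) sw) -big_filter.
apply: (moment_cover p1 mK muK mf fp) => // x /StarP [v wv vx].
have [u su ux] := cell_extend hK m vx; exists (v ++ u) => //.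
by rewrite mem_filter star_cat // mem_words size_cat su -(adj_size wv) sw eqxx.
Qed.

Lemma moment_cell_Star w c : moment (cell K w) c <= moment (Star w) c.
Proof.
apply: (moment_mono p1 mK muK mf fp) => //.
exact/cell_Star/adj_refl.
Qed.

(** Measuring the oscillation by the best constant, rather than by a double
    integral, leaves only integrals in one variable to estimate. *)
Definition osc w : R := inf [set 5 ^+ size w * moment (Star w) c | c in [set: R]].

Let osc_set_inf w : has_inf [set 5 ^+ size w * moment (Star w) c | c in [set: R]].
Proof.
split; first by exists (5 ^+ size w * moment (Star w) 0), 0.
by exists 0 => _ [c _ <-]; rewrite mulr_ge0 ?exprn_ge0 ?moment_ge0.
Qed.

Lemma osc_le w c : osc w <= 5 ^+ size w * moment (Star w) c.
Proof. by apply: ge_inf; [case: (osc_set_inf w)|exists c]. Qed.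

Lemma osc_ge0 w : 0 <= osc w.
Proof.
apply: lb_le_inf; first by case: (osc_set_inf w).
by move=> _ [c _ <-]; rewrite mulr_ge0 ?exprn_ge0 ?moment_ge0.
Qed.

(** The infimum need not be attained; the tolerance [e] may decrease with the level
    as fast as is needed to be summed over all words. *)
Lemma osc_choice (e : nat -> R) : (forall n, 0 < e n) ->
  {c : seq 'I_5 -> R & forall w,
     5 ^+ size w * moment (Star w) (c w) <= osc w + e (size w)}.
Proof.
move=> e0; apply: (@choice _ _
  (fun w c => 5 ^+ size w * moment (Star w) c <= osc w + e (size w))) => w.
have [_ [c _ <-] H] := inf_adherent (e0 (size w)) (osc_set_inf w).
by exists c; exact: ltW.
Qed.

(** The factor by which the energy is renormalised from one level to the next. *)
Definition lam : R := 3 `^ (p - 1).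

Lemma lam_ge1 : 1 <= lam.
Proof. by rewrite /lam -[leLHS](powRr0 3) ler_powR ?subr_ge0 // ler1n. Qed.

Lemma lam_gt0 : 0 < lam. Proof. exact: lt_le_trans lam_ge1. Qed.

Lemma lamE n : 3 `^ ((p - 1) * n%:R) = lam ^+ n.
Proof. by rewrite powRrM powR_mulrn // powR_ge0. Qed.

Definition osc_energy n : R := lam ^+ n * \sum_(w <- words n) osc w.

Lemma osc_energy_ge0 n : 0 <= osc_energy n.
Proof.
rewrite mulr_ge0 ?exprn_ge0 ?(ltW lam_gt0) //.
by apply: sumr_ge0 => w _; exact: osc_ge0.
Qed.

(** A Poincare inequality: chains of cells of level [n + m] control the
    oscillation over a star of level [n]. *)
Lemma osc_poincare n m (c H : seq 'I_5 -> R) :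
  (forall v v', size v = (n + m)%N -> size v' = (n + m)%N -> adj v v' ->
     `|c v - c v'| `^ p <= H v + H v') ->
  (forall v, 0 <= H v) ->
  \sum_(w <- words n) osc w <= 2 `^ p * (9 *
     (5^-1 ^+ m * \sum_(v <- words (n + m)) 5 ^+ (n + m) * moment (cell K v) (c v))
   + 81 * 2 `^ p * (lam ^+ m * \sum_(v <- words (n + m)) H v)).
Proof.
move=> cH H0.
have pp : 0 <= 2 `^ p :> R by rewrite powR_ge0.
have l0 := lam_gt0.
pose M v := \sum_(u <- words m) 5 ^+ (n + m) * moment (cell K (v ++ u)) (c (v ++ u)).
pose S v := \sum_(u <- words m) H (v ++ u).
have M0 v : 0 <= M v.
  by apply: sumr_ge0 => u _; rewrite mulr_ge0 ?exprn_ge0 ?moment_ge0.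
have S0 v : 0 <= S v by apply: sumr_ge0.
have step w : size w = n -> osc w <= 2 `^ p * (
     5^-1 ^+ m * (\sum_(v <- words n | adj w v) M v)
   + 9 * 2 `^ p * lam ^+ m * \sum_(v <- words n | adj w v) S v).
  move=> sw; set u0 := nseq m ctr; have su0 : size u0 = m by rewrite size_nseq.
  set SS := \sum_(v <- words n | adj w v) S v.
  have SS0 : 0 <= SS by apply: sumr_ge0.
  apply: le_trans (osc_le w (c (w ++ u0))) _; rewrite sw.
  have one v u : adj w v -> size u = m -> 5 ^+ n * moment (cell K (v ++ u)) (c (w ++ u0)) <=
      2 `^ p * (5^-1 ^+ m * (5 ^+ (n + m) * moment (cell K (v ++ u)) (c (v ++ u)))
        + 5^-1 ^+ m * (2 `^ p * lam ^+ m * SS)).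
    move=> wv su.
    have svu : size (v ++ u) = (n + m)%N by rewrite size_cat su -(adj_size wv) sw.
    have := chain_bound p1 cH H0 sw wv su su0.
    rewrite sum_star // -/S lamE => hc.
    have := moment_shift p1 mK muK mf fp (c (w ++ u0)) (c (v ++ u)) (mcell (v ++ u)) (@cellK _).
    rewrite mu_cell_fine svu => /(ler_wpM2l (exprn_ge0 n (ler0n R 5))) /le_trans; apply.
    set a := moment _ _.
    have a0 : 0 <= a by exact: moment_ge0.
    set b := `|_| `^ p in hc *.
    have -> : 5 ^+ n * (2 `^ (p - 1) * (a + b * 5^-1 ^+ (n + m))) =
        2 `^ (p - 1) * (5 ^+ n * a + b * 5^-1 ^+ m).
      by rewrite exprD !exprVn; field; rewrite !expf_neq0.
    have -> : 5^-1 ^+ m * (5 ^+ (n + m) * a) = 5 ^+ n * a.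
      by rewrite exprD !exprVn; field; rewrite !expf_neq0.
    apply: ler_pM; rewrite ?powR_ge0 //.
    - by rewrite addr_ge0 // mulr_ge0 ?exprn_ge0 ?powR_ge0 ?invr_ge0.
    - by rewrite ler_powR ?ler1n // gerBl.
    - by rewrite lerD2l mulrC ler_wpM2l // exprn_ge0 // invr_ge0.
  apply: (@le_trans _ _ (\sum_(v <- words n | adj w v) \sum_(u <- words m)
      5 ^+ n * moment (cell K (v ++ u)) (c (w ++ u0)))).
    under eq_bigr do rewrite -mulr_sumr.
    by rewrite -mulr_sumr ler_wpM2l ?exprn_ge0 //; exact: moment_Star_cover.
  apply: (@le_trans _ _ (\sum_(v <- words n | adj w v)
      2 `^ p * (5^-1 ^+ m * M v + 2 `^ p * lam ^+ m * SS))).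
    apply: ler_sum => v wv.
    apply: le_trans (ler_sum_words (fun u => one v u wv)) _.
    rewrite -mulr_sumr big_split /= -mulr_sumr sum_words_const -/(M v).
    by rewrite [5 ^+ m * _]mulrA -exprMn divff ?expr1n ?mul1r // pnatr_eq0.
  rewrite -mulr_sumr ler_wpM2l // big_split /= -mulr_sumr lerD2l.
  rewrite big_const_seq iter_addr_0 -[leLHS]mulr_natl -!mulrA.
  rewrite ler_wpM2r ?mulr_ge0 ?exprn_ge0 ?(ltW l0) // ler_nat.
  exact: count_adj.
apply: le_trans (ler_sum_words step) _; rewrite -[leLHS]mulr_sumr ler_wpM2l //.
rewrite big_split /= -[X in X + _ <= _]mulr_sumr -[X in _ + X <= _]mulr_sumr; apply: lerD.
  rewrite [leRHS]mulrCA ler_wpM2l ?exprn_ge0 ?invr_ge0 //.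
  by rewrite [X in 9 * X]sum_words_cat; exact: sum_adj.
rewrite [X in _ * (_ * X)]sum_words_cat -/S.
have -> : 81 * 2 `^ p * (lam ^+ m * \sum_(i <- words n) S i) =
  9 * 2 `^ p * lam ^+ m * (9 * \sum_(i <- words n) S i) by ring.
rewrite ler_wpM2l ?mulr_ge0 ?exprn_ge0 ?(ltW l0) //; exact: sum_adj.
Qed.

(** The best constants of neighbouring stars are close, both being tested on
    a cell common to the two stars. *)
Lemma osc_adj (c : seq 'I_5 -> R) (e : nat -> R) u v :
  (forall w, 5 ^+ size w * moment (Star w) (c w) <= osc w + e (size w)) ->
  adj u v ->
  `|c u - c v| `^ p <= 2 `^ (p - 1) * (osc u + e (size u)) + 2 `^ (p - 1) * (osc v + e (size v)).
Proof.
move=> Hc uv; have suv := adj_size uv.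
have := moment_dist p1 mK muK mf fp (c u) (c v) (mcell u) (@cellK _).
rewrite mu_cell_fine => H.
have n0 : 0 < 5 ^+ size u :> R by rewrite exprn_gt0.
have p0 : 0 < 2 `^ (p - 1) :> R by rewrite powR_gt0.
rewrite -mulrDr; apply: (@le_trans _ _ (2 `^ (p - 1) * (5 ^+ size u * moment (cell K u) (c u) +
   5 ^+ size u * moment (cell K u) (c v)))).
  rewrite -mulrDr mulrCA mulrC -ler_pdivrMr //.
  by rewrite -exprVn.
rewrite ler_pM2l //; apply: lerD.
  by apply: le_trans (Hc u); rewrite ler_pM2l // moment_cell_Star.
apply: le_trans (Hc v); rewrite suv ler_pM2l -?suv //.
apply: (moment_mono p1 mK muK mf fp) => //.
by apply: cell_Star; rewrite adj_sym.
Qed.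

Definition mono_const : R := 2 `^ p * (9 + 81 * 2 `^ p * 2 `^ (p - 1)).

Lemma mono_const_gt0 : 0 < mono_const.
Proof. by rewrite mulr_gt0 ?addr_gt0 ?mulr_gt0 ?powR_gt0. Qed.

(** Weak monotonicity: the Poincare inequality is applied to almost best constants
    of the small stars, whose differences are controlled by [osc_adj]; the tolerance
    [e] then tends to 0 with [n] and [m] fixed. *)
Lemma osc_energy_mono n m : osc_energy n <= mono_const * osc_energy (n + m).
Proof.
rewrite /mono_const.
set A := 2 `^ p; set P := 2 `^ (p - 1) : R.
have A0 : 0 < A by rewrite powR_gt0.
have P0 : 0 < P by rewrite powR_gt0.
set Q := \sum_(v <- words (n + m)) osc v.
have Q0 : 0 <= Q by apply: sumr_ge0 => v _; exact: osc_ge0.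
have l0 := lam_gt0; have lm1 : 1 <= lam ^+ m by rewrite exprn_ege1 // lam_ge1.
have H e : 0 < e -> \sum_(w <- words n) osc w <=
    A * (9 + 81 * A * P) * lam ^+ m * (Q + 5 ^+ (n + m) * e).
  move=> e0; have [c Hc] := osc_choice (fun _ : nat => e0).
  pose H v := P * (osc v + e).
  have Hv v : 0 <= H v by rewrite mulr_ge0 ?addr_ge0 ?osc_ge0 // ltW.
  have cH v v' : size v = (n + m)%N -> size v' = (n + m)%N -> adj v v' ->
     `|c v - c v'| `^ p <= H v + H v' by move=> _ _; exact: (osc_adj Hc).
  apply: le_trans (osc_poincare cH Hv) _; rewrite -/A.
  have sumE : \sum_(v <- words (n + m)) (osc v + e) = Q + 5 ^+ (n + m) * e.
    by rewrite big_split /= sum_words_const.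
  have E0 : 0 <= Q + 5 ^+ (n + m) * e.
    by rewrite addr_ge0 // mulr_ge0 ?exprn_ge0 // ltW.
  have T1 : \sum_(v <- words (n + m)) 5 ^+ (n + m) * moment (cell K v) (c v) <=
      Q + 5 ^+ (n + m) * e.
    rewrite -sumE; apply: ler_sum_words => v sv.
    apply: le_trans (Hc v); rewrite sv ler_wpM2l ?exprn_ge0 //.
    exact: moment_cell_Star.
  have T2 : 5^-1 ^+ m * (\sum_(v <- words (n + m)) 5 ^+ (n + m) * moment (cell K v) (c v))
     <= lam ^+ m * (Q + 5 ^+ (n + m) * e).
    apply: ler_pM T1; first by rewrite exprn_ge0 ?invr_ge0.
      by apply: sumr_ge0 => v _; rewrite mulr_ge0 ?exprn_ge0 ?moment_ge0.
    by apply: le_trans lm1; rewrite exprn_ile1 ?invr_ge0 //; lra.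
  have -> : \sum_(v <- words (n + m)) H v = P * (Q + 5 ^+ (n + m) * e).
    by rewrite /H -mulr_sumr sumE.
  set E := Q + _ in E0 T1 T2 *.
  have -> : A * (9 + 81 * A * P) * lam ^+ m * E =
    A * (9 * (lam ^+ m * E) + 81 * A * (lam ^+ m * (P * E))) by ring.
  by rewrite ler_pM2l // lerD2r ler_pM2l.
rewrite /osc_energy -/Q exprD.
have -> : A * (9 + 81 * A * P) * (lam ^+ n * lam ^+ m * Q) =
  lam ^+ n * (A * (9 + 81 * A * P) * lam ^+ m * Q) by ring.
rewrite ler_pM2l ?exprn_gt0 //; apply/ler_addgt0Pr => e e0.
set D := A * (9 + 81 * A * P) * lam ^+ m.
have D0 : 0 < D.
  by rewrite /D !mulr_gt0 ?addr_gt0 ?mulr_gt0 ?exprn_gt0.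
have n0 : 0 < 5 ^+ (n + m) :> R by rewrite exprn_gt0.
apply: le_trans (H (e / (D * 5 ^+ (n + m))) _) _; first by rewrite divr_gt0 // mulr_gt0.
rewrite -/D mulrDr lerD2l; have -> : D * (5 ^+ (n + m) * (e / (D * 5 ^+ (n + m)))) = e.
  by field; rewrite !gt_eqF.
by [].
Qed.

End Oscillation.

(** * Comparison of the Korevaar-Schoen and oscillation energies *)

Section KorevaarSchoen.
Variables (R : realType) (K : set (R * R)) (d : R * R -> R * R -> R).
Variable mu : {measure set (borel_plane R) -> \bar R}.
Hypotheses (hK : is_vicsek_set K) (hd : is_geodesic_distance K d).
Hypothesis hmu : is_vicsek_measure K mu.
Variables (p alpha : R) (f : borel_plane R -> R).
Hypotheses (p1 : 1 <= p) (hf : Lp K mu p f).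
Hypothesis pa0 : 0 <= p * alpha.
Implicit Types (x y : R * R) (u v w : seq 'I_5) (r : R).
Local Notation moment := (moment mu p f).
Local Notation Star := (Star K).
Local Notation osc := (osc K mu p f).
Local Notation osc_energy := (osc_energy K mu p f).
Local Notation kappa := (3 `^ (p * alpha)).
Local Notation E := (Epa K d mu p alpha f).

Let mK : measurable (K : set (borel_plane R)) := K_measurable hK.
Let mf : measurable_fun (K : set (borel_plane R)) f := hf.1.
Let fp := hf.2.
Let mcell v := cell_measurable hK v.
Let mStar v := Star_measurable hK v.
Let cellK v := @cell_sub _ _ hK v.
Let StarK v := @Star_sub _ _ hK v.
Let l0 := lam_gt0 p1.

Let muK : (mu K < +oo)%E.
Proof. by rewrite (mu_cell hmu [::]) ltry. Qed.

Let kappa_gt0 : 0 < kappa. Proof. by rewrite powR_gt0. Qed.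

Lemma scale_powR n : (3^-1 ^+ n) `^ (p * alpha) = kappa ^- n.
Proof.
rewrite -(@powR_mulrn _ 3^-1) ?invr_ge0 // powRAC powR_mulrn ?powR_ge0 //.
by rewrite -powR_inv1 // powRAC powR_inv1 ?(ltW kappa_gt0) // exprVn.
Qed.

(** The least [n] whose stars fit into the balls of radius [r], by [d_le_adj]; unless
    [n = 0], the preceding level fails, whence [12 = 3 * 4]. *)
Lemma radius_scale r : 0 < r ->
  exists n, 4 * 3^-1 ^+ n < r /\ (n = 0%N \/ r <= 12 * 3^-1 ^+ n).
Proof.
move=> r0; have [m Hm] := pow3_small 4 r0.
have ex : exists n, 4 * 3^-1 ^+ n < r by exists m; exact: Hm.
case: (ex_minnP ex) => [[|n] Hn min]; first by exists 0%N; split=> //; left.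
exists n.+1; split=> //; right; rewrite leNgt; apply/negP => H.
have := min n; rewrite ltnn => /(_ _)/wrap [] //.
by apply: le_lt_trans H; rewrite exprS; lra.
Qed.

Let integrand_ge0 x r y : (0 <= (`|f y - f x| `^ p / r `^ (p * alpha))%:E)%E.
Proof. by rewrite lee_fin divr_ge0 ?powR_ge0. Qed.

Lemma Star_integral w c s : 0 <= s ->
  (\int[mu]_(y in Star w) (`|f y - c| `^ p * s)%:E)%E = (moment (Star w) c * s)%:E.
Proof.
move=> s0; under eq_integral do rewrite EFinM.
rewrite ge0_integralZr ?lee_fin //; last first.
  exact: (measurable_moment p mK mf c (mStar w) (@StarK w)).
by rewrite (momentE p1 mK muK mf fp) // EFinM.
Qed.

Let mean x r : \bar R := ((mu (dball K d x r))^-1 *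
     \int[mu]_(y in dball K d x r) (`|f y - f x| `^ p / r `^ (p * alpha))%:E)%E.

Let mean_ge0 x r : (0 <= mean x r)%E.
Proof. by rewrite mule_ge0 ?inve_ge0 // integral_ge0. Qed.

Let mu_dball_fine n x r : 4 * 3^-1 ^+ n < r -> K x ->
  exists2 b : R, mu (dball K d x r) = b%:E & 5^-1 ^+ n <= b.
Proof.
move=> rn Kx; have := mu_dball_ge hK hd hmu rn Kx.
have : (mu (dball K d x r) < +oo)%E.
  apply: le_lt_trans muK; apply: le_measure; rewrite ?inE //.
    exact: dball_measurable.
  by move=> y [].
case: (mu _) => [b| |] // _; rewrite lee_fin => H; by exists b.
Qed.

(* the constant of mu_dball_le *)
Let N : R := 9 * 5 ^+ 3.

Let N0 : 0 < N. Proof. by rewrite mulr_gt0 // exprn_gt0. Qed.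

Let inv5 n : 0 < 5^-1 ^+ n :> R. Proof. by rewrite exprn_gt0 // invr_gt0. Qed.

(** The ball contains the star of [w], and [f x] is one of the constants over which
    the infimum [osc w] is taken. *)
Lemma mean_ge w x r : 4 * 3^-1 ^+ size w < r -> r <= 12 * 3^-1 ^+ size w ->
  cell K w x ->
  ((osc w * (kappa ^+ size w / (N * 12 `^ (p * alpha))))%:E <= mean x r)%E.
Proof.
move=> r1 r2 wx; have Kx := cellK wx; set n := size w in r1 r2 *.
have r0 : 0 < r by apply: le_lt_trans r1; rewrite mulr_ge0 // exprn_ge0 // invr_ge0.
have [b bE b1] := mu_dball_fine r1 Kx.
have b0 : 0 < b by apply: lt_le_trans b1.
have b2 : b <= N * 5^-1 ^+ n.
  by rewrite -lee_fin -bE; exact: mu_dball_le r2 Kx.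
rewrite /mean bE inver gt_eqF //; set s := r `^ (p * alpha).
have s0 : 0 < s by rewrite powR_gt0.
have s1 : s <= 12 `^ (p * alpha) * kappa ^- n.
  rewrite -scale_powR -powRM ?exprn_ge0 ?invr_ge0 //.
  by apply: ge0_ler_powR => //; rewrite nnegrE ?mulr_ge0 ?exprn_ge0 ?invr_ge0 // ltW.
apply: (@le_trans _ _ ((b^-1)%:E * (moment (Star w) (f x) * s^-1)%:E)%E); last first.
  rewrite lee_wpmul2l ?lee_fin ?invr_ge0 ?(ltW b0) //.
  rewrite -Star_integral ?invr_ge0 ?(ltW s0) //.
  apply: le_integral_nonneg => [y _|y _|y wy].
  - by rewrite lee_fin mulr_ge0 ?powR_ge0 // invr_ge0 ltW.
  - exact: integrand_ge0.
  - by split=> //; apply: (Star_sub_dball hK hd r1 wx).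
rewrite -EFinM lee_fin.
have n0 : 0 < 5 ^+ n :> R by rewrite exprn_gt0.
have L0 : 0 < kappa ^+ n by rewrite exprn_gt0.
have a0 : 0 < 12 `^ (p * alpha) :> R by rewrite powR_gt0.
have m1 : osc w <= 5 ^+ n * moment (Star w) (f x) by exact: osc_le.
have m0 := osc_ge0 K mu p f w.
have i1 : 5 ^+ n / N <= b^-1.
  rewrite -[leLHS]invrK lef_pV2 ?posrE ?invr_gt0 ?divr_gt0 //.
  by rewrite invfM invrK mulrC -exprVn.
have i2 : kappa ^+ n / 12 `^ (p * alpha) <= s^-1.
  rewrite -[leLHS]invrK lef_pV2 ?posrE ?invr_gt0 ?divr_gt0 //.
  by rewrite invfM invrK mulrC.
apply: (@le_trans _ _ ((5 ^+ n / N) * (moment (Star w) (f x) *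
    (kappa ^+ n / 12 `^ (p * alpha))))).
  have -> : 5 ^+ n / N * (moment (Star w) (f x) *
      (kappa ^+ n / 12 `^ (p * alpha))) =
    (5 ^+ n * moment (Star w) (f x)) * (kappa ^+ n / (N * 12 `^ (p * alpha))).
    by field; rewrite !gt_eqF.
  by rewrite ler_wpM2r // divr_ge0 ?mulr_ge0 ?(ltW L0) ?(ltW a0).
apply: ler_pM => //.
- by rewrite divr_ge0 ?(ltW n0) ?(ltW N0).
- by rewrite mulr_ge0 ?moment_ge0 // divr_ge0 ?(ltW L0) ?(ltW a0).
- by rewrite ler_wpM2l ?moment_ge0.
Qed.

Definition low_const : R := 9 * (9 * 5 ^+ 3) * 12 `^ (p * alpha).

Lemma low_const_gt0 : 0 < low_const.
Proof. by rewrite /low_const -/N !mulr_gt0 // powR_gt0. Qed.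

(** Every point lies in at most nine cells of level [n], by [cell_adj] and
    [count_adj]; this is the factor 9 of [low_const]. *)
Lemma osc_energy_le n r : 4 * 3^-1 ^+ n < r -> r <= 12 * 3^-1 ^+ n ->
  (((kappa / 5) ^+ n * \sum_(w <- words n) osc w)%:E <= low_const%:E * E r)%E.
Proof.
rewrite /low_const -/N; have a0 : 0 < 12 `^ (p * alpha) :> R by rewrite powR_gt0.
have C0 : 0 < 9 * N * 12 `^ (p * alpha) by rewrite !mulr_gt0.
move=> r1 r2.
pose a w := osc w * (kappa ^+ n / (N * 12 `^ (p * alpha))) / 9.
have L0 : 0 < kappa ^+ n by rewrite exprn_gt0.
have aw0 w : 0 <= a w.
  by rewrite divr_ge0 // mulr_ge0 ?osc_ge0 // divr_ge0 ?mulr_ge0 ?(ltW L0) ?(ltW a0).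
have pack : (\sum_(w <- words n) (a w)%:E * mu (cell K w) <= E r)%E.
  apply: integral_pack => // [x Kx|x Kx]; first exact: mean_ge0.
  rewrite -/(mean x r).
  have [w0 sw0 w0x] := K_cell hK n Kx.
  have H w : size w = n -> cell K w x -> ((9 * a w)%:E <= mean x r)%E.
    move=> sw wx; have -> : 9 * a w = osc w * (kappa ^+ size w / (N * 12 `^ (p * alpha))).
      by rewrite /a sw; field; rewrite !gt_eqF.
    by apply: mean_ge; rewrite ?sw.
  move: H (mean_ge0 x r); case: (mean x r) => [y| |] H => [|_|//]; last by rewrite leey.
  rewrite !lee_fin => y0.
  apply: (@le_trans _ _ (\sum_(w <- words n | adj w0 w) y / 9)).
    rewrite [leRHS]big_mkcond; apply: ler_sum_words => w sw.
    rewrite indicE; have [wx|wx] := pselect (cell K w x).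
      rewrite mem_set // (cell_adj hK _ w0x wx) ?sw0 // mulr1.
      by have := H w sw wx; rewrite lee_fin ler_pdivlMr // mulrC.
    by rewrite memNset // mulr0; case: ifP => // _; rewrite divr_ge0.
  rewrite big_const_seq iter_addr_0 -[leLHS]mulr_natl.
  have := count_adj sw0; rewrite -(ler_nat R) => H9.
  apply: le_trans (ler_wpM2r _ H9) _; first by rewrite divr_ge0.
  by rewrite mulrC mulfVK.
have <- : ((9 * N * 12 `^ (p * alpha))%:E *
    (\sum_(w <- words n) (a w)%:E * mu (cell K w)) = ((kappa / 5) ^+ n * \sum_(w <- words n) osc w)%:E)%E.
  rewrite (eq_big_seq (fun w => (a w * 5^-1 ^+ n)%:E)); last first.
    by move=> w; rewrite mem_words => /eqP <-; rewrite (mu_cell hmu) -EFinM.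
  rewrite sumEFin -EFinM; congr (_%:E).
  rewrite /a -!mulr_suml exprMn exprVn.
  by field; rewrite !gt_eqF ?exprn_gt0.
by rewrite lee_wpmul2l // lee_fin ltW.
Qed.

Lemma mean_le n w x r c : 4 * 3^-1 ^+ n < r -> (dball K d x r `<=` Star w) -> K x ->
  (mean x r <= (5 ^+ n * kappa ^+ n * 2 `^ (p - 1) * moment (Star w) c)%:E +
    (5 ^+ n * kappa ^+ n * 2 `^ (p - 1) * (9 * 5^-1 ^+ size w))%:E
      * (`|f x - c| `^ p)%:E)%E.
Proof.
move=> r1 BS Kx; have [b bE b1] := mu_dball_fine r1 Kx.
have b0 : 0 < b by apply: lt_le_trans b1.
have n0 : 0 < 5 ^+ n :> R by rewrite exprn_gt0.
have L0 : 0 < kappa ^+ n by rewrite exprn_gt0.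
have r0 : 0 < r by apply: le_lt_trans r1; rewrite mulr_ge0 // exprn_ge0 // invr_ge0.
rewrite /mean bE inver gt_eqF //; set s := r `^ (p * alpha).
have s0 : 0 < s by rewrite powR_gt0.
have s1 : s^-1 <= kappa ^+ n.
  rewrite -[leRHS]invrK lef_pV2 ?posrE ?invr_gt0 //.
  rewrite -scale_powR; apply: ge0_ler_powR => //; rewrite ?nnegrE ?(ltW r0) //.
  by apply: le_trans (ltW r1); rewrite ler_peMl ?exprn_ge0 ?invr_ge0 // ler1n.
have b2 : b^-1 <= 5 ^+ n.
  by rewrite -[leRHS]invrK lef_pV2 ?posrE ?invr_gt0 // -exprVn.
apply: (@le_trans _ _ ((b^-1)%:E * (moment (Star w) (f x) * s^-1)%:E)%E).
  rewrite lee_wpmul2l ?lee_fin ?invr_ge0 ?(ltW b0) //.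
  rewrite -Star_integral ?invr_ge0 ?(ltW s0) //.
  apply: le_integral_nonneg => [y _|y _|y wy].
  - exact: integrand_ge0.
  - by rewrite lee_fin mulr_ge0 ?powR_ge0 // invr_ge0 ltW.
  - by split=> //; exact: BS.
rewrite -!EFinM -EFinD lee_fin.
have sh := moment_shift p1 mK muK mf fp (f x) c (mStar w) (@StarK w).
have m9 := mu_Star_fine hK hmu w.
apply: (@le_trans _ _ (5 ^+ n * ((2 `^ (p - 1) * (moment (Star w) c + `|f x - c| `^ p *
    (9 * 5^-1 ^+ size w))) * kappa ^+ n))); last first.
  by rewrite le_eqVlt; apply/orP; left; apply/eqP; ring.
apply: ler_pM => //; first by rewrite invr_ge0 ltW.
  by rewrite mulr_ge0 ?moment_ge0 // invr_ge0 ltW.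
apply: ler_pM => //; first exact: moment_ge0.
  by rewrite invr_ge0 ltW.
apply: le_trans sh _; rewrite ler_wpM2l ?powR_ge0 // lerD2l distrC.
by rewrite ler_wpM2l ?powR_ge0.
Qed.

Definition up_const : R := 10 * 2 `^ (p - 1) * (25 * lam p) ^+ 3.

Lemma up_const_gt0 : 0 < up_const.
Proof. by rewrite !mulr_gt0 ?powR_gt0 // exprn_gt0 // mulr_gt0. Qed.

(** At the critical exponent the factor [kappa] of the radius is the product of the
    factor of the energy and of the number of cells. Balls of radius at most
    [12 * 3^-1 ^+ n] lie in stars of level [n - 3]; for [n < 3] this level is 0, and
    the star is the whole set. The loss of three levels is paid in [up_const]. *)
Lemma Epa_le n r : kappa = lam p * 5 ->
  4 * 3^-1 ^+ n < r -> (n = 0%N \/ r <= 12 * 3^-1 ^+ n) ->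
  (E r <= (up_const * osc_energy (n - 3))%:E)%E.
Proof.
rewrite /up_const => kE; have P0 : 0 < 2 `^ (p - 1) :> R by rewrite powR_gt0.
move=> r1 r2; set k := (n - 3)%N.
have BS w x : size w = k -> cell K w x -> dball K d x r `<=` Star w.
  move=> sw wx; have [n3|n3] := ltnP n 3.
    have k0 : k = 0%N by apply/eqP; rewrite /k subn_eq0 ltnW.
    rewrite k0 in sw; have -> := size0nil sw.
    by apply: (@subset_trans _ K) => [y []//|]; exact: (@cell_Star _ K [::] [::]).
  apply: (dball_sub_Star hK hd _ wx); rewrite sw.
  case: r2 => [n0|r2]; first by move: n3; rewrite n0.
  apply: le_trans r2 _; rewrite -(subnK n3) -/k exprD [leLHS]mulrC -mulrA ler_piMr //.
  by rewrite !exprS expr0; lra.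
set D := 5 ^+ n * (lam p * 5) ^+ n * 2 `^ (p - 1) : R.
have lam50 : 0 <= lam p * 5 by rewrite mulr_ge0 // ltW.
have D0 : 0 <= D by rewrite /D !mulr_ge0 ?exprn_ge0 ?powR_ge0.
have Dk : D * 10 * 5^-1 ^+ k * 5^-1 ^+ k <= 10 * 2 `^ (p - 1) * (25 * lam p) ^+ 3 * lam p ^+ k.
  have nk : exists2 j, (j <= 3)%N & n = (k + j)%N.
    by exists (minn n 3); rewrite ?geq_minr // /k minnE subnKC ?leq_subr.
  have [j j3 nE] := nk; rewrite /D nE.
  have -> : 5 ^+ (k + j) * (lam p * 5) ^+ (k + j) * 2 `^ (p - 1) * 10 * 5^-1 ^+ k * 5^-1 ^+ k =
    10 * 2 `^ (p - 1) * lam p ^+ k * (25 * lam p) ^+ j.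
    have -> : 25 = 5 * 5 :> R by ring.
    by rewrite !exprMn !exprD !exprVn; field; rewrite !gt_eqF ?exprn_gt0.
  rewrite [leRHS]mulrAC; apply: ler_wpM2l.
    by rewrite !mulr_ge0 ?exprn_ge0 ?powR_ge0 // ltW.
  apply: ler_weXn2l => //; have := lam_ge1 p1; lra.
apply/lee_addgt0Pr => e e0.
have L0 : 0 < lam p ^+ k * 5 ^+ k by rewrite mulr_gt0 ?exprn_gt0.
set C := 10 * 2 `^ (p - 1) * (25 * lam p) ^+ 3 in Dk *.
have C0 : 0 < C by rewrite /C !mulr_gt0 // exprn_gt0 // mulr_gt0.
have e'0 : 0 < e / (C * (lam p ^+ k * 5 ^+ k)) by rewrite divr_gt0 // mulr_gt0.
set e' := e / _ in e'0.
have [c Hc] := osc_choice K mu p f (fun _ : nat => e'0).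
pose G w (x : borel_plane R) := ((D * moment (Star w) (c w))%:E + (D * (9 * 5^-1 ^+ k))%:E *
    (`|f x - c w| `^ p)%:E)%E.
have mG w := measurable_moment p mK mf (c w) (mcell w) (@cellK w).
have D90 : 0 <= D * (9 * 5^-1 ^+ k) 
  by apply: mulr_ge0 => //; apply: mulr_ge0 => //; exact: ltW.
have G1 w x : (0 <= (D * moment (Star w) (c w))%:E)%E by rewrite lee_fin mulr_ge0 ?moment_ge0.
have G2 w x : (0 <= (D * (9 * 5^-1 ^+ k))%:E * (`|f x - c w| `^ p)%:E)%E.
  by rewrite mule_ge0 ?lee_fin ?powR_ge0.
have mG2 w : measurable_fun (cell K w : set (borel_plane R))
    (fun x : borel_plane R => ((D * (9 * 5^-1 ^+ k))%:E * (`|f x - c w| `^ p)%:E)%E).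
  exact: measurable_funeM (mG w).
apply: (@le_trans _ _ (\sum_(w <- words k) \int[mu]_(x in cell K w) G w x)%E).
  have G0 w x : (0 <= G w x)%E 
    by apply: adde_ge0; [exact: (G1 w x)|exact: G2].
  apply: integral_cover => //.
  - by move=> w; apply: emeasurable_funD => //; exact: measurable_cst.
  - by move=> x _; exact: mean_ge0.
  - move=> x Kx; have [w sw wx] := K_cell hK k Kx.
    exists w; first by rewrite mem_words sw.
    by split=> //; rewrite /G -sw /D -kE; apply: mean_le => //; exact: BS.
have intG w : size w = k -> (\int[mu]_(x in cell K w) G w x <=
    (C * lam p ^+ k * (osc w + e'))%:E)%E.
  move=> sw; rewrite ge0_integralD //; last first.
    by move=> x _; exact: (G1 w x).
  rewrite integral_cst // (mu_cell hmu) -EFinM ge0_integralZl_EFin //.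
  rewrite (momentE p1 mK muK mf fp) // -EFinM -EFinD lee_fin sw.
  have m1 := moment_cell_Star hK hmu p1 hf w (c w).
  have m2 := Hc w; rewrite sw in m2.
  set M := moment (Star w) (c w) in m1 m2 *; set M' := moment (cell K w) _ in m1 *.
  have M0 : 0 <= M by exact: moment_ge0.
  have s0 : 0 < 5^-1 ^+ k :> R by [].
  apply: (@le_trans _ _ (D * 10 * 5^-1 ^+ k * M)).
    have -> : D * 10 * 5^-1 ^+ k * M = D * M * 5^-1 ^+ k + D * (9 * 5^-1 ^+ k) * M by ring.
    by rewrite lerD2l ler_wpM2l.
  have -> : D * 10 * 5^-1 ^+ k * M = (D * 10 * 5^-1 ^+ k * 5^-1 ^+ k) * (5 ^+ k * M).
    by rewrite !exprVn; field; rewrite !gt_eqF ?exprn_gt0.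
  apply: ler_pM => //.
  - by apply: mulr_ge0 (ltW s0); apply: mulr_ge0 (ltW s0); apply: mulr_ge0.
  - by rewrite mulr_ge0 // exprn_ge0.
apply: (@le_trans _ _ (\sum_(w <- words k) (C * lam p ^+ k * (osc w + e'))%:E)%E).
  rewrite big_seq [leRHS]big_seq; apply: lee_sum => w.
  by rewrite mem_words => /eqP; exact: intG.
rewrite sumEFin -EFinD lee_fin -mulr_sumr big_split /= sum_words_const mulrDr.
rewrite /osc_energy [C * (_ * _)]mulrA lerD2l.
rewrite le_eqVlt; apply/orP; left; apply/eqP; rewrite /e'.
by field; rewrite !gt_eqF ?exprn_gt0.
Qed.

End KorevaarSchoen.

(** * Functions prescribed by their values on cells *)

Section Geometric.
Variable R : realType.
Implicit Types (a : nat -> R) (M A e t : R).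

Lemma powR_exprn (x s : R) n : 0 <= x -> (x ^+ n) `^ s = (x `^ s) ^+ n.
Proof. by move=> x0; rewrite -(powR_mulrn n x0) -(powR_mulrn n (powR_ge0 _ _)) powRAC. Qed.

Lemma le_add_geometric x y M t : 0 <= t < 1 -> (forall m, x <= y + M * t ^+ m) -> x <= y.
Proof.
move=> t01 H; apply/ler_addgt0Pr => e e0.
have [n Hn] := geometric_small M t01 e0.
by apply: le_trans (H n) _; rewrite lerD2l ltW // Hn.
Qed.

(** [a n - B * t ^+ n] increases and [a n + B * t ^+ n] decreases, for
    [B = A / (1 - t)], and the limit lies between the two. *)
Lemma geometric_limit a A t : 0 <= t < 1 ->
  (forall n, `|a n.+1 - a n| <= A * t ^+ n) ->
  exists l, forall n, `|l - a n| <= A / (1 - t) * t ^+ n.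
Proof.
move=> /andP [t0 t1] H; set B := A / (1 - t).
have Bt n : B * t ^+ n - B * t ^+ n.+1 = A * t ^+ n.
  by rewrite /B exprS; field; rewrite subr_eq0 gt_eqF.
have A0 n : 0 <= A * t ^+ n by apply: le_trans (H n).
have lowS n m : (n <= m)%N -> a n - B * t ^+ n <= a m - B * t ^+ m.
  move=> /subnK <-; elim: (m - n)%N => [//|k IH]; apply: le_trans IH _.
  rewrite addSn; have := H (k + n)%N; rewrite ler_norml => /andP [+ _].
  have := Bt (k + n)%N; lra.
have upS n m : (n <= m)%N -> a m + B * t ^+ m <= a n + B * t ^+ n.
  move=> /subnK <-; elim: (m - n)%N => [//|k IH]; apply: le_trans IH.
  rewrite addSn; have := H (k + n)%N; rewrite ler_norml => /andP [_].
  have := Bt (k + n)%N; lra.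
have B0 n : 0 <= B * t ^+ n.
  have B0 : 0 <= B.
    by rewrite divr_ge0 ?subr_ge0 ?(ltW t1) //; have := A0 0%N; rewrite expr0 mulr1.
  by rewrite mulr_ge0 // exprn_ge0.
have cross n m : a n - B * t ^+ n <= a m + B * t ^+ m.
  have := lowS n (maxn n m) (leq_maxl _ _); have := upS m (maxn n m) (leq_maxr _ _).
  have := B0 (maxn n m); lra.
pose S := [set a n - B * t ^+ n | n in [set: nat]].
have hS : has_sup S.
  split; first by exists (a 0%N - B * t ^+ 0), 0%N.
  by exists (a 0%N + B * t ^+ 0) => _ [n _ <-].
exists (sup S) => n; rewrite ler_distl; apply/andP; split.
  by apply: ub_le_sup; [case: hS|exists n].
by apply: ge_sup; [case: hS|move=> _ [m _ <-]].
Qed.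

End Geometric.

Section Glue.
Variables (R : realType) (K : set (R * R)).
Hypothesis hK : is_vicsek_set K.
Implicit Types (x y : R * R) (u v w : seq 'I_5).
Variables (c : seq 'I_5 -> R) (A t : R).
Hypotheses (t01 : 0 <= t < 1)
  (cadj : forall u v, adj u v -> `|c u - c v| <= A * t ^+ size u)
  (cchild : forall u i, `|c (rcons u i) - c u| <= A * t ^+ size u).

(** Points close to each other lie in adjacent cells, by [cell_separation], so that
    values that vary little between adjacent cells, and between a cell and its
    subcells, have a continuous limit. *)
Lemma continuous_glue : exists g : R * R -> R, {within K, continuous g} /\
  exists B, forall u x, cell K u x -> `|g x - c u| <= B * t ^+ size u.
Proof.
have [t0 t1] := andP t01.
set B := (A + A) / (1 - t) + A.
have lim x : exists l, forall u, cell K u x -> `|l - c u| <= B * t ^+ size u.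
  have [Kx|nKx] := pselect (K x); last first.
    by exists 0 => u /(cell_sub hK).
  have ex n : exists w, size w = n /\ cell K w x.
    by have [w sw wx] := K_cell hK n Kx; exists w.
  have [a Ha] := choice ex.
  have step n : `|c (a n.+1) - c (a n)| <= (A + A) * t ^+ n.
    have [s1 x1] := Ha n.+1; have [s0 x0] := Ha n.
    case/lastP E : (a n.+1) => [|v i] in s1 x1 *; first by [].
    rewrite size_rcons in s1; case: s1 => sv.
    have vx : cell K v x by move: x1; rewrite -cats1; exact: cell_cat_sub.
    have va : adj v (a n) by apply: (cell_adj hK _ vx x0); rewrite sv.
    have := cadj va; have := cchild v i; rewrite sv => H1 H2.
    rewrite mulrDl -(subrK (c v) (c (rcons v i))) -addrA.
    by apply: le_trans (ler_normD _ _) _; exact: lerD.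
  have [l Hl] := geometric_limit t01 step; exists l => u ux.
  have [sa xa] := Ha (size u).
  have au : adj (a (size u)) u by apply: (cell_adj hK _ xa ux).
  have := cadj au; have := Hl (size u); rewrite sa => H1 H2.
  rewrite /B mulrDl -(subrK (c (a (size u))) l) -addrA.
  by apply: le_trans (ler_normD _ _) _; exact: lerD.
clearbody B; have [g Hg] := choice lim; exists g; split; last by exists B => u x; exact: Hg.
apply/subspace_continuousP => x Kx; apply/cvgrPdist_lt => e e0.
have [n Hn] := geometric_small (B + A + B) t01 e0.
have [u su ux] := K_cell hK n Kx.
rewrite near_withinE; apply/nbhs_ballP.
have d0 : 0 < 2^-1 * 3^-1 ^+ n :> R by rewrite mulr_gt0 ?exprn_gt0 ?invr_gt0.
exists (2^-1 * 3^-1 ^+ n) => // y; rewrite -ball_normE /= => xy Ky.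
have [v sv vy] := K_cell hK n Ky.
have uv : adj u v.
  apply: contraT => nadj; have suv : size u = size v by rewrite su.
  have [j Hj] := cell_separation hK suv nadj ux vy.
  by have := lin_sup j x y; rewrite su in Hj; lra.
apply: le_lt_trans (Hn n (leqnn _)).
have := Hg x u ux; have := Hg y v vy; have := cadj uv.
rewrite sv su !ler_norml => /andP [a1 a2] /andP [b1 b2] /andP [d1 d2].
by rewrite /from_subspace !mulrDl; apply/andP; split; lra.
Qed.

End Glue.

Section OscillationBound.
Variables (R : realType) (K : set (R * R)).
Variable mu : {measure set (borel_plane R) -> \bar R}.
Hypotheses (hK : is_vicsek_set K) (hmu : is_vicsek_measure K mu).
Variables (p : R) (f : borel_plane R -> R).
Hypotheses (p1 : 1 <= p) (hf : Lp K mu p f).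
Implicit Types (u v w : seq 'I_5).

Lemma moment_cell_bound u (c e : R) : 0 <= e ->
  {ae mu, forall x, cell K u x -> `|f x - c| <= e} ->
  moment mu p f (cell K u) c <= e `^ p * 5^-1 ^+ size u.
Proof.
move=> e0 H; have mK := K_measurable hK.
have muK : (mu K < +oo)%E by rewrite (mu_cell hmu [::]) ltry.
have mu' := cell_measurable hK u; have uK := @cell_sub _ _ hK u.
rewrite -lee_fin EFinM -(momentE p1 mK muK hf.1 hf.2) // -(mu_cell hmu) -integral_cst //.
apply: ae_ge0_le_integral => //.
- exact: (measurable_moment p mK hf.1 c mu' uK).
- by move=> x _; rewrite lee_fin powR_ge0.
- by move: H; apply: ae_imply => x Hx ux; rewrite lee_fin ler_powR_base // Hx.
Qed.

(** The error made in replacing [f] by its values on the cells of level [n + m]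
    disappears as [m] tends to infinity, [n] being fixed. *)
Lemma osc_energy_bound (c H : seq 'I_5 -> R) (B t S : R) n :
  0 <= t < 1 ->
  (forall u v, adj u v -> `|c u - c v| `^ p <= H u + H v) ->
  (forall u, 0 <= H u) ->
  (forall N, lam p ^+ N * \sum_(u <- words N) H u <= S) ->
  (forall u, {ae mu, forall x, cell K u x -> `|f x - c u| <= B * t ^+ size u}) ->
  osc_energy K mu p f n <= 81 * 2 `^ p * 2 `^ p * S.
Proof.
move=> t01 cH H0 HS fc; have [t0 t1] := andP t01.
have l0 := lam_gt0 p1; have L0 : 0 < lam p ^+ n by rewrite exprn_gt0.
have A0 : 0 <= 2 `^ p :> R by rewrite powR_ge0.
have p0 : 0 < p by rewrite (lt_le_trans _ p1).
set B' := `|B|; have B'0 : 0 <= B' by exact: normr_ge0.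
have tp0 : 0 <= t `^ p by rewrite powR_ge0.
have tp1 : 0 <= t `^ p < 1.
  rewrite tp0 /=; have -> : 1 = 1 `^ p :> R by rewrite powR1.
  by apply: gt0_ltr_powR; rewrite ?nnegrE.
apply: (le_add_geometric (M := lam p ^+ n * 2 `^ p * 9 * 5 ^+ n * B' `^ p * (t `^ p) ^+ n) tp1) => m.
have cH' v v' : size v = (n + m)%N -> size v' = (n + m)%N -> adj v v' ->
     `|c v - c v'| `^ p <= H v + H v' by move=> _ _; exact: cH.
have := osc_poincare hK hmu p1 hf cH' H0.
set T := \sum_(v <- _) 5 ^+ _ * _; set SH := \sum_(v <- _) H v => HQ.
have T1 : T <= 5 ^+ (n + m) * (B' `^ p * (t `^ p) ^+ (n + m)).
  rewrite /T -sum_words_const; apply: ler_sum_words => v sv.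
  have -> : B' `^ p * (t `^ p) ^+ (n + m) = (B' * t ^+ (n + m)) `^ p.
    by rewrite powRM ?exprn_ge0 // powR_exprn.
  have b0 : 0 <= B' * t ^+ (n + m) by rewrite mulr_ge0 ?exprn_ge0.
  have := @moment_cell_bound v (c v) _ b0.
  rewrite sv => /(_ _)/wrap [|Hm].
    move: (fc v); apply: ae_imply => x Hx vx; apply: le_trans (Hx vx) _.
    by rewrite sv ler_wpM2r ?exprn_ge0 // ler_norm.
  apply: le_trans (ler_wpM2l _ Hm) _; first by rewrite exprn_ge0.
  by rewrite le_eqVlt; apply/orP; left; apply/eqP; rewrite exprVn; field; rewrite gt_eqF // exprn_gt0.
have S1 : lam p ^+ n * (lam p ^+ m * SH) <= S.
  by rewrite mulrA -exprD; exact: HS.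
rewrite /osc_energy; apply: le_trans (ler_wpM2l (ltW L0) HQ) _.
have m5 : 0 < 5 ^+ m :> R by rewrite exprn_gt0.
have T2 : 5^-1 ^+ m * T <= 5 ^+ n * (B' `^ p * (t `^ p) ^+ (n + m)).
  rewrite exprVn mulrC ler_pdivrMr //; apply: le_trans T1 _.
  by rewrite exprD le_eqVlt; apply/orP; left; apply/eqP; ring.
rewrite [leRHS]addrC [2 `^ p * (_ + _)]mulrDr [leLHS]mulrDr; apply: lerD; last first.
  have -> : 81 * 2 `^ p * 2 `^ p * S = 2 `^ p * (81 * 2 `^ p) * S by ring.
  have -> : lam p ^+ n * (2 `^ p * (81 * 2 `^ p * (lam p ^+ m * SH))) =
    2 `^ p * (81 * 2 `^ p) * (lam p ^+ n * (lam p ^+ m * SH)) by ring.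
  by rewrite ler_wpM2l // !mulr_ge0.
have -> : lam p ^+ n * 2 `^ p * 9 * 5 ^+ n * B' `^ p * (t `^ p) ^+ n * (t `^ p) ^+ m =
    lam p ^+ n * (2 `^ p * (9 * (5 ^+ n * (B' `^ p * (t `^ p) ^+ (n + m))))).
  by rewrite exprD; ring.
by rewrite !ler_wpM2l // ?(ltW L0).
Qed.

End OscillationBound.

(** * A nonconstant function of finite energy *)

Section Projection.
Variable R : realType.
Implicit Types (i j : 'I_5) (u v w : seq 'I_5).

Definition tip : 'I_5 := inord 1.

Definition on_axis i : bool := i \in [:: ctr; tip; opposite tip].

(** The limit of [proj] along the cells of a point is the nearest-point projection
    of the tree onto the segment from [q (opposite tip)] to [q tip], in the
    coordinate [lin tip]: a cell that leaves the axis is projected to the point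
    where it is attached. *)
Fixpoint proj w : R :=
  if w is i :: u then
    if on_axis i then (2 * lin tip (q R i) + proj u) / 3 else 0
  else 0.

Lemma tip_neq_ctr : tip != ctr.
Proof. by rewrite -val_eqE /= inordK. Qed.

Lemma on_axis_opposite i : on_axis (opposite i) = on_axis i.
Proof.
have H j : on_axis j -> on_axis (opposite j).
  by rewrite /on_axis !inE => /or3P [] /eqP ->; rewrite ?oppositeK !eqxx ?orbT.
by apply/idP/idP => /H //; rewrite oppositeK.
Qed.

Lemma tip_coord_le1 i : `|lin tip (q R i)| <= 1.
Proof. by rewrite ler_norml lin_q_le1 lerNl -lin_opposite lin_q_le1. Qed.

Lemma tip_coord_opposite i : lin tip (q R (opposite i)) = - lin tip (q R i).
Proof. by rewrite linC lin_opposite linC. Qed.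

Lemma proj_child u i : `|proj (rcons u i) - proj u| <= 3^-1 ^+ size u.
Proof.
elim: u => [|j u IH] /=.
  rewrite subr0 expr0 addr0; case: ifP => _; last by rewrite normr0.
  have := tip_coord_le1 i; rewrite !ler_norml => /andP [a1 a2].
  by apply/andP; split; lra.
case: ifP => _; last by rewrite subrr normr0 exprn_ge0 // invr_ge0.
move: IH; rewrite exprS !ler_norml => /andP [a1 a2].
by apply/andP; split; lra.
Qed.

Lemma proj_nseq k i : proj (nseq k i) =
  if on_axis i then lin tip (q R i) * (1 - 3^-1 ^+ k) else 0.
Proof.
elim: k => [|k IH] /=; first by rewrite expr0 subrr mulr0 if_same.
by rewrite IH; case: (on_axis i) => //; rewrite exprS; field.
Qed.

Lemma all_on_axis_nseq k i : on_axis i -> all on_axis (nseq k i).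
Proof. by move=> H; rewrite all_nseq H orbT. Qed.

Lemma proj_adj u v : adj u v ->
  `|proj u - proj v| <=
    2 * 3^-1 ^+ size u * ((all on_axis u)%:R + (all on_axis v)%:R).
Proof.
have junction k j : j != ctr ->
    `|proj (ctr :: nseq k j) - proj (j :: nseq k (opposite j))| <= 2 * 3^-1 ^+ k.+1 *
      ((all on_axis (ctr :: nseq k j))%:R + (all on_axis (j :: nseq k (opposite j)))%:R).
  move=> jc /=; rewrite !proj_nseq on_axis_opposite q_ctr tip_coord_opposite.
  have -> : lin tip (0 : R * R) = 0 by rewrite /lin /= !mulr0 addr0.
  have e0 : 0 <= 3^-1 ^+ k :> R by rewrite exprn_ge0 // invr_ge0.
  case: ifP => jx; last first.
    rewrite mulr0 addr0 mul0r subrr normr0; apply: mulr_ge0.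
      by apply: mulr_ge0 => //; rewrite exprn_ge0 // invr_ge0.
    by rewrite addr_ge0 ?ler0n.
  rewrite !all_on_axis_nseq ?on_axis_opposite // exprS.
  have := tip_coord_le1 j; set a := lin _ _ => a1.
  have -> : (2 * 0 + a * (1 - 3^-1 ^+ k)) / 3 - (2 * a + - a * (1 - 3^-1 ^+ k)) / 3 =
    - (2 * 3^-1 * 3^-1 ^+ k) * a by field.
  have c0 : 0 <= 2 * 3^-1 * 3^-1 ^+ k :> R by rewrite mulr_ge0.
  rewrite normrM normrN (ger0_norm c0).
  by rewrite /=; have := ler_wpM2l e0 a1; lra.
elim: u v => [|i u IH] [|j v] //; first by rewrite subrr normr0 !mulr_ge0 // expr0.
have e0 : 0 <= 3^-1 ^+ size u :> R by rewrite exprn_ge0 // invr_ge0.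
rewrite [adj _ _]/=; case: ifP => [/eqP <- uv|ij].
  have := IH v uv; rewrite /=; case: ifP => ix /=; rewrite exprS.
    set X := _%:R + _%:R => H.
    have -> : (2 * lin tip (q R i) + proj u) / 3 - (2 * lin tip (q R i) + proj v) / 3 =
      3^-1 * (proj u - proj v) by field.
    by rewrite normrM ger0_norm ?invr_ge0 //; lra.
  by rewrite addr0 mulr0 subrr normr0.
have sE (s : seq 'I_5) k : size (k :: s) = (size s).+1 by [].
case/orP => /and3P [/eqP ic /eqP uE /eqP vE].
  have jc : j != ctr by rewrite -ic eq_sym ij.
  have suv : size u = size v by rewrite uE size_nseq.
  have := junction (size v) j jc; rewrite -uE -[X in nseq X (opposite j)]suv -vE.
  by rewrite ic sE suv.
have jc : i != ctr by rewrite -ic ij.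
have suv : size u = size v by rewrite uE size_nseq.
have := junction (size u) i jc; rewrite -uE [X in nseq X (opposite i)]suv -vE.
by rewrite ic sE distrC [X in _ * X]addrC.
Qed.

Lemma sum_on_axis n : \sum_(w <- words n) (all on_axis w)%:R <= 3 ^+ n :> R.
Proof.
elim: n => [|n IH]; first by rewrite sum_words0.
rewrite sum_wordsS exprS.
apply: (@le_trans _ _ (\sum_(i : 'I_5) (on_axis i)%:R * 3 ^+ n)).
  apply: ler_sum => i _ /=; case: (on_axis i) => /=; first by rewrite mul1r.
  by rewrite mul0r big1.
rewrite -mulr_suml ler_wpM2r ?exprn_ge0 // -natr_sum ler_nat.
rewrite (eq_bigr (fun i => if on_axis i then 1%N else 0%N)); last by move=> i _; case: on_axis.
rewrite -big_mkcond sum1_card; exact: (card_size [:: ctr; tip; opposite tip]).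
Qed.

End Projection.

Section NonconstantFunction.
Variables (R : realType) (K : set (R * R)).
Variable mu : {measure set (borel_plane R) -> \bar R}.
Hypotheses (hK : is_vicsek_set K) (hmu : is_vicsek_measure K mu).
Variable p : R.
Hypothesis p1 : 1 <= p.

Lemma bounded_Lp (g : R * R -> R) (M : R) : {within K, continuous g} ->
  (forall x, K x -> `|g x| <= M) -> Lp K mu p g.
Proof.
move=> gc gM; have mg := within_continuous_measurable (K_closed hK) gc; split=> //.
have mK := K_measurable hK.
have muK : (mu K < +oo)%E by rewrite (mu_cell hmu [::]) ltry.
apply: (@le_lt_trans _ _ (\int[mu]_(x in K) cst (M `^ p)%:E x)%E).
  apply: le_integral_nonneg => [x _|x _|x Kx]; rewrite ?lee_fin ?powR_ge0 //.
  by split=> //; rewrite ler_powR_base // gM.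
by rewrite integral_cst // lte_mul_pinfty ?lee_fin ?powR_ge0.
Qed.

Lemma ae_cell (P : R * R -> Prop) u : {ae mu, forall x, K x -> P x} ->
  exists x, cell K u x /\ P x.
Proof.
move=> [N [mN muN NP]]; apply/not_existsP => H.
have uN : cell K u `<=` N.
  move=> x ux; apply: NP => /= HP; apply: (H x); split=> //; apply: HP.
  exact: cell_sub ux.
have : (mu (cell K u) <= mu N)%E.
  by apply: le_measure; rewrite ?inE //; exact: cell_measurable.
by rewrite muN (mu_cell hmu) lee_fin leNgt exprn_gt0 // invr_gt0.
Qed.

(** The projection varies by at most the order of [3^-1 ^+ n] between adjacent cells
    of level [n], and only when one of them is among the [3 ^+ n] cells on the axis:
    its energy is of order [lam p ^+ n * 3 ^+ n * (3^-1 ^+ n) `^ p = 1]. *)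
Lemma exists_nonconstant : exists g : R * R -> R, [/\ Lp K mu p g,
  exists S, forall n, osc_energy K mu p g n <= S & ~ is_constant K mu g].
Proof.
have t01 : 0 <= (3^-1 : R) < 1 by apply/andP; split; lra.
have pos n : 0 <= 3^-1 ^+ n :> R by rewrite exprn_ge0 // invr_ge0.
have b01 (b : bool) : 0 <= (b%:R : R) <= 1 by case: b; rewrite ?lexx ?ler01.
have [||g [gc [B gB]]] := @continuous_glue R K hK (@proj R) 4 3^-1 t01.
- move=> u v /(proj_adj R) /le_trans; apply.
  have := b01 (all on_axis u); have := b01 (all on_axis v).
  by move=> /andP [_ h1] /andP [_ h2]; have := pos (size u); nra.
- by move=> u i; apply: le_trans (proj_child R u i) _; have := pos (size u); lra.
have gLp : Lp K mu p g.
  apply: (@bounded_Lp _ B) => // x Kx.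
  by have := gB [::] x Kx; rewrite subr0 expr0 mulr1.
exists g; split=> //.
  pose H u : R := 4 `^ p * ((3^-1) `^ p) ^+ size u * (all on_axis u)%:R.
  have H0 u : 0 <= H u by rewrite /H !mulr_ge0 ?exprn_ge0 ?powR_ge0.
  exists (81 * 2 `^ p * 2 `^ p * 4 `^ p) => n.
  apply: (osc_energy_bound hK hmu p1 gLp n (c := @proj R) (H := H) t01).
  - move=> u v uv; have suv := adj_size uv.
    rewrite /H -suv -mulrDr -powR_exprn ?invr_ge0 // -powRM //.
    have := proj_adj R uv; case: (all on_axis u); case: (all on_axis v) => /= h.
    + apply: (@le_trans _ _ ((4 * 3^-1 ^+ size u) `^ p)).
        by apply: ler_powR_base => //; lra.
      by rewrite ler_peMr ?powR_ge0 // lerDl.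
    + rewrite addr0 mulr1; apply: ler_powR_base => //; have := pos (size u); lra.
    + rewrite add0r mulr1; apply: ler_powR_base => //; have := pos (size u); lra.
    + move: h; rewrite addr0 mulr0 normr_le0 => /eqP ->; rewrite normr0 mulr0 powR0 //.
      by rewrite gt_eqF // (lt_le_trans _ p1).
  - exact: H0.
  - move=> N; rewrite (eq_sum_words (H := fun u => 4 `^ p * ((3^-1) `^ p) ^+ N *
      (all on_axis u)%:R)); last by move=> u su; rewrite /H su.
    rewrite -mulr_sumr.
    have lam3 : lam p * ((3^-1) `^ p * 3) = 1.
      rewrite -[3^-1]powR_inv1 // -powRrM mulN1r powRN /lam.
      rewrite -(@mulr_powRB1 _ 3 p) // ?(lt_le_trans _ p1) //.
      by field; rewrite gt_eqF // powR_gt0.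
    apply: (@le_trans _ _ (lam p ^+ N * (4 `^ p * (3^-1) `^ p ^+ N * 3 ^+ N))).
      rewrite ler_wpM2l ?exprn_ge0 ?(ltW (lam_gt0 p1)) // ler_wpM2l //.
      exact: sum_on_axis.
    have -> : lam p ^+ N * (4 `^ p * (3^-1) `^ p ^+ N * 3 ^+ N) =
      4 `^ p * (lam p * ((3^-1) `^ p * 3)) ^+ N by rewrite !exprMn; ring.
    by rewrite lam3 expr1n mulr1.
  - by move=> u; apply: aeW => x; exact: gB.
move=> [c Hc].
have [n Hn] := geometric_small (B + 1) t01 (ltr01 : 0 < 1 :> R).
have := Hn n (leqnn _) => {}Hn.
have at_tip := @proj_nseq R n tip; have at_op := @proj_nseq R n (opposite tip).
move: at_op; rewrite on_axis_opposite tip_coord_opposite.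
have tx : on_axis tip by rewrite /on_axis !inE eqxx orbT.
rewrite tx lin_qq ?tip_neq_ctr // in at_tip * => at_op.
have [x [ux gx]] := ae_cell (nseq n tip) Hc.
have [y [vy gy]] := ae_cell (nseq n (opposite tip)) Hc.
have := gB _ _ ux; have := gB _ _ vy.
rewrite !size_nseq at_tip at_op gx gy !ler_norml => /andP [a1 a2] /andP [b1 b2].
by lra.
Qed.

End NonconstantFunction.

(** * The continuous version and its energy along the edges *)

(** The discrete energy, listed cell by cell: the edges of level [m] join the centre
    of a cell to its four corners. *)
Definition cell_energy (R : realType) (p : R) (g : R * R -> R) (m : nat) : R :=
  lam p ^+ m * \sum_(w <- words m) \sum_(i : 'I_5 | i != ctr)
    `|g (Pw w 0) - g (Pw w (q R i))| `^ p.

Section EdgeEnergy.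
Variables (R : realType) (K : set (R * R)).
Variable mu : {measure set (borel_plane R) -> \bar R}.
Hypotheses (hK : is_vicsek_set K) (hmu : is_vicsek_measure K mu).
Variables (p : R) (f : borel_plane R -> R).
Hypotheses (p1 : 1 <= p) (hf : Lp K mu p f).
Implicit Types (u v w : seq 'I_5).
Local Notation osc_energy := (osc_energy K mu p f).

(** Adjacent cells share a corner, so that the values of [g] at their centres are
    compared through two edges. *)
Lemma osc_energy_le_cell_energy (g : R * R -> R) (B t S : R) n :
  0 <= t < 1 ->
  {ae mu, forall x, K x -> f x = g x} ->
  (forall u x y, cell K u x -> cell K u y -> `|g x - g y| <= B * t ^+ size u) ->
  (forall N, cell_energy p g N <= S) ->
  osc_energy n <= 81 * 2 `^ p * 2 `^ p * (2 `^ p * S).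
Proof.
move=> t01 fg gB HS.
pose G u := \sum_(i : 'I_5 | i != ctr) `|g (Pw u 0) - g (Pw u (q R i))| `^ p.
have G0 u : 0 <= G u by apply: sumr_ge0 => i _; exact: powR_ge0.
have A0 : 0 <= 2 `^ p :> R by rewrite powR_ge0.
apply: (osc_energy_bound hK hmu p1 hf n (c := fun u => g (Pw u 0))
  (H := fun u => 2 `^ p * G u) (B := B) t01).
- have one u i : `|g (Pw u 0) - g (Pw u (q R i))| `^ p <= G u.
    have [->|ic] := eqVneq i ctr; last by rewrite /G (bigD1 i) //= lerDl sumr_ge0 // => j _; exact: powR_ge0.
    by rewrite q_ctr subrr normr0 powR0 // gt_eqF // (lt_le_trans _ p1).
  move=> u v uv; have [i [j ij]] := adj_common_corner R uv.
  apply: le_trans (powR_dist p1 _ (g (Pw u (q R i))) _) _.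
  rewrite -mulrDr; apply: ler_pM; rewrite ?powR_ge0 ?addr_ge0 ?powR_ge0 //.
    by rewrite ler_powR ?ler1n // gerBl.
  by rewrite lerD // {1}ij distrC one.
- by move=> u; rewrite mulr_ge0.
- move=> N; rewrite -mulr_sumr mulrCA ler_wpM2l //; exact: HS.
- move=> u; move: fg; apply: ae_imply => x Hx ux.
  rewrite Hx; last exact: cell_sub ux.
  by apply: gB => //; apply: cell_Pw; exact: K_0.
Qed.

End EdgeEnergy.

Section ContinuousVersion.
Variables (R : realType) (K : set (R * R)).
Variable mu : {measure set (borel_plane R) -> \bar R}.
Hypotheses (hK : is_vicsek_set K) (hmu : is_vicsek_measure K mu).
Variables (p : R) (f : borel_plane R -> R).
Hypotheses (p1 : 1 < p) (hf : Lp K mu p f).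
Variable M : R.
Hypothesis oscM : forall n, osc_energy K mu p f n <= M.
Implicit Types (u v w : seq 'I_5).
Local Notation moment := (moment mu p f).
Local Notation osc := (osc K mu p f).

Let p1' : 1 <= p := ltW p1.
Let p0 : 0 < p. Proof. exact: lt_trans p1. Qed.
Let mK : measurable (K : set (borel_plane R)) := K_measurable hK.
Let mcell v := cell_measurable hK v.
Let cellK v := @cell_sub _ _ hK v.
Let l0 := lam_gt0 p1'.
Let l1 := lam_ge1 p1'.

Let muK : (mu K < +oo)%E.
Proof. by rewrite (mu_cell hmu [::]) ltry. Qed.

Let M0 : 0 <= M.
Proof. exact: le_trans (osc_energy_ge0 K mu f p1' 0) (oscM 0). Qed.

(* With p > 1 the energy bound makes oscillations decay like s per level, and the
   differences of the best constants like t. *)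
Let s : R := (lam p)^-1.
Let t : R := s `^ p^-1.

Let s0 : 0 < s. Proof. by rewrite invr_gt0. Qed.

Let s1 : s < 1.
Proof.
rewrite invf_lt1 //; have -> : 1 = 1 `^ (p - 1) :> R by rewrite powR1.
by apply: gt0_ltr_powR; rewrite ?nnegrE ?subr_gt0 // ltr1n.
Qed.

Let s01 : 0 <= s < 1. Proof. by rewrite (ltW s0) s1. Qed.

Let t01 : 0 <= t < 1.
Proof.
rewrite powR_ge0 /=; have -> : 1 = 1 `^ p^-1 :> R by rewrite powR1.
by apply: gt0_ltr_powR; rewrite ?invr_gt0 ?nnegrE // ltW.
Qed.

Let tp n (A : R) : 0 <= A -> (A * t ^+ n) `^ p = A `^ p * s ^+ n.
Proof.
have t0 : 0 <= t by rewrite powR_ge0.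
move=> A0; rewrite powRM ?exprn_ge0 // powR_exprn //.
by rewrite /t -powRrM mulVf ?gt_eqF // powRr1 // ltW.
Qed.

Let powR_le_inv (x y : R) : 0 <= x -> 0 <= y -> x `^ p <= y `^ p -> x <= y.
Proof.
move=> x0 y0; apply: contraTT; rewrite -!ltNge => yx.
by apply: gt0_ltr_powR; rewrite ?nnegrE.
Qed.

(* The tolerance for the choice of the constants; its sum over the 5 ^ n words of
   level n is at most s ^+ n * s ^+ n. *)
Let e (n : nat) : R := s ^+ n * (s / 5) ^+ n.

Let e0 n : 0 < e n.
Proof. by rewrite mulr_gt0 ?exprn_gt0 // divr_gt0. Qed.

Let e_le n : 5 ^+ n * e n <= s ^+ n * s ^+ n.
Proof.
rewrite /e mulrCA -exprMn; have -> : 5 * (s / 5) = s by field.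
by [].
Qed.

Let sn1 n : s ^+ n <= 1. Proof. by rewrite exprn_ile1 // ltW. Qed.
Let sn0 n : 0 <= s ^+ n. Proof. by rewrite exprn_ge0 // ltW. Qed.

Let e_le_s n : e n <= s ^+ n.
Proof.
rewrite ler_piMr // exprn_ile1 ?divr_ge0 ?(ltW s0) //.
by rewrite ler_pdivrMr // mul1r (le_trans (ltW s1)) // ler1n.
Qed.

Let sumosc n : \sum_(w <- words n) osc w <= M * s ^+ n.
Proof. by rewrite exprVn ler_pdivlMr ?exprn_gt0 // mulrC; exact: oscM. Qed.

Let osc1 u : osc u <= M * s ^+ size u.
Proof.
apply: le_trans (sumosc _); have := @ler_sum_uniq R _ [:: u] (words (size u)) osc.
rewrite big_seq1; apply => //; first exact: osc_ge0.
by move=> v; rewrite inE => /eqP ->; rewrite mem_words.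
Qed.

Let P2 : 0 < 2 `^ p :> R. Proof. by rewrite powR_gt0. Qed.
Let P1 : 0 < 2 `^ (p - 1) :> R. Proof. by rewrite powR_gt0. Qed.
Let P12 : 2 `^ (p - 1) <= 2 `^ p :> R.
Proof. by rewrite ler_powR ?ler1n // gerBl. Qed.

Section Values.
Variable c : seq 'I_5 -> R.
Hypothesis Hc : forall w, 5 ^+ size w * moment (Star K w) (c w) <= osc w + e (size w).

Let A : R := (6 * 2 `^ p * (M + 1)) `^ p^-1.

Let A0 : 0 <= A. Proof. exact: powR_ge0. Qed.

Let Ap : A `^ p = 6 * 2 `^ p * (M + 1).
Proof.
by rewrite /A -powRrM mulVf ?gt_eqF // powRr1 // !mulr_ge0 ?addr_ge0 ?(ltW P2).
Qed.

Let At_le n (x : R) : 0 <= x -> x `^ p <= 6 * 2 `^ p * (M + 1) * s ^+ n -> x <= A * t ^+ n.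
Proof.
have [t0 _] := andP t01.
by move=> x0 H; apply: powR_le_inv; rewrite ?mulr_ge0 ?exprn_ge0 // tp // Ap.
Qed.

Let oe u : osc u + e (size u) <= (M + 1) * s ^+ size u.
Proof. by rewrite mulrDl mul1r lerD. Qed.

Let oe0 u n : 0 <= osc u + e n.
Proof. by rewrite addr_ge0 ?osc_ge0 // ltW. Qed.

Let cadj u v : adj u v -> `|c u - c v| <= A * t ^+ size u.
Proof.
move=> uv; apply: At_le => //.
apply: le_trans (osc_adj hK hmu p1' hf Hc uv) _.
have := oe u; have := oe v; rewrite -(adj_size uv) => hv hu.
have M10 : 0 <= (M + 1) * s ^+ size u by rewrite mulr_ge0 ?addr_ge0.
have -> : 6 * 2 `^ p * (M + 1) * s ^+ size u = 2 `^ p * (6 * ((M + 1) * s ^+ size u)) by ring.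
rewrite -mulrDr; apply: (ler_pM (ltW P1) _ P12); last by lra.
by rewrite !addr_ge0 ?osc_ge0 // ltW.
Qed.

Let cchild u i : `|c (rcons u i) - c u| <= A * t ^+ size u.
Proof.
apply: At_le => //; set v := rcons u i; set n := size u.
have sv : size v = n.+1 by rewrite size_rcons.
have n0 : 0 < 5 ^+ n :> R by rewrite exprn_gt0.
have vu : cell K v `<=` cell K u by rewrite /v -cats1; exact: cell_cat_sub.
have := moment_dist p1' mK muK hf.1 hf.2 (c v) (c u) (mcell v) (@cellK v).
rewrite (mu_cell_fine hmu) sv.
have m1 : 5 ^+ n.+1 * moment (cell K v) (c v) <= (M + 1) * s ^+ n.
  apply: (@le_trans _ _ ((M + 1) * s ^+ n.+1)).
    rewrite -sv; apply: le_trans (oe v); apply: le_trans (Hc v).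
    by rewrite ler_wpM2l ?exprn_ge0 //; exact: moment_cell_Star.
  by rewrite ler_wpM2l ?addr_ge0 // exprS ler_piMl // ltW.
have m2 : 5 ^+ n * moment (cell K v) (c u) <= (M + 1) * s ^+ n.
  apply: le_trans (oe u); apply: le_trans (Hc u); rewrite -/n ler_wpM2l ?exprn_ge0 //.
  apply: (moment_mono p1' mK muK hf.1 hf.2) => //; first exact: Star_measurable.
    apply: subset_trans vu _; exact/cell_Star/adj_refl.
  exact: Star_sub.
move: m1 m2; set a := moment _ _; set b := moment _ _; rewrite exprS => m1 m2 H.
have M10 : 0 <= (M + 1) * s ^+ n by rewrite mulr_ge0 ?addr_ge0.
have {}H : `|c v - c u| `^ p <= 2 `^ (p - 1) * (5 * 5 ^+ n * a + 5 * (5 ^+ n * b)).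
  have -> : 2 `^ (p - 1) * (5 * 5 ^+ n * a + 5 * (5 ^+ n * b)) =
    2 `^ (p - 1) * (a + b) * 5 ^+ n.+1 by rewrite exprS; ring.
  by rewrite -ler_pdivrMr ?exprn_gt0 // -exprVn.
apply: le_trans H _.
have -> : 6 * 2 `^ p * (M + 1) * s ^+ n = 2 `^ p * (6 * ((M + 1) * s ^+ n)) by ring.
apply: (ler_pM (ltW P1) _ P12); last by lra.
by rewrite addr_ge0 // !mulr_ge0 ?moment_ge0 // ltW.
Qed.

Let chain m k w (u u0 : seq 'I_5) : size w = m -> size u = k -> size u0 = k ->
  `|c (w ++ u) - c (w ++ u0)| `^ p <= 2 `^ p * lam p ^+ k *
     \sum_(v <- words (m + k) | star w v) 2 `^ p * (osc v + e (m + k)).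
Proof.
move=> sw su su0; rewrite -lamE.
apply: (chain_bound p1' (H := fun v => 2 `^ p * (osc v + e (m + k)))) => //.
- move=> v v' sv sv' vv'; apply: le_trans (osc_adj hK hmu p1' hf Hc vv') _.
  by rewrite sv sv'; apply: lerD; apply: ler_wpM2r P12.
- by move=> v; apply: mulr_ge0 (oe0 _ _); exact: ltW.
- exact: adj_refl.
Qed.

(** On each cell of level [n] both [f] and [g] are close to its constant, so that the
    integral of [|f - g| ^ p] is at most of order [s ^+ n], for every [n]. *)
Let ae_eq_of_cells (g : R * R -> R) (B : R) : {within K, continuous g} ->
  (forall u x, cell K u x -> `|g x - c u| <= `|B| * t ^+ size u) ->
  {ae mu, forall x, K x -> f x = g x}.
Proof.
move=> gc gB; have mg := within_continuous_measurable (K_closed hK) gc.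
pose h (x : borel_plane R) : \bar R := (`|f x - g x| `^ p)%:E.
have mh : measurable_fun (K : set (borel_plane R)) h.
  have := measurable_dist_powR p 0 (measurable_funB hf.1 mg).
  by under eq_fun do rewrite subr0.
have h0 x : (0 <= h x)%E by rewrite lee_fin powR_ge0.
set D := 2 `^ p * (M + 1 + `|B| `^ p).
have key n : (\int[mu]_(x in K) h x <= (D * s ^+ n)%:E)%E.
  pose G w (x : borel_plane R) := ((2 `^ p)%:E * (`|f x - c w| `^ p)%:E +
    (2 `^ p * (`|B| `^ p * s ^+ n))%:E)%E.
  have b0 : 0 <= 2 `^ p * (`|B| `^ p * s ^+ n).
    by apply: mulr_ge0 (ltW P2) _; apply: mulr_ge0 (powR_ge0 _ _) _.
  have mG w := measurable_moment p mK hf.1 (c w) (mcell w) (@cellK w).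
  have mG2 w : measurable_fun (cell K w : set (borel_plane R))
      (fun x : borel_plane R => ((2 `^ p)%:E * (`|f x - c w| `^ p)%:E)%E).
    exact: measurable_funeM (mG w).
  have G2 w x : (0 <= (2 `^ p)%:E * (`|f x - c w| `^ p)%:E)%E.
    by rewrite mule_ge0 ?lee_fin ?powR_ge0.
  have n5 : 0 < 5 ^+ n :> R by rewrite exprn_gt0.
  apply: (@le_trans _ _ (\sum_(w <- words n) \int[mu]_(x in cell K w) G w x)%E).
    apply: integral_cover => //.
    - by move=> w; apply: emeasurable_funD => //; exact: measurable_cst.
    - by move=> w x _; apply: adde_ge0 (G2 w x) _; rewrite lee_fin.
    - move=> x Kx; have [w sw wx] := K_cell hK n Kx.
      exists w; first by rewrite mem_words sw.
      split=> //; rewrite /G /h -EFinM -EFinD lee_fin.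
      have := powR_dist p1' (f x) (c w) (g x).
      have H2 : `|c w - g x| `^ p <= `|B| `^ p * s ^+ n.
        by rewrite -tp // distrC; apply: ler_powR_base => //; rewrite -sw; exact: gB.
      move=> /le_trans; apply; rewrite -mulrDr; apply: (ler_pM (ltW P1) _ P12).
        by rewrite addr_ge0 ?powR_ge0.
      by rewrite lerD2l.
  have intG w : size w = n -> (\int[mu]_(x in cell K w) G w x <=
      (2 `^ p * (5^-1 ^+ n * (osc w + e n) + 5^-1 ^+ n * (`|B| `^ p * s ^+ n)))%:E)%E.
    move=> sw; rewrite ge0_integralD //.
    rewrite integral_cst // (mu_cell hmu) -EFinM ge0_integralZl_EFin ?powR_ge0 //.
    rewrite (momentE p1' mK muK hf.1 hf.2) // -EFinM -EFinD lee_fin sw mulrDr.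
    apply: lerD; last by rewrite le_eqVlt; apply/orP; left; apply/eqP; ring.
    rewrite ler_wpM2l ?(ltW P2) // exprVn mulrC ler_pdivlMr // mulrC.
    rewrite -sw; apply: le_trans (Hc w); rewrite ler_wpM2l ?exprn_ge0 //.
    exact: moment_cell_Star.
  apply: (@le_trans _ _ (\sum_(w <- words n)
      (2 `^ p * (5^-1 ^+ n * (osc w + e n) + 5^-1 ^+ n * (`|B| `^ p * s ^+ n)))%:E)%E).
    rewrite big_seq [leRHS]big_seq; apply: lee_sum => w.
    by rewrite mem_words => /eqP; exact: intG.
  rewrite sumEFin lee_fin -mulr_sumr /D -mulrA; apply: ler_wpM2l (ltW P2) _ _ _.
  rewrite big_split /= sum_words_const -[X in X + _]mulr_sumr big_split /= sum_words_const.
  have i5 : 5 ^+ n * 5^-1 ^+ n = 1 :> R by rewrite -exprMn divff ?expr1n.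
  have i51 : 5^-1 ^+ n <= 1 :> R by rewrite exprn_ile1 //; lra.
  set Q := \sum_(w <- words n) osc w; set bs := `|B| `^ p * s ^+ n.
  have -> : 5^-1 ^+ n * (Q + 5 ^+ n * e n) + 5 ^+ n * (5^-1 ^+ n * bs) =
    5^-1 ^+ n * Q + (5 ^+ n * 5^-1 ^+ n) * (e n + bs) by ring.
  have Q1 : 5^-1 ^+ n * Q <= M * s ^+ n.
    apply: le_trans (sumosc n); rewrite ler_piMl //.
    by apply: sumr_ge0 => w _; exact: osc_ge0.
  by rewrite i5 mul1r !mulrDl mul1r addrA; apply: lerD => //; exact: lerD.
have int0 : (\int[mu]_(x in K) h x = 0)%E.
  apply/eqP; rewrite eq_le integral_ge0 // andbT; apply/lee_addgt0Pr => d d0.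
  have [n Hn] := geometric_small D s01 d0.
  by apply: le_trans (key n) _; rewrite add0e lee_fin ltW // Hn.
have : (\int[mu]_(x in K) `|h x| = 0)%E.
  by rewrite -[RHS]int0; apply: eq_integral => x _; rewrite gee0_abs.
move/(ae_eq_integral_abs mu mK mh); apply: ae_imply => x Hx Kx.
have [H0] : (`|f x - g x| `^ p)%:E = 0%R%:E := Hx Kx.
by have /eqP := powR_eq0_eq0 H0; rewrite normr_eq0 subr_eq0 => /eqP.
Qed.

(** The edges of level [m] are compared with chains of arbitrarily small cells
    ending at their two endpoints. *)
Let cell_energy_bound (g : R * R -> R) (B : R) m :
  (forall u x, cell K u x -> `|g x - c u| <= `|B| * t ^+ size u) ->
  cell_energy p g m <= 45 * 2 `^ p * 2 `^ p * 2 `^ p * M.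
Proof.
move=> gB; have [t0 _] := andP t01.
set b := (2 * `|B|) `^ p; have b0 : 0 <= b by exact: powR_ge0.
set Y := 5 * 2 `^ p * (9 * 2 `^ p * 2 `^ p + lam p ^+ m * 5 ^+ m * b).
apply: (le_add_geometric (M := Y) s01) => k; set N := (m + k)%N.
pose SS w := \sum_(v <- words N | star w v) 2 `^ p * (osc v + e N).
have SS0 w : 0 <= SS w.
  by apply: sumr_ge0 => v _; apply: mulr_ge0 (ltW P2) (oe0 _ _).
have lk0 : 0 <= lam p ^+ k by rewrite exprn_ge0 // ltW.
have lm0 : 0 <= lam p ^+ m by rewrite exprn_ge0 // ltW.
have one w i : size w = m -> `|g (Pw w 0) - g (Pw w (q R i))| `^ p <=
    2 `^ p * (2 `^ p * lam p ^+ k * SS w + b * s ^+ N).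
  move=> sw.
  have near j : cell K (w ++ nseq k j) (Pw w (q R j)).
    rewrite cell_cat; exists (q R j) => //; rewrite -[X in cell K _ X](Pw_nseq R k j).
    by apply: cell_Pw; exact: K_q.
  have n0 := gB _ _ (near ctr); have ni := gB _ _ (near i).
  rewrite !size_cat !size_nseq sw -/N in n0 ni.
  have C := chain sw (size_nseq k ctr) (size_nseq k i); rewrite -/N -/(SS w) in C.
  set c0 := c (w ++ nseq k ctr) in n0 C; set ci := c (w ++ nseq k i) in ni C.
  apply: (@le_trans _ _ ((`|c0 - ci| + 2 * `|B| * t ^+ N) `^ p)).
    apply: ler_powR_base => //.
    rewrite q_ctr in n0; move: n0 ni; set x0 := g _; set xi := g _ => n0 ni.
    have -> : x0 - xi = (c0 - ci) + ((x0 - c0) - (xi - ci)) by ring.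
    apply: le_trans (ler_normD _ _) _; rewrite lerD2l.
    by apply: le_trans (ler_normB _ _) _; lra.
  apply: le_trans (powR_addr p1' _ _) _ => //; first by rewrite !mulr_ge0 ?exprn_ge0.
  rewrite tp ?mulr_ge0 // -/b; apply: (ler_pM (ltW P1) _ P12).
    by rewrite addr_ge0 ?powR_ge0 // mulr_ge0.
  by rewrite lerD2r.
have SSsum : \sum_(w <- words m) SS w <= 9 * 2 `^ p * (M * s ^+ N + s ^+ N * s ^+ N).
  rewrite (eq_sum_words (H := fun w => \sum_(v <- words m | adj w v)
    \sum_(u <- words k) 2 `^ p * (osc (v ++ u) + e N))); last first.
    by move=> w sw; exact: sum_star.
  apply: le_trans (sum_adj _ _) _.
    by move=> v; apply: sumr_ge0 => u _; apply: mulr_ge0 (ltW P2) (oe0 _ _).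
  rewrite -(sum_words_cat m k (fun v => 2 `^ p * (osc v + e N))) -/N.
  rewrite -mulr_sumr -mulrA ler_wpM2l // ler_wpM2l ?(ltW P2) //.
  by rewrite big_split /= sum_words_const lerD.
apply: (@le_trans _ _ (lam p ^+ m * \sum_(w <- words m)
    5 * (2 `^ p * (2 `^ p * lam p ^+ k * SS w + b * s ^+ N)))).
  rewrite ler_wpM2l //; apply: ler_sum_words => w sw.
  apply: (@le_trans _ _ (\sum_(i : 'I_5)
      2 `^ p * (2 `^ p * lam p ^+ k * SS w + b * s ^+ N))).
    rewrite big_mkcond; apply: ler_sum => i _; case: ifP => _; first exact: one.
    by apply: mulr_ge0 (ltW P2) _; rewrite addr_ge0 // !mulr_ge0 // ltW.
  by rewrite sumr_const card_ord mulr_natl.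
rewrite -!mulr_sumr big_split /= -mulr_sumr sum_words_const.
apply: (@le_trans _ _ (lam p ^+ m * (5 * (2 `^ p * (2 `^ p * lam p ^+ k *
   (9 * 2 `^ p * (M * s ^+ N + s ^+ N * s ^+ N)) + 5 ^+ m * (b * s ^+ N)))))).
  rewrite ler_wpM2l // ler_wpM2l // ler_wpM2l ?(ltW P2) // lerD2r ler_wpM2l //.
  by rewrite mulr_ge0 // ltW.
have ls : lam p ^+ m * lam p ^+ k * s ^+ N = 1.
  by rewrite -exprD -exprMn divff ?expr1n // gt_eqF.
have -> : lam p ^+ m * (5 * (2 `^ p * (2 `^ p * lam p ^+ k *
   (9 * 2 `^ p * (M * s ^+ N + s ^+ N * s ^+ N)) + 5 ^+ m * (b * s ^+ N)))) =
   45 * 2 `^ p * 2 `^ p * 2 `^ p * M * (lam p ^+ m * lam p ^+ k * s ^+ N)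
   + 5 * 2 `^ p * (9 * 2 `^ p * 2 `^ p * (lam p ^+ m * lam p ^+ k * s ^+ N)
       + lam p ^+ m * 5 ^+ m * b) * s ^+ N by ring.
rewrite ls !mulr1 lerD2l -/Y ler_wpM2l //.
  rewrite /Y !mulr_ge0 // ?(ltW P2) // addr_ge0 // !mulr_ge0 ?exprn_ge0 //; exact: ltW.
by rewrite /N exprD ler_piMl.
Qed.

Lemma glued_version : exists g : R * R -> R, [/\ {within K, continuous g},
  {ae mu, forall x, K x -> f x = g x},
  exists B, forall u x y, cell K u x -> cell K u y -> `|g x - g y| <= B * t ^+ size u &
  forall m, cell_energy p g m <= 45 * 2 `^ p * 2 `^ p * 2 `^ p * M].
Proof.
have [g [gc [B gB]]] := continuous_glue hK t01 cadj cchild.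
have [t0 _] := andP t01.
have gB' u x : cell K u x -> `|g x - c u| <= `|B| * t ^+ size u.
  by move=> /gB /le_trans; apply; rewrite ler_wpM2r ?exprn_ge0 // ler_norm.
exists g; split=> //.
- exact: ae_eq_of_cells gc gB'.
- exists (B + B) => u x y /gB gx /gB gy; rewrite mulrDl -(subrK (c u) (g x)) -addrA.
  by apply: le_trans (ler_normD _ _) _; rewrite lerD // distrC.
- move=> m; exact: cell_energy_bound gB'.
Qed.

End Values.

Lemma exists_continuous_version : exists g : R * R -> R, [/\ {within K, continuous g},
  {ae mu, forall x, K x -> f x = g x},
  exists B t, 0 <= t < 1 /\
    forall u x y, cell K u x -> cell K u y -> `|g x - g y| <= B * t ^+ size u &
  forall m, cell_energy p g m <= 45 * 2 `^ p * 2 `^ p * 2 `^ p * M].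
Proof.
have [c Hc] := osc_choice K mu p f e0.
have [g [H1 H2 [B H3] H4]] := glued_version Hc.
by exists g; split=> //; exists B, t.
Qed.

End ContinuousVersion.

(** * The discrete energies *)

Section DiscreteEnergy.
Variables (R : realType) (K : set (R * R)).
Hypothesis hK : is_vicsek_set K.
Implicit Types (x y : R * R) (i j : 'I_5) (u v w : seq 'I_5).

Lemma lin_center_lt1 j w : lin j (Pw w (0 : R * R)) < 1.
Proof.
elim: w => [|i w IH] /=; first by rewrite /lin /= !mulr0 addr0 ltr01.
by rewrite lin_psi; have := lin_q_le1 R j i; lra.
Qed.

(** Where [u] and [v] first differ, the functional of a corner letter separates the
    two first-level cells strictly, as it does not attain its bounds at centres. *)
Lemma center_inj u v y : size u = size v -> K y -> Pw u 0 = Pw v y -> u = v /\ y = 0.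
Proof.
move=> + Ky; elim: u v => [|i u IH] [|j v] //= [suv] H.
have [ij|ij] := eqVneq i j.
  by rewrite ij in H *; have [-> ->] := IH v suv (psi_inj H).
have Kv := K_Pw hK v Ky.
exfalso.
have [ic|ic] := eqVneq i ctr.
  have ji : j != ctr by rewrite -ic eq_sym.
  have {H} := congr1 (lin j) H; rewrite !lin_psi ic q_ctr lin_qq //.
  have -> : lin j (0 : R * R) = 0 by rewrite /lin /= !mulr0 addr0.
  have := lin_center_lt1 j u; have := lin_geN1 hK j Kv; lra.
have {H} := congr1 (lin i) H; rewrite !lin_psi lin_qq //.
have := lin_center_lt1 (opposite i) u; rewrite lin_opposite.
have ji : j != i by rewrite eq_sym.
have := lin_le1 hK i Kv; have := lin_q_le0 R ji; lra.
Qed.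

Lemma q_neq0 i : i != ctr -> q R i != 0.
Proof.
move=> ic; apply/eqP => q0; have := lin_qq R ic.
by rewrite q0 /lin /= !mulr0 addr0 => /eqP; rewrite eq_sym oner_eq0.
Qed.

Lemma edgesP m e : edges m e <->
  exists w i, [/\ size w = m, i != ctr & e = (Pw w 0, Pw w (q R i))].
Proof.
elim: m e => [|m IH] e /=.
  split=> [[i /eqP ic <-]|[w [i [/size0nil -> ic ->]]]]; first by exists [::], i.
  by exists i => //; exact/eqP.
split=> [[j _ [e' /IH [w [i [sw ic ->]]] <-]]|[[|j w] [i [// [sw] ic ->]]]].
  by exists (j :: w), i; rewrite /= sw.
by exists j => //; exists (Pw w 0, Pw w (q R i)) => //; apply/IH; exists w, i.
Qed.

Lemma V_Pw m w i : size w = m -> V m (Pw w (q R i)).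
Proof.
elim: m w => [|m IH] [|j w] //= => [_|[sw]]; first by exists i.
by exists j => //; exists (Pw w (q R i)) => //; exact: IH.
Qed.

Definition edge_list m : seq ((R * R) * (R * R)) :=
  [seq (Pw w 0, Pw w (q R i)) | w <- words m, i <- [seq i <- enum 'I_5 | i != ctr]].

Lemma mem_edge_list m e : (e \in edge_list m) <-> edges m e.
Proof.
split.
  move=> /allpairsPdep [w [i [wm im ->]]]; apply/edgesP; exists w, i.
  by move: wm im; rewrite mem_words mem_filter => /eqP -> /andP [-> _].
move=> /edgesP [w [i [sw ic ->]]]; apply/allpairsPdep; exists w, i.
by rewrite mem_words sw eqxx mem_filter ic mem_enum.
Qed.

Definition flip (e : (R * R) * (R * R)) := (e.2, e.1).

Lemma flipK : involutive flip. Proof. by case. Qed.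

(** A centre determines its cell and is never a corner of a cell of the same level,
    so that no edge occurs twice, in whichever orientation. *)
Lemma edge_list_uniq m : uniq (edge_list m ++ map flip (edge_list m)).
Proof.
have U : uniq (edge_list m).
  apply: allpairs_uniq; [exact: uniq_words|by rewrite filter_uniq // enum_uniq|].
  move=> [w i] [v j] /allpairsPdep [w' [i' [+ + [-> ->]]]].
  rewrite mem_words mem_filter => /eqP sw /andP [ic _].
  move=> /allpairsPdep [v' [j' [+ + [-> ->]]]].
  rewrite mem_words mem_filter => /eqP sv /andP [jc _] [H1 H2].
  have [wv _] := center_inj (etrans sw (esym sv)) (K_0 hK) H1.
  rewrite -wv in H2 *; congr (_, _); apply: contraTeq isT => ij.
  have /eqP := PwB w' (q R i') (q R j'); rewrite H2 subrr eq_sym scaler_eq0.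
  rewrite expf_eq0 invr_eq0 pnatr_eq0 andbF /= subr_eq0 => /eqP qq.
  by have := lin_q_le0 R ij; rewrite qq lin_qq // ler10.
rewrite cat_uniq U map_inj_uniq ?U ?andbT; last exact: can_inj flipK.
apply/hasPn => _ /mapP [e /mem_edge_list /edgesP [w [i [sw ic ->]]] ->].
apply/negP => /mem_edge_list /edgesP [v [j [sv jc [H1 _]]]].
have [_ /eqP] := center_inj (etrans sv (esym sw)) (K_q hK i) (esym H1).
by rewrite (negbTE (q_neq0 ic)).
Qed.

Lemma edge_pairs m :
  [set` edge_list m ++ map flip (edge_list m)] =
  [set z | [/\ V m z.1, V m z.2 & neighbors m z.1 z.2]].
Proof.
have Ve (e : (R * R) * (R * R)) : edges m e -> V m e.1 /\ V m e.2.
  by move=> /edgesP [w [i [sw _ ->]]]; split; [exact: (V_Pw ctr sw)|exact: V_Pw].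
apply/seteqP; split => z /=; rewrite mem_cat.
  case/orP => [/mem_edge_list ez|/mapP [e /mem_edge_list ee ->]].
    by have [h1 h2] := Ve _ ez; split=> //; left; case: z ez {h1 h2}.
  by have [h1 h2] := Ve _ ee; split=> //; right; case: e ee {h1 h2}.
case=> _ _ [] ez; apply/orP; [left|right].
  by apply/mem_edge_list; case: z ez.
apply/mapP; exists (z.2, z.1); first exact/mem_edge_list.
by case: z {ez}.
Qed.

Lemma discrete_energyE (p : R) (g : R * R -> R) m : discrete_energy p m g = cell_energy p g m.
Proof.
rewrite /discrete_energy -edge_pairs -fsbig_seq ?edge_list_uniq // big_cat /= big_map /=.
rewrite [X in _ * (_ + X) = _](_ : _ = \sum_(z <- edge_list m) `|g z.1 - g z.2| `^ p); last first.
  by apply: eq_bigr => z _; rewrite distrC.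
rewrite big_allpairs_dep /= /cell_energy lamE.
have H w : \sum_(i <- [seq i <- enum 'I_5 | i != ctr]) `|g (Pw w 0) - g (Pw w (q R i))| `^ p =
    \sum_(i : 'I_5 | i != ctr) `|g (Pw w 0) - g (Pw w (q R i))| `^ p.
  by rewrite big_filter big_enum_cond.
by rewrite (eq_bigr _ (fun w _ => H w)); field.
Qed.

(** Each edge is cut into three edges of the next level. *)
Lemma cell_energy_mono p (g : R * R -> R) m : 1 <= p ->
  cell_energy p g m <= cell_energy p g m.+1.
Proof.
move=> p1; pose D w i := `|g (Pw w 0) - g (Pw w (q R i))| `^ p.
have D0 w i : 0 <= D w i by exact: powR_ge0.
have l0 := lam_gt0 p1.
rewrite /cell_energy exprSr -mulrA ler_wpM2l ?exprn_ge0 ?(ltW l0) //.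
rewrite -[m.+1]addn1 sum_words_cat mulr_sumr; apply: ler_sum_words => w sw.
pose G j := \sum_(i | i != ctr) D (w ++ [:: j]) i.
rewrite [X in _ <= _ * X](_ : _ = \sum_j G j); last first.
  by rewrite sum_wordsS; apply: eq_bigr => j _; rewrite sum_words0.
rewrite [X in _ <= _ * X](bigD1 ctr) //= -big_split /=.
rewrite mulr_sumr; apply: ler_sum => i ic.
have oc : opposite i != ctr by rewrite opposite_eq_ctr.
apply: (@le_trans _ _ (lam p * (D (w ++ [:: ctr]) i +
    (D (w ++ [:: i]) (opposite i) + D (w ++ [:: i]) i)))).
  set x0 := g (Pw w 0); set x1 := g (Pw (w ++ [:: ctr]) (q R i)).
  set x2 := g (Pw (w ++ [:: i]) 0); set x3 := g (Pw w (q R i)).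
  have e0 : g (Pw (w ++ [:: ctr]) 0) = x0 by rewrite Pw_cat /= psi_ctr0.
  have e1 : g (Pw (w ++ [:: i]) (q R (opposite i))) = x1.
    by rewrite /x1 !Pw_cat /= psi_junction.
  have e3 : g (Pw (w ++ [:: i]) (q R i)) = x3 by rewrite Pw_cat /= psi_q.
  rewrite /D e0 e1 e3 -/x1 -/x2 -/x0 -/x3.
  have := @powR_sum R p p1 [:: `|x0 - x1|; `|x2 - x1|; `|x2 - x3|].
  rewrite /= !normr_ge0 !big_cons !big_nil !addr0 => /(_ isT) /(le_trans _); apply.
  apply: ler_powR_base => //.
  have -> : x0 - x3 = (x0 - x1) + (- (x2 - x1) + (x2 - x3)) by ring.
  apply: le_trans (ler_normD _ _) _; rewrite lerD2l.
  by apply: le_trans (ler_normD _ _) _; rewrite normrN.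
rewrite ler_wpM2l ?(ltW l0) // lerD2l /G (bigD1 i) //= (bigD1 (opposite i)) /=; last first.
  by rewrite oc opposite_neq.
set S := \sum_(_ | _) _; have : 0 <= S by apply: sumr_ge0 => j _.
lra.
Qed.

Lemma energyE p (g : R * R -> R) : 1 <= p ->
  energy p g = ereal_sup (range (fun m => (cell_energy p g m)%:E)).
Proof.
move=> p1; rewrite /energy; under eq_fun do rewrite discrete_energyE.
apply/cvg_lim => //; apply: ereal_nondecreasing_cvgn.
apply/nondecreasing_seqP => m; rewrite lee_fin; exact: cell_energy_mono.
Qed.

End DiscreteEnergy.

(** * Lower and upper limits at zero *)

Section LimitsAtZero.
Variable R : realType.
Implicit Types (F : R -> \bar R) (a : \bar R) (del r : R).
Local Open Scope ereal_scope.

Lemma near_zero del : (0 < del)%R -> \forall r \near (0 : R)^'+, (0 < r < del)%R.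
Proof.
move=> d0; near=> r; apply/andP; split; near: r.
  exact: nbhs_right_gt.
exact: nbhs_right_lt.
Unshelve. all: by end_near. Qed.

Lemma le_limf_einf F a del : (0 < del)%R ->
  (forall r, (0 < r < del)%R -> a <= F r) -> a <= limf_einf F (0 : R)^'+.
Proof.
move=> d0 H; rewrite limf_einfE.
apply: (@le_trans _ _ (ereal_inf (F @` [set r : R | (0 < r < del)%R]))).
  by apply: le_ereal_inf_tmp => _ [r rd <-]; exact: H.
by apply: ereal_sup_ubound; exists [set r : R | (0 < r < del)%R] => //; exact: near_zero.
Qed.

Lemma limf_einf_le F a del : (0 < del)%R ->
  (forall r, (0 < r < del)%R -> F r <= a) -> limf_einf F (0 : R)^'+ <= a.
Proof.
move=> d0 H; rewrite limf_einfE; apply: ge_ereal_sup => _ [V V0 <-].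
have [r [Vr rd]] := filter_ex (filterI V0 (near_zero d0)).
by apply: le_trans (H r rd); apply: ereal_inf_lbound; exists r.
Qed.

Lemma limf_esup_le F a del : (0 < del)%R ->
  (forall r, (0 < r < del)%R -> F r <= a) -> limf_esup F (0 : R)^'+ <= a.
Proof.
move=> d0 H; rewrite limf_esupE.
apply: (@le_trans _ _ (ereal_sup (F @` [set r : R | (0 < r < del)%R]))).
  by apply: ereal_inf_lbound; exists [set r : R | (0 < r < del)%R] => //; exact: near_zero.
by apply: ge_ereal_sup => _ [r rd <-]; exact: H.
Qed.

Lemma limf_einf_le_esup F : limf_einf F (0 : R)^'+ <= limf_esup F (0 : R)^'+.
Proof.
rewrite limf_einfE limf_esupE; apply: ge_ereal_sup => _ [V V0 <-].
apply: le_ereal_inf_tmp => _ [W W0 <-].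
have [r [Vr Wr]] := filter_ex (filterI V0 W0).
apply: (@le_trans _ _ (F r)).
  by apply: ereal_inf_lbound; exists r.
by apply: ereal_sup_ubound; exists r.
Qed.

End LimitsAtZero.

(** * The critical exponent and the comparison of the energies *)

Section Critical.
Variables (R : realType) (K : set (R * R)) (d : R * R -> R * R -> R).
Variable mu : {measure set (borel_plane R) -> \bar R}.
Hypotheses (hK : is_vicsek_set K) (hd : is_geodesic_distance K d).
Hypothesis hmu : is_vicsek_measure K mu.
Variable p : R.
Hypothesis p1 : 1 <= p.
Implicit Types (f g : borel_plane R -> R) (r : R).
Local Notation osc_energy := (osc_energy K mu p).

Let p0 : 0 < p. Proof. exact: lt_le_trans p1. Qed.
Let l0 := lam_gt0 p1.

Definition alpha_vicsek : R := 1 + (ln 5 / ln 3 - 1) / p.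

Let ln3 : 0 < ln 3 :> R. Proof. by rewrite ln_gt0 // ltr1n. Qed.

Let pa : p * alpha_vicsek = p - 1 + ln 5 / ln 3.
Proof. by rewrite /alpha_vicsek; field; rewrite !gt_eqF. Qed.

Lemma alpha_vicsek_ge0 : 0 <= alpha_vicsek.
Proof.
have H : 1 <= ln 5 / ln 3 :> R.
  by rewrite ler_pdivlMr // mul1r ler_ln ?posrE // ler_nat.
by rewrite /alpha_vicsek addr_ge0 // divr_ge0 ?subr_ge0 // ltW.
Qed.

Let pa0 : 0 <= p * alpha_vicsek.
Proof. by rewrite mulr_ge0 ?alpha_vicsek_ge0 // ltW. Qed.

Lemma kappa_vicsek : 3 `^ (p * alpha_vicsek) = lam p * 5.
Proof.
rewrite pa powRD ?pnatr_eq0 ?implybT //; congr (_ * _).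
by rewrite /powR gt_eqF // divfK ?gt_eqF // lnK // posrE.
Qed.

Local Notation E f := (Epa K d mu p alpha_vicsek f).

Definition liminf_const : R := mono_const p * low_const p alpha_vicsek.

Lemma liminf_const_gt0 : 0 < liminf_const.
Proof. by rewrite mulr_gt0 ?mono_const_gt0 ?low_const_gt0. Qed.

(** The radius determines a level [k], and weak monotonicity passes from [k] to every
    coarser level [n]: arbitrarily small radii control all the levels, so that a lower
    limit is enough. *)
Lemma osc_energy_le_Epa f n r : Lp K mu p f -> 0 < r -> r <= 4 * 3^-1 ^+ n ->
  ((osc_energy f n)%:E <= liminf_const%:E * E f r)%E.
Proof.
move=> hf r0 rn; have [k [rk kr]] := radius_scale r0.
have nk : (n <= k)%N.
  rewrite leqNgt; apply/negP => kn.
  have : 3^-1 ^+ n <= 3^-1 ^+ k :> R by apply: ler_wiXn2l; [lra|lra|exact: ltnW].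
  by have := lt_le_trans rk rn; lra.
have rk' : r <= 12 * 3^-1 ^+ k.
  case: kr => // k0; move: rk nk; rewrite k0 leqn0 => rk /eqP n0.
  by move: rn; rewrite n0 => rn; have := lt_le_trans rk rn; rewrite ltxx.
have := osc_energy_le hK hd hmu p1 hf pa0 rk rk'.
rewrite kappa_vicsek mulfK ?pnatr_eq0 // -/(osc_energy f k) => H.
apply: (@le_trans _ _ ((mono_const p)%:E * (osc_energy f k)%:E)%E).
  by rewrite -EFinM lee_fin -(subnKC nk); exact: osc_energy_mono.
rewrite /liminf_const [(mono_const p * _)%:E]EFinM -muleA; apply: lee_wpmul2l H.
by rewrite lee_fin ltW // mono_const_gt0.
Qed.

Lemma Epa_le_osc_energy f M r : Lp K mu p f -> 0 < r ->
  (forall n, osc_energy f n <= M) -> (E f r <= (up_const p * M)%:E)%E.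
Proof.
move=> hf r0 HM; have [k [rk kr]] := radius_scale r0.
apply: le_trans (Epa_le hK hd hmu p1 hf pa0 kappa_vicsek rk kr) _.
by rewrite lee_fin ler_wpM2l // ltW // up_const_gt0.
Qed.

Lemma supE_le f M : Lp K mu p f -> (forall n, osc_energy f n <= M) ->
  (supE K d mu p alpha_vicsek f <= (up_const p * M)%:E)%E.
Proof.
move=> hf HM; apply: ge_ereal_sup => _ [r /= r0 <-]; exact: Epa_le_osc_energy.
Qed.

Lemma Epa_ge0 alpha f r : (0 <= Epa K d mu p alpha f r)%E.
Proof.
apply: integral_ge0 => x _; rewrite mule_ge0 ?inve_ge0 //.
by apply: integral_ge0 => y _; rewrite lee_fin divr_ge0 ?powR_ge0.
Qed.

Lemma KS_liminf f : KS K d mu alpha_vicsek p f -> exists2 l : R,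
  limf_einf (E f) (0 : R)^'+ = l%:E & forall n, osc_energy f n <= liminf_const * l.
Proof.
move=> [hf hsup].
have l1 : (limf_einf (E f) (0 : R)^'+ < +oo)%E.
  exact: le_lt_trans (limf_einf_le_esup _) hsup.
have l2 : (0 <= limf_einf (E f) (0 : R)^'+)%E.
  by apply: (le_limf_einf ltr01) => r _; exact: Epa_ge0.
have c0 := liminf_const_gt0.
have H n : ((osc_energy f n / liminf_const)%:E <= limf_einf (E f) (0 : R)^'+)%E.
  have d0 : 0 < 4 * 3^-1 ^+ n :> R by rewrite mulr_gt0 // exprn_gt0 // invr_gt0.
  apply: (le_limf_einf d0) => r /andP [r0 rd].
  by rewrite EFinM muleC lee_pdivrMl //; exact: osc_energy_le_Epa hf r0 (ltW rd).
case: (limf_einf _ _) l1 l2 H => [l| |] // _ _ H; exists l => // n.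
by have := H n; rewrite lee_fin ler_pdivrMr // mulrC.
Qed.

Lemma KS_of_bounded f M : Lp K mu p f -> (forall n, osc_energy f n <= M) ->
  KS K d mu alpha_vicsek p f.
Proof.
move=> hf HM; split=> //; apply: le_lt_trans (ltry (up_const p * M)).
by apply: (limf_esup_le ltr01) => r /andP [r0 _]; exact: Epa_le_osc_energy.
Qed.

Lemma propertyP_vicsek : propertyP K d mu p alpha_vicsek.
Proof.
split.
  have [g [hg [S HS] nc]] := exists_nonconstant hK hmu p1.
  by exists g => //; exact: KS_of_bounded HS.
have c0 := liminf_const_gt0; have u0 := up_const_gt0 p.
exists (1 + up_const p * liminf_const); first by rewrite lerDl mulr_ge0 // ltW.
move=> f hf; have [l lE Hl] := KS_liminf hf.
apply: le_trans (supE_le hf.1 Hl) _; rewrite lE -EFinM lee_fin mulrA.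
rewrite ler_wpM2r ?lerDr //.
have := le_trans (osc_energy_ge0 K mu f p1 0) (Hl 0%N).
by rewrite pmulr_rge0.
Qed.

(** The infimum [osc [::]] might not be attained; almost best constants form a Cauchy
    sequence, and its limit attains it. *)
Lemma osc0_is_constant f : Lp K mu p f -> osc K mu p f [::] <= 0 -> is_constant K mu f.
Proof.
move=> hf o0; have mK := K_measurable hK.
have muK1 : fine (mu K) = 1 by rewrite (mu_cell hmu [::]).
have muK : (mu K < +oo)%E by rewrite (mu_cell hmu [::]) ltry.
set s := (2^-1 : R) `^ p.
have h0 : 0 <= (2^-1 : R) by rewrite invr_ge0.
have s0 : 0 < s by rewrite powR_gt0 // invr_gt0.
have s01 : 0 <= s < 1.
  rewrite (ltW s0) /=; have -> : 1 = 1 `^ p :> R by rewrite powR1.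
  by apply: gt0_ltr_powR; rewrite ?nnegrE //; lra.
have ex n : exists c, moment mu p f K c <= s ^+ n.
  have sn0 : 0 < s ^+ n by rewrite exprn_gt0.
  have [c Hc] := osc_choice K mu p f (fun _ : nat => sn0).
  exists (c [::]); have := Hc [::]; rewrite expr0 mul1r => H.
  apply: le_trans (moment_cell_Star hK hmu p1 hf [::] (c [::])) _.
  by apply: le_trans H _; rewrite gerDr.
have [c Hc] := choice ex.
have t01 : 0 <= (2^-1 : R) < 1 by apply/andP; split; lra.
have step n : `|c n.+1 - c n| <= 2 * 2^-1 ^+ n.
  have := moment_dist p1 mK muK hf.1 hf.2 (c n.+1) (c n) mK (@subset_refl _ K).
  rewrite muK1 mulr1 => H.
  have b0 : 0 <= 2 * 2^-1 ^+ n :> R by rewrite mulr_ge0 // exprn_ge0.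
  rewrite leNgt; apply/negP => lt1.
  have : (2 * 2^-1 ^+ n) `^ p < `|c n.+1 - c n| `^ p.
    by apply: gt0_ltr_powR; rewrite ?nnegrE.
  apply/negP; rewrite -leNgt; apply: le_trans H _.
  rewrite powRM ?exprn_ge0 // powR_exprn // -/s.
  have sn : s ^+ n.+1 <= s ^+ n.
    by rewrite exprS ler_piMl ?exprn_ge0 ?(ltW s0) // ltW //; case/andP: s01.
  have -> : 2 `^ p = 2 `^ (p - 1) * 2 :> R by rewrite mulrC mulr_powRB1.
  rewrite -mulrA ler_wpM2l ?powR_ge0 //.
  by rewrite [2 * _]mulr_natl mulr2n; apply: lerD; [exact: le_trans (Hc _) sn|exact: Hc].
have [l Hl] := geometric_limit t01 step; exists l.
set B := 2 / (1 - 2^-1) in Hl.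
apply: (moment_eq0 p1 mK muK hf.1 hf.2); apply/eqP; rewrite eq_le moment_ge0 andbT.
apply: (le_add_geometric (M := 2 `^ (p - 1) * (1 + B `^ p)) s01) => n; rewrite add0r.
apply: le_trans (moment_shift p1 mK muK hf.1 hf.2 l (c n) mK (@subset_refl _ K)) _.
rewrite muK1 mulr1 -mulrA ler_wpM2l ?powR_ge0 // mulrDl mul1r; apply: lerD; first exact: Hc.
have B0 : 0 <= B by rewrite /B divr_ge0 //; lra.
have -> : B `^ p * s ^+ n = (B * 2^-1 ^+ n) `^ p.
  by rewrite [RHS]powRM ?exprn_ge0 // powR_exprn.
by apply: ler_powR_base => //; rewrite distrC.
Qed.

(** Above the critical exponent a finite energy forces the energies at the critical
    exponent to vanish at small scales, hence at all scales. *)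
Lemma besov_supercritical alpha f : alpha_vicsek < alpha -> besov K d mu alpha p f ->
  is_constant K mu f.
Proof.
move=> aa [hf hsup]; apply: osc0_is_constant => //.
have a0 : 0 <= p * alpha.
  by rewrite mulr_ge0 ?(ltW p0) // (le_trans alpha_vicsek_ge0) // ltW.
set rho := 3 `^ (p * (alpha - alpha_vicsek)) : R.
have rho1 : 1 < rho.
  rewrite /rho -[X in X < _](powRr0 3) /powR pnatr_eq0 /= ltr_expR mul0r.
  by rewrite mulr_gt0 // mulr_gt0 // subr_gt0.
have kE : 3 `^ (p * alpha) / 5 = lam p * rho.
  have -> : p * alpha = p * alpha_vicsek + p * (alpha - alpha_vicsek) by ring.
  rewrite powRD ?pnatr_eq0 ?implybT // kappa_vicsek -/rho.
  by field.
have r01 : 0 <= rho^-1 < 1.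
  by rewrite invr_ge0 (le_trans ler01 (ltW rho1)) /= invf_lt1 // (lt_trans ltr01).
have [M HM] : exists M : R, (supE K d mu p alpha f <= M%:E)%E.
  have sup0 : (0 <= supE K d mu p alpha f)%E.
    apply: le_trans (Epa_ge0 alpha f 1) _; apply: ereal_sup_ubound; exists 1 => //=.
  by move: hsup sup0; case: supE => [M| |] // _ _; exists M.
apply: (le_add_geometric (M := mono_const p * (low_const p alpha * M)) r01) => n.
rewrite add0r; set r := 12 * 3^-1 ^+ n : R.
have e0 : 0 < 3^-1 ^+ n :> R by rewrite exprn_gt0 // invr_gt0.
have r1 : 4 * 3^-1 ^+ n < r by rewrite /r; lra.
have Er : (Epa K d mu p alpha f r <= M%:E)%E.
  apply: le_trans HM; apply: ereal_sup_ubound; exists r => //=.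
  by rewrite /r mulr_gt0.
have low0 := low_const_gt0 p alpha.
have := osc_energy_le hK hd hmu p1 hf a0 r1 (lexx r).
move=> /le_trans /(_ (lee_wpmul2l _ Er)) /wrap [].
  by rewrite lee_fin ltW.
rewrite -EFinM lee_fin kE exprMn [lam p ^+ n * _]mulrC => H0.
have H : rho ^+ n * osc_energy f n <= low_const p alpha * M by rewrite /osc_energy mulrA.
have rn0 : 0 < rho ^+ n by rewrite exprn_gt0 // (lt_trans ltr01).
have : osc_energy f 0 <= mono_const p * osc_energy f n.
  exact: (osc_energy_mono hK hmu p1 hf 0 n).
rewrite {1}/osc_energy expr0 mul1r sum_words0 => /le_trans; apply.
apply: (@le_trans _ _ (mono_const p * (low_const p alpha * M * rho^-1 ^+ n))); last by rewrite mulrA.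
apply: ler_wpM2l; first by rewrite ltW // mono_const_gt0.
by rewrite exprVn ler_pdivlMr // [leLHS]mulrC; exact: H.
Qed.

Lemma alpha_critE : alpha_crit K d mu p = alpha_vicsek.
Proof.
rewrite /alpha_crit; set A := [set _ | _].
have inA : A alpha_vicsek.
  split; first exact: alpha_vicsek_ge0.
  have [g [hg [S HS] nc]] := exists_nonconstant hK hmu p1.
  exists g => //; split=> //; apply: le_lt_trans (supE_le hg HS) _; exact: ltry.
have ubA : ubound A alpha_vicsek.
  move=> a [_ [f hf nc]]; rewrite leNgt; apply/negP => aa.
  by apply: nc; exact: besov_supercritical aa hf.
apply/eqP; rewrite eq_le; apply/andP; split.
  by apply: ge_sup => //; exists alpha_vicsek.
by apply: ub_le_sup => //; exists alpha_vicsek.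
Qed.

End Critical.

Section Comparison.
Variables (R : realType) (K : set (R * R)) (d : R * R -> R * R -> R).
Variable mu : {measure set (borel_plane R) -> \bar R}.
Hypotheses (hK : is_vicsek_set K) (hd : is_geodesic_distance K d).
Hypothesis hmu : is_vicsek_measure K mu.
Variable p : R.
Hypothesis p1 : 1 < p.
Local Notation E f := (Epa K d mu p (alpha_vicsek p) f).

Let p1' : 1 <= p := ltW p1.
Let p0 : 0 < p. Proof. exact: lt_trans p1. Qed.

Lemma powR_invK (x : R) : 0 <= x -> (x `^ p^-1) `^ p = x.
Proof. by move=> x0; rewrite -powRrM mulVf ?gt_eqF // powRr1. Qed.

Lemma le_poweR (x y : \bar R) (s : R) : 0 <= s -> (0 <= x)%E -> (x <= y)%E ->
  (x `^ s <= y `^ s)%E.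
Proof.
move=> s0 x0 xy; apply: gt0_ler_poweR => //; rewrite in_itv /= leey andbT //.
exact: le_trans xy.
Qed.

Lemma Varp_ge f n : Lp K mu p f ->
  ((osc_energy K mu p f n / liminf_const p)%:E <= Varp K d mu p f `^ p)%E.
Proof.
move=> hf; have c0 := liminf_const_gt0 p.
have x0 : 0 <= osc_energy K mu p f n / liminf_const p.
  by rewrite divr_ge0 ?osc_energy_ge0 // ltW.
set x := osc_energy K mu p f n / _ in x0 *.
have H : ((x `^ p^-1)%:E <= Varp K d mu p f)%E.
  have d0 : 0 < 4 * 3^-1 ^+ n :> R by rewrite mulr_gt0 // exprn_gt0 // invr_gt0.
  rewrite /Varp (alpha_critE hK hd hmu p1'); apply: (le_limf_einf d0) => r /andP [r0 rd].
  rewrite -poweR_EFin; apply: le_poweR; rewrite ?invr_ge0 ?lee_fin // ?(ltW p0) //.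
  by rewrite /x EFinM muleC lee_pdivrMl //; apply: osc_energy_le_Epa => //; exact: ltW.
rewrite -[in leLHS](powR_invK x0) -poweR_EFin; apply: le_poweR => //; first exact: ltW.
by rewrite lee_fin powR_ge0.
Qed.

Lemma Varp_le f M : Lp K mu p f -> (forall n, osc_energy K mu p f n <= M) ->
  (Varp K d mu p f `^ p <= (up_const p * M)%:E)%E.
Proof.
move=> hf HM; have u0 := up_const_gt0 p.
have M0 : 0 <= up_const p * M.
  rewrite mulr_ge0 ?(ltW u0) //; exact: le_trans (osc_energy_ge0 K mu f p1' 0) (HM 0%N).
have V0 : (0 <= Varp K d mu p f)%E.
  by apply: (le_limf_einf ltr01) => r _; exact: poweR_ge0.
rewrite -[in leRHS](powR_invK M0) -poweR_EFin; apply: le_poweR => //; first exact: ltW.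
rewrite /Varp (alpha_critE hK hd hmu p1'); apply: (limf_einf_le ltr01) => r /andP [r0 _].
rewrite -poweR_EFin; apply: le_poweR; rewrite ?invr_ge0 ?(ltW p0) //; first exact: Epa_ge0.
exact: Epa_le_osc_energy.
Qed.

Lemma energy_comparison : exists C1 C2 : R, [/\ 0 < C1, 0 < C2 &
  forall f, KS K d mu (alpha_vicsek p) p f ->
    exists2 g, continuous_version K mu f g &
      (C1%:E * (Varp K d mu p f `^ p) <= energy p g)%E /\
      (energy p g <= C2%:E * (Varp K d mu p f `^ p))%E].
Proof.
have c0 := liminf_const_gt0 p; have u0 := up_const_gt0 p.
have P0 : 0 < 2 `^ p :> R by rewrite powR_gt0.
set D1 := 81 * 2 `^ p * 2 `^ p * 2 `^ p; set D2 := 45 * 2 `^ p * 2 `^ p * 2 `^ p.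
have D10 : 0 < D1 by rewrite !mulr_gt0.
have uD0 : 0 < up_const p * D1 by apply: mulr_gt0.
have D20 : 0 < D2 by rewrite !mulr_gt0.
exists (up_const p * D1)^-1, (D2 * liminf_const p); split.
- by rewrite invr_gt0.
- by rewrite mulr_gt0.
move=> f hfKS; have [l _ Hl] := KS_liminf hK hd hmu p1' hfKS; have hf := hfKS.1.
set W := (Varp K d mu p f `^ p)%E.
have W0 : (0 <= W)%E by exact: poweR_ge0.
pose S := [set osc_energy K mu p f n | n in [set: nat]].
have hS : has_sup S.
  by split; [exists (osc_energy K mu p f 0), 0%N|exists (liminf_const p * l) => _ [n _ <-]].
have SM n : osc_energy K mu p f n <= sup S.
  by apply: ub_le_sup; [case: hS|exists n].
have [g [gc fg [B [t [t01 gB]]] gE]] := exists_continuous_version hK hmu p1 hf SM.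
exists g; first by split.
rewrite (energyE hK g p1'); set Eg := ereal_sup _.
have Eg_ub m : ((cell_energy p g m)%:E <= Eg)%E by apply: ereal_sup_ubound; exists m.
have EgD : (Eg <= (D2 * sup S)%:E)%E.
  by apply: ge_ereal_sup => _ [m _ <-]; rewrite lee_fin; exact: gE.
split.
  have [eg egE] : exists eg : R, Eg = eg%:E.
    have : (0 <= Eg)%E.
      apply: le_trans (Eg_ub 0%N); rewrite lee_fin mulr_ge0 ?exprn_ge0 ?(ltW (lam_gt0 p1')) //.
      by apply: sumr_ge0 => w _; apply: sumr_ge0 => i _; exact: powR_ge0.
    by move: EgD; case EgE : Eg => [e| |] // _ _; exists e.
  have ge m : cell_energy p g m <= eg by rewrite -lee_fin -egE.
  have := Varp_le hf (fun n => osc_energy_le_cell_energy hK hmu p1' hf n t01 fg gB ge).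
  rewrite -/W => H; rewrite egE lee_pdivrMl // -EFinM.
  apply: le_trans H _; rewrite lee_fin le_eqVlt; apply/orP; left; apply/eqP.
  by rewrite /D1; ring.
have HW n : ((osc_energy K mu p f n / liminf_const p)%:E <= W)%E by exact: Varp_ge.
apply: le_trans EgD _; move: W0 HW; case: W => [w| |] // w0 HW; last first.
  by rewrite gt0_muley ?leey // lte_fin mulr_gt0.
rewrite -EFinM lee_fin.
have -> : D2 * liminf_const p * w = D2 * (liminf_const p * w) by rewrite mulrA.
rewrite ler_pM2l //.
apply: ge_sup; first by case: hS.
by move=> _ [n _ <-]; have := HW n; rewrite lee_fin ler_pdivrMr // mulrC.
Qed.

End Comparison.

Theorem theorem6p3 (R : realType) (K : set (R * R))
    (d : R * R -> R * R -> R)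
    (mu : {measure set (borel_plane R) -> \bar R})
    (hK : is_vicsek_set K) (hd : is_geodesic_distance K d)
    (hmu : is_vicsek_measure K mu) :
  (forall p : R, 1 <= p -> propertyP K d mu p (alpha_crit K d mu p)) /\
  (forall p : R, 1 < p ->
     exists C1 C2 : R, [/\ 0 < C1, 0 < C2 &
       forall f, KS K d mu (alpha_crit K d mu p) p f ->
         exists2 g, continuous_version K mu f g &
           (C1%:E * (Varp K d mu p f `^ p) <= energy p g)%E /\
           (energy p g <= C2%:E * (Varp K d mu p f `^ p))%E]).
Proof.
split=> p p1.
  by rewrite alpha_critE //; exact: propertyP_vicsek.
by rewrite (alpha_critE hK hd hmu (ltW p1)); exact: energy_comparison.
Qed.
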